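(* Let $d$ be an odd prime, let $p$ be an odd prime with $p\neq d$, and let $q=p^r$ ($r\in\mathbb{Z}^+$) be such that $q\not\equiv 1 \pmod{d}$. Let $\lambda\in\mathbb{F}_q$ and let $X_\lambda^d$ be the Dwork hypersurface $$X_{\lambda}^d:\; x_1^d+x_2^d+\cdots+x_d^d=d\lambda\, x_1x_2\cdots x_d$$ in projective space $\mathbb{P}^{d-1}$. Then the number of $\mathbb{F}_q$-rational points on $X_\lambda^d$ is $$\#X_{\lambda}^d(\mathbb{F}_q)=\frac{q^{d-1}-1}{q-1}-{}_{d-1}G_{d-1}\left[\begin{array}{cccc}\frac{1}{d}, & \frac{2}{d}, & \ldots, & \frac{d-1}{d} \\ 0, & 0, & \ldots, & 0\end{array}\Big|\,\lambda^d\right]_q.$$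
   Context: Notation: for $x\in\mathbb{Q}$, $\lfloor x\rfloor$ is the greatest integer $\le x$ and $\langle x\rangle=x-\lfloor x\rfloor$. $\mathbb{Z}_p$ is the ring of $p$-adic integers, $\mathbb{Z}_q$ the ring of integers of the unramified extension of $\mathbb{Q}_p$ with residue field $\mathbb{F}_q$. $\omega:\mathbb{F}_q^\times\to\mathbb{Z}_q^\times$ is the Teichmüller character ($\omega(a)$ is the $(q-1)$-th root of unity congruent to $a$ mod $p$), $\overline{\omega}=\omega^{-1}$, and characters are extended by $\chi(0)=0$. $\Gamma_p$ is Morita's $p$-adic gamma function: $\Gamma_p(n)=(-1)^n\prod_{0<j<n,\,p\nmid j} j$ for $n\in\mathbb{Z}^+$, extended continuously to $\mathbb{Z}_p$ (with $\Gamma_p(0)=1$). McCarthy's function: for $t\in\mathbb{F}_q$, $n\in\mathbb{Z}^+$, and $a_i,b_i\in\mathbb{Q}\cap\mathbb{Z}_p$ ($1\le i\le n$), $${}_nG_n\left[\begin{array}{ccc}a_1,&\ldots,&a_n\\ b_1,&\ldots,&b_n\end{array}\Big|\,t\right]_q:=\frac{-1}{q-1}\sum_{j=0}^{q-2}(-1)^{jn}\,\overline{\omega}^j(t)\prod_{i=1}^n\prod_{k=0}^{r-1}(-p)^{-\lfloor\langle a_ip^k\rangle-\frac{jp^k}{q-1}\rfloor-\lfloor\langle -b_ip^k\rangle+\frac{jp^k}{q-1}\rfloor}\frac{\Gamma_p(\langle (a_i-\frac{j}{q-1})p^k\rangle)}{\Gamma_p(\langle a_ip^k\rangle)}\frac{\Gamma_p(\langle(-b_i+\frac{j}{q-1})p^k\rangle)}{\Gamma_p(\langle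 -b_ip^k\rangle)}.$$ *)

(* Defs.v *)
From HB Require Import structures.
From mathcomp Require Import all_boot all_order all_algebra.
From Stdlib Require Import ClassicalEpsilon.
Set Implicit Arguments. Unset Strict Implicit. Unset Printing Implicit Defensive.
Import Order.TTheory GRing.Theory Num.Theory.
Local Open Scope ring_scope.

(* Concrete models of F_q and of Z_q / p^(N+1) Z_q.                          *)
(* Given a monic integer polynomial f of degree r whose reduction mod p is  *)
(* irreducible, F_q = F_p[x]/(f) and Z_q = lim_N (Z/p^(N+1))[x]/(f).        *)

Definition fbar (p : nat) (f : {poly int}) : {poly 'F_p} :=
  map_poly (fun c : int => c%:~R) f.

Definition Fq (p : nat) (f : {poly int}) := {poly %/ fbar p f}.

Definition fN (p : nat) (f : {poly int}) (N : nat) : {poly 'Z_(p ^ N.+1)} :=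
  map_poly (fun c : int => c%:~R) f.

Definition GR (p : nat) (f : {poly int}) (N : nat) := {poly %/ fN p f N}.

Definition red (p : nat) (f : {poly int}) (N : nat) (x : GR p f N) : Fq p f :=
  in_qpoly (fbar p f)
    (map_poly (fun c : 'Z_(p ^ N.+1) => (nat_of_ord c)%:R : 'F_p) (x : {poly _})).

Definition teich (p r : nat) (f : {poly int}) (N : nat) (t : Fq p f) : GR p f N :=
  if t == 0 then 0 else
  odflt 0 [pick y : GR p f N | (y ^+ (p ^ r).-1 == 1) && (red y == t)].

Definition teichbar (p r : nat) (f : {poly int}) (N : nat) (t : Fq p f) : GR p f N :=
  if t == 0 then 0 else
  odflt 0 [pick y : GR p f N | y * teich r N t == 1].

(* the character overline(omega)^j evaluated at t, with chi(0) = 0 for all j *)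
Definition teichbar_pow (p r : nat) (f : {poly int}) (N : nat) (j : nat)
    (t : Fq p f) : GR p f N :=
  if t == 0 then 0 else teichbar r N t ^+ j.

Definition fracq (x : rat) : rat := x - (Num.floor x)%:~R.

Definition gammap_nat (p n : nat) : int :=
  (-1) ^+ n * \prod_(1 <= j < n | ~~ (p %| j)%N) (j%:Z).

(* Morita's p-adic Gamma function at x in Q (p-integral), modulo p^(N+1),   *)
(* defined as the continuous extension: the residue y such that             *)
(* Gamma_p(n) = y mod p^(N+1) for all positive integers n close enough to x.*)
Definition gammap (p N : nat) (x : rat) : 'Z_(p ^ N.+1) :=
  epsilon (inhabits 0) (fun y : 'Z_(p ^ N.+1) =>
    exists M : nat, forall n : nat, (0 < n)%N ->
      ((p ^ M)%:Z %| (n%:Z * denq x - numq x))%Z ->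
      (gammap_nat p n)%:~R = y).

(* One factor of McCarthy's function, for fixed i, k and j, multiplied by p *)
(* (the exponent e below always satisfies e >= -1).                         *)
Definition mc_factor (p r N : nat) (ai bi : rat) (j k : nat) : 'Z_(p ^ N.+1) :=
  let q := (p ^ r)%N in
  let pk : rat := (p ^ k)%:R in
  let x : rat := j%:R * pk / (q.-1)%:R in
  let e : int := - Num.floor (fracq (ai * pk) - x) - Num.floor (fracq (- bi * pk) + x) in
  exprz (-1 : 'Z_(p ^ N.+1)) e * (p%:R) ^+ absz (e + 1) *
  (gammap p N (fracq ((ai - j%:R / (q.-1)%:R) * pk)) / gammap p N (fracq (ai * pk))) *
  (gammap p N (fracq ((- bi + j%:R / (q.-1)%:R) * pk)) / gammap p N (fracq (- bi * pk))).

(* p^(n r) * nG_n[a; b | t]_q   computed modulo p^(N+1) in Z_q *)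
Definition mcG_scaled (p r : nat) (f : {poly int}) (n : nat) (a b : 'I_n -> rat)
    (N : nat) (t : Fq p f) : GR p f N :=
  let q := (p ^ r)%N in
  \sum_(j < q.-1)
    ((- ((q.-1)%:R : 'Z_(p ^ N.+1))^-1) * (-1) ^+ (j * n) *
       \prod_(i < n) \prod_(k < r) mc_factor p r N (a i) (b i) j k)
    *: teichbar_pow r N j t.

(* "nG_n[a; b | t]_q = z" (an equality in Q_q, z an integer): equivalently  *)
(* p^(n r) G = p^(n r) z in Z_q, i.e. modulo p^(N+1) for every N.           *)
Definition mcG_eq (p r : nat) (f : {poly int}) (n : nat) (a b : 'I_n -> rat)
    (t : Fq p f) (z : int) : Prop :=
  forall N : nat, mcG_scaled r a b N t = ((p ^ (n * r))%:Z * z)%:~R.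

Definition dwork_affine (p : nat) (f : {poly int}) (d : nat) (lam : Fq p f) :
    {set {ffun 'I_d -> Fq p f}} :=
  [set x : {ffun 'I_d -> Fq p f} | (x != 0) &&
     (\sum_(i < d) x i ^+ d == d%:R * lam * \prod_(i < d) x i)].

Definition dwork_points (p : nat) (f : {poly int}) (d : nat) (lam : Fq p f) :
    {set {set {ffun 'I_d -> Fq p f}}} :=
  [set [set ([ffun i => c * x i] : {ffun 'I_d -> Fq p f}) | c : Fq p f in [set c : Fq p f | c != 0]]
     | x : {ffun 'I_d -> Fq p f} in dwork_affine d lam].

(* Main.v *)
(** Sending x_i to y_i = x_i^d is a bijection of F_q since d is prime to q - 1,
so the affine cone becomes (sum y)^d = d^d lam^d prod y. Expanding the last
condition in the powers of the Teichmueller character omega expresses the point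
count through the Jacobi sums J_j of d equal characters, and it suffices to
identify each p^((d-1)r) omega(d)^(-dj) J_j with the j-th coefficient of
McCarthy's function modulo every power of p.

That is a Gross-Koblitz type formula. Adjoin pi with pi^(p-1) = - p; then
exp(pi (x - x^q)), evaluated at Teichmueller points, is an additive character
with values in a finite quotient of the ring of integers, so J_j is a quotient
of the Gauss sums g_j^d / g_(dj). Summing over x turns g_a into a sum of every
(q-1)-st coefficient of this series. If M is chosen so that a + (q - 1) M = a q^k,
an exact rational identity equates that sum to M! varpi^M / (q M + a)! up to terms
that vanish p-adically as k grows, thanks to Dwork's estimate on the coefficients.
The factorial ratio is a product of values of Gamma_p, and the reflection and
multiplication formulas for Gamma_p recover McCarthy's factors. *)

Require Import Defs.
From Stdlib Require Import ClassicalEpsilon.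
From HB Require Import structures.
From mathcomp Require Import all_boot all_order all_algebra.
From mathcomp Require Import fingroup cyclic finfield qfpoly boolp.
From mathcomp Require Import zify ring lra.
Set Implicit Arguments. Unset Strict Implicit. Unset Printing Implicit Defensive.
Import Order.TTheory GRing.Theory Num.Theory.
Local Open Scope ring_scope.

(** * Formal power series *)

Definition fps (R : Type) := nat -> R.

HB.instance Definition _ (R : choiceType) := Choice.copy (fps R) (nat -> R).

Section FpsZmodule.
Variable R : zmodType.
Implicit Types f g h : fps R.

Definition fps_zero : fps R := fun=> 0.
Definition fps_opp f : fps R := fun n => - f n.
Definition fps_add f g : fps R := fun n => f n + g n.

Lemma fps_addA : associative fps_add.
Proof. by move=> f g h; apply/funext => n; apply: addrA. Qed.

Lemma fps_addC : commutative fps_add.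
Proof. by move=> f g; apply/funext => n; apply: addrC. Qed.

Lemma fps_add0 : left_id fps_zero fps_add.
Proof. by move=> f; apply/funext => n; apply: add0r. Qed.

Lemma fps_addN : left_inverse fps_zero fps_opp fps_add.
Proof. by move=> f; apply/funext => n; apply: addNr. Qed.

HB.instance Definition _ := GRing.isZmodule.Build (fps R) fps_addA fps_addC fps_add0 fps_addN.

End FpsZmodule.

Section FpsRing.
Variable R : comNzRingType.
Implicit Types (f g h : fps R) (P : {poly R}).

Definition fps_of_poly P : fps R := fun n => P`_n.

Definition fps_mul f g : fps R := fun n => \sum_(i < n.+1) f i * g (n - i)%N.

Definition fps_trunc L f : {poly R} := \poly_(i < L) f i.

Lemma fps_mul_trunc L f g n : (n < L)%N -> fps_mul f g n = (fps_trunc L f * fps_trunc L g)`_n.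
Proof.
move=> ltnL; rewrite coefM; apply: eq_bigr => i _; rewrite !coef_poly.
by rewrite (leq_ltn_trans _ ltnL) ?(leq_ltn_trans (leq_subr _ _) ltnL) // -ltnS.
Qed.

Lemma fps_mulC : commutative fps_mul.
Proof. by move=> f g; apply/funext => n; rewrite !(@fps_mul_trunc n.+1) // mulrC. Qed.

Lemma fps_trunc_mul L f g h n : (n < L)%N ->
  fps_mul (fps_mul f g) h n = (fps_trunc L f * fps_trunc L g * fps_trunc L h)`_n.
Proof.
move=> ltnL; rewrite (fps_mul_trunc _ _ ltnL) !coefM; apply: eq_bigr => i _; congr (_ * _).
have ltiL : (i < L)%N by apply: leq_ltn_trans ltnL; rewrite -ltnS.
by rewrite coef_poly ltiL (fps_mul_trunc f g ltiL).
Qed.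

Lemma fps_mulA : associative fps_mul.
Proof.
move=> f g h; apply/funext => n.
by rewrite fps_mulC !(fps_trunc_mul _ _ _ (ltnSn n)) mulrC mulrA.
Qed.

Lemma fps_mul1 : left_id (fps_of_poly 1) fps_mul.
Proof.
move=> f; apply/funext => n.
rewrite /fps_mul big_ord_recl /= subn0 /fps_of_poly coef1 mul1r big1 ?addr0 // => i _.
by rewrite coef1 mul0r.
Qed.

Lemma fps_mulDl : left_distributive fps_mul +%R.
Proof.
move=> f g h; apply/funext => n; rewrite -[RHS]big_split.
by apply: eq_bigr => i _; apply: mulrDl.
Qed.

Lemma fps_oner_neq0 : fps_of_poly 1 != 0 :> fps R.
Proof.
apply/eqP => /(congr1 (fun f : fps R => f 0%N)); rewrite /fps_of_poly coef1 => /eqP.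
by rewrite (negPf (oner_neq0 R)).
Qed.

HB.instance Definition _ := GRing.Zmodule_isComNzRing.Build (fps R)
  fps_mulA fps_mulC fps_mul1 fps_mulDl fps_oner_neq0.

Lemma fpsD f g n : (f + g) n = f n + g n. Proof. by []. Qed.

Lemma fpsM f g n : (f * g) n = \sum_(i < n.+1) f i * g (n - i)%N. Proof. by []. Qed.

Lemma fps1 n : (1 : fps R) n = (n == 0%N)%:R. Proof. exact: coef1. Qed.

Lemma fps_of_poly_is_zmod_morphism : zmod_morphism fps_of_poly.
Proof. by move=> P Q; apply/funext => n; apply: coefB. Qed.

Lemma fps_of_poly_is_monoid_morphism : monoid_morphism fps_of_poly.
Proof. by split=> // P Q; apply/funext => n; apply: coefM. Qed.

HB.instance Definition _ :=
  GRing.isZmodMorphism.Build {poly R} (fps R) fps_of_poly fps_of_poly_is_zmod_morphism.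
HB.instance Definition _ :=
  GRing.isMonoidMorphism.Build {poly R} (fps R) fps_of_poly fps_of_poly_is_monoid_morphism.

Lemma fps_of_poly_inj : injective fps_of_poly.
Proof. by move=> P Q /funeqP PQ; apply/polyP. Qed.

Lemma fps_truncK L f : (forall n, (L <= n)%N -> f n = 0) -> fps_of_poly (fps_trunc L f) = f.
Proof.
move=> f0; apply/funext => n; rewrite /fps_of_poly coef_poly.
by case: ltnP => // /f0.
Qed.

Lemma fps_trunc_leq L L' f : (forall n, (L <= n)%N -> f n = 0) -> (L <= L')%N ->
  fps_trunc L' f = fps_trunc L f.
Proof.
move=> f0 leL; apply: fps_of_poly_inj; rewrite !fps_truncK // => n leLn.
by rewrite f0 // (leq_trans leL).
Qed.

Lemma coef_fps_monomM c j f n :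
  (fps_of_poly (c *: 'X^j) * f) n = if (j <= n)%N then c * f (n - j)%N else 0.
Proof.
rewrite fpsM /fps_of_poly; case: leqP => [lejn|ltnj].
  rewrite (bigD1 (Ordinal (lejn : (j < n.+1)%N))) //= coefZ coefXn eqxx mulr1 big1 ?addr0 // => i.
  by rewrite -val_eqE coefZ coefXn /= => /negPf ->; rewrite mulr0 mul0r.
rewrite big1 // => i _; rewrite coefZ coefXn ltn_eqF ?mulr0 ?mul0r //.
by apply: leq_ltn_trans ltnj; rewrite -ltnS.
Qed.

Definition fps_deriv f : fps R := fun n => f n.+1 *+ n.+1.

Lemma fps_derivM f g : fps_deriv (f * g) = fps_deriv f * g + f * fps_deriv g.
Proof.
apply/funext => n; rewrite /fps_deriv fpsD.
rewrite -[(f * g) _]/(fps_mul f g _) (@fps_mul_trunc n.+2) // -coef_deriv derivM coefD.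
have derivT h i : (i < n.+1)%N -> (fps_trunc n.+2 h)^`()`_i = h i.+1 *+ i.+1.
  by move=> lti; rewrite coef_deriv coef_poly ltnS lti.
congr (_ + _); rewrite coefM; apply: eq_bigr => i _; rewrite derivT ?coef_poly //.
- by rewrite (leq_ltn_trans (leq_subr _ _)).
- by rewrite (ltn_trans (ltn_ord i)).
by rewrite ltnS leq_subr.
Qed.

Lemma fps_deriv_poly P : fps_deriv (fps_of_poly P) = fps_of_poly P^`().
Proof. by apply/funext => n; rewrite /fps_deriv /fps_of_poly coef_deriv. Qed.

Lemma iter_fps_deriv k f n : iter k fps_deriv f n = f (n + k)%N *+ (n + k) ^_ k.
Proof.
elim: k n => [|k IHk] n; first by rewrite addn0.
by rewrite iterS /fps_deriv IHk addSnnS -mulrnA ffactnSr -addSnnS addnK.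
Qed.

Definition fps_scale s f : fps R := fun n => s ^+ n * f n.

Lemma fps_scaleM s f g : fps_scale s (f * g) = fps_scale s f * fps_scale s g.
Proof.
apply/funext => n; rewrite /fps_scale !fpsM mulr_sumr; apply: eq_bigr => i _.
have lein : (i <= n)%N by rewrite -ltnS.
by rewrite mulrACA -exprD subnKC.
Qed.

Lemma horner_fps_trunc L f x : (fps_trunc L f).[x] = \sum_(i < L) f i * x ^+ i.
Proof. exact: horner_poly. Qed.

Lemma horner_trunc_scale L s f x : (fps_trunc L (fps_scale s f)).[x] = (fps_trunc L f).[s * x].
Proof.
by rewrite !horner_fps_trunc; apply: eq_bigr => i _; rewrite exprMn mulrAC mulrA /fps_scale; ring.
Qed.

Definition fps_compXn k f : fps R := fun n => if (k %| n)%N then f (n %/ k)%N else 0.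

Lemma fps_compXn_comp k l f : (0 < k)%N ->
  fps_compXn k (fps_compXn l f) = fps_compXn (k * l) f.
Proof.
move=> k0; apply/funext => n; rewrite /fps_compXn.
case: (boolP (k %| n)%N) => [/dvdnP[m ->]|kn].
  by rewrite [(m * k)%N]mulnC dvdn_pmul2l // !mulKn // divnMl.
by case: ifP => // kln; case/negP: kn; apply: dvdn_trans kln; apply: dvdn_mulr.
Qed.

Lemma sum_fps_compXn k f n : (0 < k)%N ->
  \sum_(i < n.+1) fps_compXn k f i = \sum_(i < (n %/ k).+1) f i.
Proof.
move=> k0; elim: n => [|n IHn].
  by rewrite div0n !big_ord_recl !big_ord0 /fps_compXn dvdn0 div0n.
rewrite big_ord_recr /= IHn divnS // /fps_compXn; case: (boolP (k %| n.+1)%N) => kn.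
  by rewrite add1n [RHS]big_ord_recr /= divnS // kn add1n.
by rewrite addr0 add0n.
Qed.

Lemma fps_compXnM k f g : (0 < k)%N ->
  fps_compXn k (f * g) = fps_compXn k f * fps_compXn k g.
Proof.
move=> k0; apply/funext => n; rewrite fpsM {1}/fps_compXn; case: ifP => [/dvdnP[m ->]|kn].
  have := sum_fps_compXn (fun i => f i * g (m - i)%N) (m * k) k0; rewrite mulnK // fpsM => <-.
  apply: eq_bigr => i _; rewrite /fps_compXn; case: ifP => [/dvdnP[j ->]|_]; last by rewrite mul0r.
  by rewrite -mulnBl dvdn_mull // !mulnK.
apply/esym/big1 => i _; rewrite /fps_compXn; case: ifP => ki; rewrite ?mul0r //.
have lein : (i <= n)%N by rewrite -ltnS.
by case: ifP => kni; rewrite ?mulr0 //; rewrite -(subnK lein) dvdn_addl ?kni in kn.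
Qed.

End FpsRing.

Section DividedPowers.
Variables (R : comNzRingType) (e : fps R).

Definition divided_powers :=
  e 0%N = 1 /\ forall i j, e i * e j = 'C(i + j, i)%:R * e (i + j)%N.

(* The series e(s X^k); when the e n are the divided powers pi^n / n!, it is
   exp(pi s X^k). *)
Definition expX k s : fps R := fps_compXn k (fps_scale s e).

Lemma expXE k s n : (0 < k)%N -> expX k s (n * k)%N = s ^+ n * e n.
Proof. by move=> k0; rewrite /expX /fps_compXn dvdn_mull // mulnK. Qed.

Lemma coef0_expX k s : expX k s 0%N = e 0%N.
Proof. by rewrite /expX /fps_compXn dvdn0 div0n /fps_scale mul1r. Qed.

Lemma expX_ndvd k s n : ~~ (k %| n)%N -> expX k s n = 0.
Proof. by move=> kn; rewrite /expX /fps_compXn (negPf kn). Qed.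

Lemma expX1E s n : expX 1 s n = s ^+ n * e n.
Proof. by rewrite -[n in LHS]muln1 expXE. Qed.

Lemma fps_compXn_expX k l s : (0 < k)%N -> fps_compXn k (expX l s) = expX (k * l) s.
Proof. exact: fps_compXn_comp. Qed.

Lemma fps_scale_expX k s t : (0 < k)%N -> fps_scale s (expX k t) = expX k (s ^+ k * t).
Proof.
move=> k0; apply/funext => n; rewrite /fps_scale.
case: (boolP (k %| n)%N) => [/dvdnP[m ->]|kn]; last by rewrite !expX_ndvd ?mulr0.
by rewrite !expXE // exprMn mulrA -exprM mulnC.
Qed.

Hypothesis e_dp : divided_powers.

Lemma expX0 k : (0 < k)%N -> expX k 0 = 1.
Proof.
move=> k0; apply/funext => n; rewrite fps1.
case: (boolP (k %| n)%N) => [/dvdnP[[|m] ->]|kn].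
- by rewrite expXE // e_dp.1 mulr1.
- by rewrite expXE // expr0n mul0r gtn_eqF ?muln_gt0.
by rewrite expX_ndvd //; case: n kn => //; rewrite dvdn0.
Qed.

Lemma expXD k s t : (0 < k)%N -> expX k (s + t) = expX k s * expX k t.
Proof.
move=> k0; rewrite /expX -fps_compXnM //; congr fps_compXn; apply/funext => n.
rewrite fpsM /fps_scale [s + t]addrC exprDn mulr_suml; apply: eq_bigr => i _.
have lein : (i <= n)%N by rewrite -ltnS.
by rewrite mulrACA e_dp.2 subnKC // -mulr_natl; ring.
Qed.

Lemma fps_deriv_expX k s : (0 < k)%N ->
  fps_deriv (expX k s) = fps_of_poly ((k%:R * s * e 1%N) *: 'X^(k.-1)) * expX k s.
Proof.
move=> k0; apply/funext => n; rewrite coef_fps_monomM /fps_deriv.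
have coefS m : e m.+1 *+ m.+1 = e 1%N * e m by rewrite e_dp.2 add1n bin1 mulr_natl.
case: (boolP (k %| n.+1)%N) => [/dvdnP[[|m] nE]|kn] //.
  have -> : (k.-1 <= n)%N by lia.
  have -> : (n - k.-1 = m * k)%N by lia.
  rewrite nE !expXE // mulrnA -mulrnAr coefS -mulr_natl exprS; ring.
rewrite expX_ndvd // mul0rn; case: leqP => // le_kn; rewrite expX_ndvd ?mulr0 //.
by apply: contra kn => kn; rewrite -[n.+1](_ : n - k.-1 + k = _)%N ?dvdn_addl //; lia.
Qed.

End DividedPowers.

(** * Rational numbers integral at p *)

Definition pint_pred (p : nat) (x : rat) := coprime p `|denq x|.

Definition pint (p : nat) := [qualify a x : rat | pint_pred p x].

Section PIntegral.
Variable p : nat.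
Implicit Types x y : rat.

Lemma pintP x :
  reflect (exists (a : int) (b : nat), coprime p b /\ x * b%:R = a%:~R) (x \is a pint p).
Proof.
apply: (iffP idP) => [px|[a [b [pb xb]]]].
  by exists (numq x), `|denq x|%N; rewrite pmulrn absz_denq -numqE.
apply: coprime_dvdr pb.
have /eqP : (numq x)%:~R * (b%:R : rat) = (a * denq x)%:~R.
  by rewrite numqE intrM -xb; ring.
rewrite pmulrn -intrM eqr_int => /eqP numE.
have : (denq x %| numq x * b)%Z by rewrite numE dvdz_mull.
by rewrite Gauss_dvdzr // coprimezE coprime_sym coprime_num_den.
Qed.

Lemma pint_subring_closed : subring_closed (pint p).
Proof.
split=> [|x y /pintP[a [b [pb xb]]] /pintP[c [d [pd yd]]]|x y /pintP[a [b [pb xb]]] /pintP[c [d [pd yd]]]].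
- by apply/pintP; exists 1, 1%N; rewrite coprimen1 mulr1.
- apply/pintP; exists (a * d%:Z - c * b%:Z), (b * d)%N; rewrite coprimeMr pb pd; split=> //.
  by rewrite natrM intrB !intrM -xb -yd -!pmulrn; ring.
apply/pintP; exists (a * c), (b * d)%N; rewrite coprimeMr pb pd; split=> //.
by rewrite natrM intrM -xb -yd; ring.
Qed.

HB.instance Definition _ := GRing.isSubringClosed.Build rat (pint_pred p) pint_subring_closed.

Lemma pintV (b : nat) : (0 < b)%N -> coprime p b -> b%:R^-1 \is a pint p.
Proof. by move=> b0 pb; apply/pintP; exists 1, b; rewrite mulVf // pnatr_eq0 -lt0n. Qed.

Lemma pint_leX m n x : (m <= n)%N -> p%:R ^+ m * x \is a pint p -> p%:R ^+ n * x \is a pint p.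
Proof. by move=> lemn px; rewrite -(subnK lemn) exprD -mulrA rpredM ?rpredX ?rpred_nat. Qed.

End PIntegral.

Lemma natr_prime_neq0 p : prime p -> p%:R != 0 :> rat.
Proof. by move=> p_pr; rewrite pnatr_eq0 -lt0n prime_gt0. Qed.

Lemma pint_pfactorV p b : prime p -> (0 < b)%N -> p%:R ^+ logn p b / b%:R \is a pint p.
Proof.
move=> p_pr b0; have [c pc bE] := pfactor_coprime p_pr b0.
have c0 : (0 < c)%N by move: b0; rewrite bE muln_gt0 => /andP[].
by rewrite {2}bE natrM natrX invfM mulrCA divff ?mulr1 ?pintV ?expf_neq0 ?natr_prime_neq0.
Qed.

Section Congruence.
Variables (p : nat) (p_gt1 : (1 < p)%N).
Implicit Types x y z c : rat.

Definition pcong n x y := (x - y) / p%:R ^+ n \is a pint p.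

Let pX_neq0 n : p%:R ^+ n != 0 :> rat.
Proof. by rewrite expf_neq0 // pnatr_eq0 -lt0n ltnW. Qed.

Lemma pcong_refl n x : pcong n x x.
Proof. by rewrite /pcong subrr mul0r rpred0. Qed.

Lemma pcong_sym n x y : pcong n x y -> pcong n y x.
Proof. by rewrite /pcong => xy; rewrite -opprB mulNr rpredN. Qed.

Lemma pcong_trans n x y z : pcong n x y -> pcong n y z -> pcong n x z.
Proof.
rewrite /pcong => xy yz; have -> : x - z = (x - y) + (y - z) by ring.
by rewrite mulrDl rpredD.
Qed.

Lemma pcongMl n c x y : c \is a pint p -> pcong n x y -> pcong n (c * x) (c * y).
Proof. by move=> pc xy; rewrite /pcong -mulrBr -mulrA rpredM. Qed.

Lemma pcongDl n c x y : pcong n x y -> pcong n (c + x) (c + y).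
Proof. by rewrite /pcong => xy; have -> : c + x - (c + y) = x - y by ring. Qed.

Lemma pcongBl n c x y : pcong n x y -> pcong n (c - x) (c - y).
Proof. by move=> xy; apply: pcongDl; rewrite /pcong -opprD mulNr rpredN. Qed.

Lemma pcong_leX m n x y : (m <= n)%N -> pcong n x y -> pcong m x y.
Proof.
move=> lemn xy; rewrite /pcong -[(_ - _) / _](_ : p%:R ^+ (n - m) * ((x - y) / p%:R ^+ n) = _).
  by rewrite rpredM ?rpredX ?rpred_nat.
by rewrite -[in p%:R ^+ n](subnK lemn) exprD; field; rewrite !pX_neq0.
Qed.

Lemma pcong_pint n x y : y \is a pint p -> pcong n x y -> x \is a pint p.
Proof.
move=> py xy; have -> : x = (x - y) / p%:R ^+ n * p%:R ^+ n + y by rewrite divfK // subrK.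
by rewrite rpredD // rpredM // rpredX // rpred_nat.
Qed.

Lemma pcong_int n (a b : int) : pcong n a%:~R b%:~R = ((p ^ n)%:Z %| a - b)%Z.
Proof.
rewrite /pcong -intrB; move: (a - b) => {a b} a.
apply/pintP/dvdzP => [[c [b [pb quotE]]]|[c ->]]; last first.
  by exists c, 1%N; rewrite coprimen1 mulr1 intrM -pmulrn natrX mulfK.
have /eqP : (a * b%:Z)%:~R = ((p ^ n)%:Z * c)%:~R :> rat.
  by rewrite !intrM -quotE -!pmulrn natrX; field.
rewrite eqr_int => /eqP abE; apply/dvdzP.
have : ((p ^ n)%:Z %| a * b%:Z)%Z by rewrite abE dvdz_mulr.
by rewrite Gauss_dvdzl // coprimezE /= coprimeXl.
Qed.

Lemma pcong_nat n (a b : nat) : pcong n a%:R b%:R = ((p ^ n)%:Z %| a%:Z - b%:Z)%Z.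
Proof. by rewrite !pmulrn pcong_int. Qed.

Lemma pcong_nat_exists n x : x \is a pint p -> exists2 m : nat, (0 < m)%N & pcong n x m%:R.
Proof.
move=> /pintP[a [b [pb xb]]].
have cop : coprimez (p ^ n)%:Z b%:Z by rewrite coprimezE /= coprimeXl.
have [u [v]] := Bezoutz (p ^ n)%:Z b%:Z; rewrite (eqP cop) => uv.
have pn_gt0 : (0 < p ^ n)%N by rewrite expn_gt0 ltnW.
pose t : int := ((a * v) %/ (p ^ n)%:Z)%Z.
have [m m_gt0 mE] : exists2 m : nat, (0 < m)%N & m%:Z = a * v + (p ^ n)%:Z * (1 - t).
  exists (`|(a * v) %% (p ^ n)%:Z|%Z + p ^ n)%N; first by rewrite addn_gt0 pn_gt0 orbT.
  rewrite PoszD gez0_abs; last by apply: modz_ge0; lia.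
  by rewrite [in RHS](divz_eq (a * v) (p ^ n)%:Z); ring.
exists m => //; apply/pintP; exists (a * u - b%:Z * (1 - t)), b; split=> //.
apply: (mulIf (pX_neq0 n)); rewrite mulrAC divfK // mulrBl xb [m%:R]pmulrn mE.
have -> : a%:~R = (a * (u * (p ^ n)%:Z + v * b%:Z))%:~R :> rat by rewrite uv mulr1.
by rewrite !(intrD, intrM, intrB, rmorphN) /= -!pmulrn -natrX; ring.
Qed.

End Congruence.

Section Reduction.
Variables (p N : nat) (p_gt1 : (1 < p)%N).
Implicit Types x y : rat.
Local Notation Z := 'Z_(p ^ N.+1).

Lemma expnS_gt1 : (1 < p ^ N.+1)%N.
Proof. by rewrite -(expn0 p) ltn_exp2l. Qed.

Lemma natr_unit_Zpn (b : nat) : coprime p b -> (b%:R : Z) \is a GRing.unit.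
Proof. by move=> pb; rewrite unitZpE ?expnS_gt1 // coprimeXl. Qed.

Lemma natrXS_Zpn : (p%:R : Z) ^+ N.+1 = 0.
Proof. by rewrite -natrX pchar_Zp ?expnS_gt1. Qed.

Definition Zpn_rat x : Z := (numq x)%:~R / (denq x)%:~R.

Lemma Zpn_ratE x (a : int) (b : nat) : coprime p b -> x * b%:R = a%:~R ->
  Zpn_rat x = a%:~R / b%:R.
Proof.
move=> pb xb; have px : x \is a pint p by apply/pintP; exists a, b.
have ub := natr_unit_Zpn pb.
have ud : ((denq x)%:~R : Z) \is a GRing.unit by rewrite -absz_denq -pmulrn natr_unit_Zpn.
apply: (mulIr ud); rewrite /Zpn_rat mulrVK // mulrAC; apply: (mulIr ub); rewrite mulrVK //.
have /eqP : (numq x)%:~R * (b%:R : rat) = (a * denq x)%:~R.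
  by rewrite numqE intrM -xb; ring.
rewrite pmulrn -intrM eqr_int => /eqP numE.
by rewrite pmulrn -!intrM numE.
Qed.

Lemma Zpn_rat_int (a : int) : Zpn_rat a%:~R = a%:~R.
Proof. by rewrite /Zpn_rat numq_int denq_int divr1. Qed.

Lemma Zpn_rat_nat (a : nat) : Zpn_rat a%:R = a%:R.
Proof. by rewrite pmulrn Zpn_rat_int -pmulrn. Qed.

Lemma Zpn_ratD x y : x \is a pint p -> y \is a pint p ->
  Zpn_rat (x + y) = Zpn_rat x + Zpn_rat y.
Proof.
move=> /pintP[a [b [pb xb]]] /pintP[c [d [pd yd]]].
have pbd : coprime p (b * d) by rewrite coprimeMr pb.
have xyE : (x + y) * (b * d)%:R = (a * d%:Z + c * b%:Z)%:~R.
  by rewrite natrM intrD !intrM -xb -yd -!pmulrn; ring.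
rewrite (Zpn_ratE pb xb) (Zpn_ratE pd yd) (Zpn_ratE pbd xyE).
have [ub ud] := (natr_unit_Zpn pb, natr_unit_Zpn pd).
rewrite natrM invrM // intrD !intrM -!pmulrn mulrDl mulrA mulrK //; congr (_ + _).
by rewrite [_^-1 / _]mulrC mulrA mulrK.
Qed.

Lemma Zpn_ratM x y : x \is a pint p -> y \is a pint p ->
  Zpn_rat (x * y) = Zpn_rat x * Zpn_rat y.
Proof.
move=> /pintP[a [b [pb xb]]] /pintP[c [d [pd yd]]].
have pbd : coprime p (b * d) by rewrite coprimeMr pb.
have xyE : (x * y) * (b * d)%:R = (a * c)%:~R by rewrite natrM intrM -xb -yd; ring.
rewrite (Zpn_ratE pb xb) (Zpn_ratE pd yd) (Zpn_ratE pbd xyE).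
by rewrite natrM invrM ?natr_unit_Zpn // intrM [_^-1 / _]mulrC mulrACA.
Qed.

Lemma Zpn_ratN x : x \is a pint p -> Zpn_rat (- x) = - Zpn_rat x.
Proof.
by move=> px; rewrite -mulN1r Zpn_ratM ?rpredN1 // (Zpn_rat_int (-1)) mulN1r.
Qed.

Lemma Zpn_ratX x n : x \is a pint p -> Zpn_rat (x ^+ n) = Zpn_rat x ^+ n.
Proof.
move=> px; elim: n => [|n IHn]; first by rewrite !expr0 (Zpn_rat_nat 1).
by rewrite !exprS Zpn_ratM ?IHn // rpredX.
Qed.

Lemma Zpn_rat_sum (I : Type) (s : seq I) (P : pred I) (F : I -> rat) :
  (forall i, P i -> F i \is a pint p) ->
  Zpn_rat (\sum_(i <- s | P i) F i) = \sum_(i <- s | P i) Zpn_rat (F i).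
Proof.
move=> pF; elim: s => [|i s IHs]; first by rewrite !big_nil (Zpn_rat_nat 0).
by rewrite !big_cons; case: ifP => // Pi; rewrite -IHs Zpn_ratD ?pF ?rpred_sum.
Qed.

Lemma Zpn_ratV (b : nat) : (0 < b)%N -> coprime p b -> Zpn_rat b%:R^-1 = b%:R^-1.
Proof.
move=> b0 pb; rewrite (@Zpn_ratE _ 1 b) ?mul1r //.
by rewrite mulVf // pnatr_eq0 -lt0n.
Qed.

Lemma Zpn_rat_expM x : x \is a pint p -> Zpn_rat (p%:R ^+ N.+1 * x) = 0.
Proof.
by move=> px; rewrite Zpn_ratM ?Zpn_ratX ?Zpn_rat_nat ?natrXS_Zpn ?mul0r ?rpredX ?rpred_nat.
Qed.

Lemma Zpn_rat_cong x y : y \is a pint p -> pcong p N.+1 x y -> Zpn_rat x = Zpn_rat y.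
Proof.
move=> py xy; have -> : x = y + p%:R ^+ N.+1 * ((x - y) / p%:R ^+ N.+1).
  by rewrite mulrC divfK ?expf_neq0 ?pnatr_eq0 -?lt0n ?(ltnW p_gt1) // addrC subrK.
by rewrite Zpn_ratD ?Zpn_rat_expM ?addr0 // rpredM ?rpredX ?rpred_nat.
Qed.

End Reduction.

(** * Factorials *)

Definition geom b k := (\sum_(i < k) b ^ i)%N.

Lemma geomE b k : (0 < b)%N -> ((b - 1) * geom b k = b ^ k - 1)%N.
Proof. by move=> b0; rewrite !subn1 predn_exp. Qed.

Lemma geomS b k : (geom b k.+1 = b * geom b k + 1)%N.
Proof.
rewrite /geom big_ord_recl expn0 addnC big_distrr; congr (_ + _)%N.
by apply: eq_bigr => i _; rewrite /= -expnS.
Qed.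

Section FactorialValuation.
Variables (p : nat) (p_pr : prime p).
Let p_gt0 := prime_gt0 p_pr.
Let p_gt1 := prime_gt1 p_pr.

Definition pfact n := (\prod_(1 <= j < n.+1 | ~~ (p %| j)) j)%N.

Lemma coprime_pfact n : coprime p (pfact n).
Proof.
rewrite /pfact; elim/big_rec: _ => [|j x pj px]; first exact: coprimen1.
by rewrite coprimeMr px prime_coprime // pj.
Qed.

Lemma pfact_gt0 n : (0 < pfact n)%N.
Proof. by rewrite prodn_cond_gt0 // => j; case: j => //; rewrite dvdn0. Qed.

Lemma fact_pfact n : (n`! = p ^ (n %/ p) * (n %/ p)`! * pfact n)%N.
Proof.
elim: n => [|n IHn]; first by rewrite div0n /pfact big_geq.
rewrite factS /pfact big_mkcond big_nat_recr //= -big_mkcond -/(pfact n) IHn.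
rewrite divnS //; case: (boolP (p %| n.+1)%N) => pn /=; last by rewrite add0n; ring.
have -> : (n.+1 = p * (n %/ p).+1)%N.
  by rewrite -{1}(divnK pn) divnS // pn add1n mulnC.
by rewrite add1n factS expnS; ring.
Qed.

Lemma logn_fact_div n : logn p n`! = (n %/ p + logn p (n %/ p)`!)%N.
Proof.
rewrite {1}fact_pfact mulnC logn_Gauss ?coprime_pfact //.
by rewrite lognM ?expn_gt0 ?p_gt0 ?fact_gt0 // pfactorK.
Qed.

Lemma logn_fact_le n : ((p - 1) * logn p n`! <= n)%N.
Proof.
elim/ltn_ind: n => -[|n] IHn; first by rewrite fact0 logn1 muln0.
rewrite logn_fact_div mulnDr; have := IHn (n.+1 %/ p)%N; rewrite ltn_Pdiv // => /(_ isT).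
have := leq_divM n.+1 p; nia.
Qed.

Lemma logn_fact_ge t n : ((p ^ t - 1) * n <= p ^ t * ((p - 1) * (logn p n`! + t)))%N.
Proof.
elim: t n => [|t IHt] n; first by rewrite expn0 mul1n.
rewrite logn_fact_div; have := IHt (n %/ p)%N.
have : (n <= n %/ p * p + (p - 1))%N.
  by rewrite {1}(divn_eq n p) leq_add2l; have := ltn_pmod n p_gt0; lia.
have : (0 < p ^ t)%N by rewrite expn_gt0 p_gt0.
move: (n %/ p)%N => m; move: (logn p m`!) => v; rewrite expnS; case: (p ^ t)%N => // P _ le_n IHm.
have {}IHm : (p * (P * m) <= p * P.+1 * (p - 1) * (v + t))%N.
  by have := leq_mul (leqnn p) IHm; rewrite subSS subn0; lia.
apply: (@leq_trans ((p * P.+1 - 1) * (m * p + (p - 1)))); first by rewrite leq_mul2l le_n orbT.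
have -> : (p * P.+1 - 1 = p * P + (p - 1))%N by nia.
have -> : (p * P.+1 * ((p - 1) * (m + v + t.+1))
  = p * P.+1 * (p - 1) * (m + 1) + p * P.+1 * (p - 1) * (v + t))%N by ring.
apply: leq_trans (leq_add (leqnn _) IHm).
have [s ->] : exists s, p = s.+1 by exists p.-1; lia.
rewrite subSS subn0; nia.
Qed.

Lemma logn_fact_geK K n : (0 < K)%N -> ((K - 1) * n <= K * ((p - 1) * (logn p n`! + K)))%N.
Proof.
move=> K0; have ltKP : (K < p ^ K)%N by apply: ltn_expl.
have P0 : (0 < p ^ K)%N by apply: leq_ltn_trans ltKP.
rewrite -(leq_pmul2l P0) [X in (_ <= X)%N]mulnCA.
apply: leq_trans (leq_mul (leqnn K) (logn_fact_ge K n)).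
by rewrite !mulnA leq_mul2r !mulnBr !muln1 [(K * _)%N]mulnC leq_sub2l ?orbT // ltnW.
Qed.

Lemma leq_logn_fact m n : (m <= n)%N -> (logn p m`! <= logn p n`!)%N.
Proof. by move=> le_mn; rewrite dvdn_leq_log ?fact_gt0 // -(bin_fact le_mn) mulnCA dvdn_mulr. Qed.

End FactorialValuation.

Lemma fact_dvd_prodz n (x : int) : (n`!%:Z %| \prod_(i < n) (x - i%:Z))%Z.
Proof.
elim: n x => [|n IHn] x; first by rewrite dvd1z.
have shift y : \prod_(i < n.+1) (y + 1 - i%:Z) =
    \prod_(i < n.+1) (y - i%:Z) + n.+1%:Z * \prod_(i < n) (y - i%:Z).
  rewrite big_ord_recl [X in _ = X + _]big_ord_recr /= subr0.
  rewrite (eq_bigr (fun i : 'I_n => y - i%:Z)) => [|i _]; first by ring.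
  by rewrite /bump add1n; ring.
have dvd_last y : (n.+1`!%:Z %| n.+1%:Z * \prod_(i < n) (y - i%:Z))%Z.
  by rewrite factS PoszM dvdz_mul.
elim/int_rec: x => [|m IHm|m IHm].
- by rewrite big_ord_recl subrr mul0r dvdz0.
- by rewrite intS addrC shift rpredD.
have := shift (- m.+1%:Z); rewrite (_ : - m.+1%:Z + 1 = - m%:Z); last by lia.
by move/esym/eqP; rewrite eq_sym -subr_eq => /eqP <-; rewrite rpredB.
Qed.

Definition inv_fact : fps rat := fun n => n`!%:R^-1.

Lemma natr_fact_neq0 n : n`!%:R != 0 :> rat.
Proof. by rewrite pnatr_eq0 -lt0n fact_gt0. Qed.

Lemma inv_fact_divided_powers : divided_powers inv_fact.
Proof.
split=> [|i j]; first by rewrite /inv_fact fact0 invr1.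
apply: (mulIf (natr_fact_neq0 (i + j))); rewrite /inv_fact -[RHS]mulrA mulVf ?natr_fact_neq0 // mulr1.
have := @bin_fact (i + j) i (leq_addr _ _); rewrite addKn => <-.
by rewrite !natrM; field; rewrite !natr_fact_neq0.
Qed.

(** * Growth of the coefficients of Dwork's exponential *)

Section DworkExponential.
Variable p : nat.

(* exp(X + X^p / p). *)
Definition theta : fps rat := expX inv_fact 1 1 * expX inv_fact p p%:R^-1.

Fixpoint theta_dpoly k : {poly int} :=
  if k is k'.+1 then (theta_dpoly k')^`() + theta_dpoly k' * (1 + 'X^(p.-1)) else 1.

(* Applying d/dX p times to theta multiplies it by an integral polynomial whose
   constant term 1 + (p-1)! is divisible by p: this gains a factor p over the
   trivial bound once every p + 1 steps. *)
Definition theta_bound n := (logn p (n %/ p)`! + n %/ p.+1)%N.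

(* v_p(g n) >= - (1 - 1/K) n / (p - 1), so that pi^n g_n tends to 0. *)
Definition decay K (g : fps rat) :=
  forall n, p%:R ^+ (((K - 1) * n) %/ (K * (p - 1))) * g n \is a pint p.

Definition varpi r : rat := (- p%:R) ^+ geom p r.

(* exp(X - X^q / varpi) with q = p^r, which becomes exp(pi (X - X^q)) after
   X := pi X, because varpi = pi^(q-1). *)
Definition dwork r : fps rat := expX inv_fact 1 1 * expX inv_fact (p ^ r) (- (varpi r)^-1).

Hypothesis p_pr : prime p.
Let p_gt0 := prime_gt0 p_pr.
Let p_gt1 := prime_gt1 p_pr.
Let p_neq0 := natr_prime_neq0 p_pr.

Local Notation ratp := (map_poly (intr : int -> rat)).

Lemma fps_deriv_theta : fps_deriv theta = fps_of_poly (ratp (1 + 'X^(p.-1))) * theta.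
Proof.
rewrite fps_derivM !(fps_deriv_expX inv_fact_divided_powers) // /inv_fact invr1 !mulr1 divff //.
by rewrite !scale1r expr0 [ratp _]rmorphD rmorph1 /= map_polyXn rmorphD /= /theta; ring.
Qed.

Lemma iter_fps_deriv_theta k :
  iter k (@fps_deriv rat) theta = fps_of_poly (ratp (theta_dpoly k)) * theta.
Proof.
elim: k => [|k IHk]; first by rewrite rmorph1 rmorph1 mul1r.
rewrite iterS IHk fps_derivM fps_deriv_poly deriv_map fps_deriv_theta /=.
by rewrite !(rmorphD, rmorphM) /=; ring.
Qed.

Lemma theta_rec k n :
  theta (n + k)%N *+ (n + k) ^_ k =
  \sum_(i < n.+1) ((theta_dpoly k)`_i)%:~R * theta (n - i)%N.
Proof.
rewrite -iter_fps_deriv iter_fps_deriv_theta fpsM; apply: eq_bigr => i _.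
by rewrite /fps_of_poly coef_map.
Qed.

Lemma theta_lt n : (n < p)%N -> theta n = n`!%:R^-1.
Proof.
move=> ltnp; rewrite /theta mulrC fpsM big_ord_recl /= subn0 coef0_expX expX1E.
rewrite expr1n mul1r [inv_fact 0%N]invr1 mul1r big1 ?addr0 // => i _.
by rewrite expX_ndvd ?mul0r // gtnNdvd // (leq_ltn_trans _ ltnp).
Qed.

Lemma theta_p : theta p = p`!%:R^-1 + p%:R^-1.
Proof.
rewrite /theta mulrC fpsM big_ord_recr (bigD1 (Ordinal p_gt0)) //= subn0 subnn.
rewrite !coef0_expX -[X in expX _ p _ X](mul1n p) expXE // expX1E big1 ?addr0 => [|i].
  by rewrite /inv_fact fact0 invr1 expr1n !mul1r !mulr1.
by rewrite -val_eqE /= => i0; rewrite expX_ndvd ?mul0r // gtnNdvd ?lt0n.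
Qed.

Lemma theta_dpoly_dvd : (p%:Z %| (theta_dpoly p)`_0)%Z.
Proof.
have := theta_rec p 0; rewrite add0n theta_p big_ord_recl big_ord0 addr0 subnn.
rewrite theta_lt // invr1 mulr1 ffactnn -[X in X = _]mulr_natl mulrDr mulfV ?natr_fact_neq0 //.
have -> : (p`!%:R * p%:R^-1 : rat) = (p.-1)`!%:R.
  by rewrite -{1}(prednK p_gt0) factS (prednK p_gt0) natrM mulrC mulKf.
rewrite addrC natr1 pmulrn => /eqP; rewrite eqr_int => /eqP <-.
by rewrite dvdzE /= -Wilson.
Qed.

Lemma divn_subp n : (p <= n)%N -> (n %/ p = ((n - p) %/ p).+1)%N.
Proof. by move=> le_pn; rewrite -{1}(subnK le_pn) divnDr ?dvdnn // divnn p_gt0 addn1. Qed.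

Lemma ffact_pfact n : (p <= n)%N -> (n ^_ p * pfact p (n - p) = p * (n %/ p) * pfact p n)%N.
Proof.
move=> le_pn; have quotE := divn_subp le_pn; set m := ((n - p) %/ p)%N in quotE.
have pm_gt0 : (0 < p ^ m * m`!)%N by rewrite muln_gt0 expn_gt0 p_gt0 fact_gt0.
apply/eqP; rewrite -(eqn_pmul2l pm_gt0) mulnCA -fact_pfact // ffact_fact // (fact_pfact p_pr n).
by rewrite quotE factS expnS; apply/eqP; ring.
Qed.

Lemma theta_quot n : (p <= n)%N ->
  theta n = (pfact p (n - p))%:R / (pfact p n)%:R / (n %/ p)%:R *
    (p%:R^-1 * \sum_(i < (n - p).+1) ((theta_dpoly p)`_i)%:~R * theta (n - p - i)%N).
Proof.
move=> le_pn; have := theta_rec p (n - p); rewrite subnK // => <-.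
have pfact_neq0 m : (pfact p m)%:R != 0 :> rat by rewrite pnatr_eq0 -lt0n pfact_gt0.
have quot_neq0 : (n %/ p)%:R != 0 :> rat by rewrite pnatr_eq0 -lt0n divn_gt0.
have /(congr1 (fun m : nat => m%:R : rat)) := ffact_pfact le_pn.
rewrite !natrM => /(canRL (mulfK (pfact_neq0 _))) ffactE.
by rewrite -[theta n *+ _]mulr_natl ffactE; field; rewrite !pfact_neq0 p_neq0 quot_neq0.
Qed.

Lemma theta_bound_lt k n : (k + p < n)%N ->
  (logn p (n %/ p) + theta_bound k < theta_bound n)%N.
Proof.
move=> lt_kn; have le_pn : (p <= n)%N by apply: leq_trans (ltnW lt_kn); rewrite leq_addl.
rewrite /theta_bound divn_subp // factS lognM ?fact_gt0 // -addnA -addnS -addnS leq_add2l.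
apply: leq_add; first by apply: leq_logn_fact; apply: leq_div2r; lia.
have -> : ((k %/ p.+1).+1 = (k + p.+1) %/ p.+1)%N by rewrite divnDr ?dvdnn // divnn addn1.
by rewrite leq_div2r // addnS.
Qed.

Lemma theta_bound_sub n : (p <= n)%N ->
  (logn p (n %/ p) + theta_bound (n - p) <= theta_bound n)%N.
Proof.
move=> le_pn; rewrite /theta_bound divn_subp // factS lognM ?fact_gt0 // -addnA leq_add2l.
by rewrite leq_add2l leq_div2r ?leq_subr.
Qed.

Lemma theta_pint n : p%:R ^+ theta_bound n * theta n \is a pint p.
Proof.
elim/ltn_ind: n => n IHn; have [ltnp|le_pn] := ltnP n p.
  rewrite theta_lt // rpredM ?rpredX ?rpred_nat // pintV ?fact_gt0 //.
  by rewrite (fact_pfact p_pr) divn_small // expn0 !mul1n coprime_pfact.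
have le_bound : (logn p (n %/ p) <= theta_bound n)%N.
  by apply: leq_trans (theta_bound_sub le_pn); rewrite leq_addr.
rewrite theta_quot // -{1}(subnK le_bound) addnC exprD; set S := \sum_(i < _) _.
have -> : forall u v w x y z : rat, u * v * (w * x * y * (z * S)) = w * x * (u * y) * (v * (z * S)).
  by move=> *; ring.
apply: rpredM.
  by rewrite rpredM ?pint_pfactorV ?divn_gt0 // rpredM ?rpred_nat ?pintV ?pfact_gt0 ?coprime_pfact.
rewrite mulrCA /S mulr_sumr big_ord_recl /= subn0 mulrDr; apply: rpredD.
  have /dvdzP[c ->] := theta_dpoly_dvd; rewrite intrM.
  have -> : forall u v : rat, p%:R^-1 * (u * (c%:~R * p%:~R * v)) = c%:~R * (u * v).
    by move=> u v; rewrite -pmulrn; field.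
  rewrite rpredM ?rpred_int //; apply: pint_leX (IHn (n - p)%N _); last by lia.
  by have := theta_bound_sub le_pn; lia.
rewrite mulr_sumr rpred_sum // => i _; rewrite mulrA mulrCA rpredM ?rpred_int //.
have lt_kn : ((n - p - bump 0 i) + p < n)%N by have := ltn_ord i; rewrite /bump leq0n; lia.
have := theta_bound_lt lt_kn; move: (n - p - _)%N lt_kn => k lt_kn lt_b.
have -> : (theta_bound n - logn p (n %/ p) = (theta_bound n - logn p (n %/ p)).-1.+1)%N by lia.
rewrite exprS mulKf //; apply: pint_leX (IHn k _); lia.
Qed.

Lemma decay_mul K f g : (0 < K)%N -> decay K f -> decay K g -> decay K (f * g).
Proof.
move=> K0 df dg n; rewrite fpsM mulr_sumr rpred_sum // => i _.
have lein : (i <= n)%N by rewrite -ltnS.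
set D := (K * (p - 1))%N; have D0 : (0 < D)%N by rewrite muln_gt0 K0 subn_gt0.
apply: (@pint_leX _ (((K - 1) * i) %/ D + ((K - 1) * (n - i)) %/ D)).
  have -> : ((K - 1) * n = (K - 1) * i + (K - 1) * (n - i))%N by rewrite -mulnDr subnKC.
  by rewrite leq_divRL // mulnDl leq_add // leq_divM.
by rewrite exprD mulrACA rpredM ?df ?dg.
Qed.

Lemma decay_leq K K' f : (0 < K <= K')%N -> decay K f -> decay K' f.
Proof.
move=> /andP[K0 leK] df n; apply: pint_leX (df n).
have p1_gt0 : (0 < p - 1)%N by rewrite subn_gt0.
rewrite leq_divRL ?muln_gt0 ?p1_gt0 ?(leq_trans K0) //.
set D := (_ %/ _)%N; have : (D * (K * (p - 1)) <= (K - 1) * n)%N by apply: leq_divM.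
move: D (p - 1)%N {p1_gt0} => D P leD.
have leKn : (K * (D * P) + n <= K * n)%N.
  by have : (n <= K * n)%N by [rewrite leq_pmull]; rewrite mulnBl mul1n in leD; lia.
have leDP : (D * P <= n)%N by rewrite -(leq_pmul2l K0); apply: leq_trans leKn; apply: leq_addr.
have : (K * (n - D * P) <= K' * (n - D * P))%N by rewrite leq_mul2r leK orbT.
rewrite !mulnBr mulnBl mul1n.
have : (K' * (D * P) <= K' * n)%N by rewrite leq_mul2l leDP orbT.
lia.
Qed.

Lemma decay_theta : decay (p * p.+1) theta.
Proof.
move=> n; apply: pint_leX (theta_pint n).
have p1_gt0 : (0 < p - 1)%N by rewrite subn_gt0.
rewrite leq_divRL ?muln_gt0 ?p_gt0 ?p1_gt0 // /theta_bound mulnDl.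
have := logn_fact_le p_pr (n %/ p).
have := leq_divM n p; have := leq_divM n p.+1.
move: (n %/ p)%N (n %/ p.+1)%N (logn _ _) => a b c le_b le_a le_c.
have le_logn : (c * (p * p.+1 * (p - 1)) <= p.+1 * n)%N.
  by apply: (@leq_trans (p.+1 * (a * p))); [nia | rewrite leq_mul2l le_a orbT].
have le_quot : (b * (p * p.+1 * (p - 1)) <= p * (p - 1) * n)%N.
  by apply: (@leq_trans (p * (p - 1) * (b * p.+1))); [nia | rewrite leq_mul2l le_b orbT].
apply: leq_trans (leq_add le_logn le_quot) _; rewrite -mulnDl leq_mul2r; apply/orP; right; nia.
Qed.

Lemma varpi_neq0 r : varpi r != 0.
Proof. by rewrite expf_neq0 // oppr_eq0. Qed.

Lemma varpiS r : varpi r.+1 = - p%:R * varpi r ^+ p.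
Proof. by rewrite /varpi geomS addn1 exprS mulnC exprM. Qed.

Lemma dworkS r : dwork r.+1 = dwork r * fps_compXn (p ^ r) (fps_scale (varpi r)^-1 theta).
Proof.
have q0 : (0 < p ^ r)%N by rewrite expn_gt0 p_gt0.
have -> : fps_compXn (p ^ r) (fps_scale (varpi r)^-1 theta) =
    expX inv_fact (p ^ r) (varpi r)^-1 * expX inv_fact (p ^ r.+1) (- (varpi r.+1)^-1).
  rewrite fps_scaleM !fps_scale_expX // expr1 mulr1 fps_compXnM // !fps_compXn_expX // muln1 -expnSr.
  by congr (_ * expX _ _ _); rewrite varpiS exprVn invfM invrN mulNr opprK mulrC.
rewrite /dwork mulrA -[_ * _ * expX _ _ (varpi r)^-1]mulrA -expXD //; last exact: inv_fact_divided_powers.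
by rewrite addNr expX0 ?mulr1 //; apply: inv_fact_divided_powers.
Qed.

Lemma decay_compXn K g r : (0 < K)%N -> decay K g ->
  decay (K * p ^ r) (fps_compXn (p ^ r) (fps_scale (varpi r)^-1 g)).
Proof.
move=> K0 dg n; have q0 : (0 < p ^ r)%N by rewrite expn_gt0 p_gt0.
rewrite /fps_compXn; case: ifP => [/dvdnP[m ->]|_]; last by rewrite mulr0 rpred0.
rewrite mulnK // /fps_scale.
have := dg m; set em := (_ %/ _)%N => dgm; set e := (_ %/ _)%N.
have le_e : (geom p r * m + em <= e)%N.
  rewrite /e leq_divRL; last by rewrite !muln_gt0 K0 q0 subn_gt0.
  have : (em * (K * (p - 1)) <= (K - 1) * m)%N by apply: leq_divM.
  move: em {dgm} => em; have := geomE r p_gt0; move: (p ^ r)%N q0 (geom p r).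
  move=> Q Q0 G geom_eq le_em.
  have -> : ((G * m + em) * (K * Q * (p - 1)) =
    K * Q * m * ((p - 1) * G) + Q * (em * (K * (p - 1))))%N by ring.
  apply: (@leq_trans (K * Q * m * (Q - 1) + Q * ((K - 1) * m))).
    by rewrite geom_eq leq_add2l leq_mul2l le_em orbT.
  case: K K0 {dg e le_em} => // K _; case: Q Q0 geom_eq => // Q _ _.
  have -> : (K.+1 * Q.+1 - 1 = K * Q.+1 + Q)%N by lia.
  by rewrite !subSS !subn0; apply/eq_leq; ring.
rewrite /varpi exprVn -exprM exprNn invfM -[((-1) ^+ _)^-1]exprVn invrN1.
rewrite -(subnK le_e) [in p%:R ^+ (_ - _ + _)]addnC -addnA exprD.
have -> : forall u s w : rat,
    p%:R ^+ (geom p r * m) * u * (s * (p%:R ^+ (geom p r * m))^-1 * w) = s * (u * w).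
  by move=> u s w; field; rewrite expf_neq0.
by rewrite rpredM ?rpred_sign // [(em + _)%N]addnC exprD -mulrA rpredM ?rpredX ?rpred_nat.
Qed.

Lemma decay_dwork r : decay (p * p.+1 * p ^ r) (dwork r).
Proof.
have K0 : (0 < p * p.+1)%N by rewrite muln_gt0 p_gt0.
elim: r => [|r IHr].
  rewrite /dwork /varpi /geom big_ord0 expr0 invr1 expn0 -expXD //; last exact: inv_fact_divided_powers.
  rewrite subrr expX0 // => [n|]; last exact: inv_fact_divided_powers.
  by rewrite fps1 rpredM ?rpredX ?rpred_nat.
have Kq0 : (0 < p * p.+1 * p ^ r)%N by rewrite muln_gt0 K0 expn_gt0 p_gt0.
rewrite dworkS; apply: (@decay_leq (p * p.+1 * p ^ r)).
  by rewrite Kq0 leq_mul2l leq_exp2l // leqnSn orbT.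
by apply: decay_mul => //; apply: decay_compXn decay_theta.
Qed.

End DworkExponential.

(** * The trace of Dwork's operator *)

Section TraceIdentity.
Variables (p : nat) (p_pr : prime p) (r a : nat).
Local Notation q := (p ^ r)%N.
Local Notation f := (dwork p r).
Local Notation w_ := (varpi p r).
Let p_gt0 := prime_gt0 p_pr.
Let q_gt0 : (0 < q)%N. Proof. by rewrite expn_gt0 p_gt0. Qed.
Let w_neq0 : w_ != 0. Proof. exact: varpi_neq0. Qed.

Lemma fps_deriv_dwork :
  fps_deriv f = f - fps_of_poly ((q%:R / w_) *: 'X^(q.-1)) * f.
Proof.
rewrite fps_derivM !(fps_deriv_expX inv_fact_divided_powers) // /inv_fact invr1 !mulr1.
by rewrite mulrN scaleNr rmorphN scale1r expr0 rmorph1 /dwork; ring.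
Qed.

Lemma dwork_rec n :
  n.+1%:R * f n.+1 = f n - (if (q <= n.+1)%N then q%:R / w_ * f (n.+1 - q)%N else 0).
Proof.
rewrite mulr_natl -[LHS]/(fps_deriv f n) fps_deriv_dwork.
rewrite -[LHS]/(f n - (fps_of_poly _ * f) n) coef_fps_monomM -ltnS (prednK q_gt0).
by case: ifP => // le_q; congr (_ - _ * f _); lia.
Qed.

Lemma dwork_expX : f * expX inv_fact q w_^-1 = inv_fact.
Proof.
have dp := inv_fact_divided_powers.
rewrite /dwork -mulrA -expXD // addNr expX0 // mulr1; apply/funext => n.
by rewrite expX1E expr1n mul1r.
Qed.

Definition dwork_entry n u := w_ ^+ n * f (a + q * n - u)%N.

Variable M : nat.
Local Notation eta := ((a + (q - 1) * M)%N%:R : rat).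

Lemma dwork_entry_rec n u : (u <= n)%N -> (0 < a)%N ->
  (u%:R - M%:R) * dwork_entry n.+1 u + dwork_entry n.+1 u.+1 =
  q%:R * ((n.+1%:R - M%:R) * dwork_entry n.+1 u + dwork_entry n u) + eta * dwork_entry n.+1 u.
Proof.
move=> le_un a0; rewrite /dwork_entry.
have indexE : (a + q * n.+1 - u = (a + q * n.+1 - u.+1).+1)%N by nia.
have := dwork_rec (a + q * n.+1 - u.+1); rewrite -indexE.
have -> : (q <= a + q * n.+1 - u)%N by nia.
have -> : (a + q * n.+1 - u - q = a + q * n - u)%N by nia.
have -> : ((a + q * n.+1 - u)%N%:R : rat) = a%:R + q%:R * n.+1%:R - u%:R.
  by rewrite natrB ?natrD ?natrM //; nia.
move/esym/eqP; rewrite subr_eq => /eqP ->; rewrite exprS natrD natrM natrB //.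
by field.
Qed.

Definition falling w u : rat := \prod_(w <= v < u) (M%:R - v%:R).

Lemma fallingnn u : falling u u = 1.
Proof. by rewrite /falling big_geq. Qed.

Lemma fallingS w u : (w <= u)%N -> falling w u.+1 = falling w u * (M%:R - u%:R).
Proof. by move=> le_wu; rewrite /falling big_nat_recr. Qed.

Lemma falling0 u : falling 0 u = (M ^_ u)%:R.
Proof.
elim: u => [|u IHu]; first by rewrite fallingnn.
rewrite fallingS // IHu ffactnSr natrM; have [leu|ltM] := leqP u M.
  by rewrite natrB.
by rewrite ffact_small // !mul0r.
Qed.

Definition falling_sum (g : nat -> rat) u := \sum_(0 <= w < u) g w * falling w.+1 u.

Lemma falling_sumS g u : falling_sum g u.+1 = g u + (M%:R - u%:R) * falling_sum g u.
Proof.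
rewrite /falling_sum big_nat_recr //= fallingnn mulr1 addrC mulr_sumr; congr (_ + _).
by apply: eq_big_nat => w /andP[_ ltwu]; rewrite fallingS //; ring.
Qed.

Lemma falling_sum_telescope (g : nat -> rat) u :
  falling_sum (fun w => (w%:R - M%:R) * g w + g w.+1) u = g u - falling 0 u * g 0%N.
Proof.
elim: u => [|u IHu]; first by rewrite fallingnn /falling_sum big_geq // mul1r subrr.
by rewrite falling_sumS IHu fallingS //; ring.
Qed.

Lemma dwork_entry_diag n : (0 < a)%N ->
  dwork_entry n.+1 n.+1 = falling 0 n.+1 * dwork_entry n.+1 0 +
    (q%:R * ((n.+1%:R - M%:R) * falling_sum (dwork_entry n.+1) n.+1
       + falling_sum (dwork_entry n) n.+1) + eta * falling_sum (dwork_entry n.+1) n.+1).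
Proof.
move=> a0; have := falling_sum_telescope (dwork_entry n.+1) n.+1.
move/esym/eqP; rewrite subr_eq => /eqP ->; rewrite addrC; congr (_ + _).
rewrite /falling_sum !mulr_sumr -!big_split mulr_sumr -big_split; apply: eq_big_nat => w /andP[_ ltwn] /=.
by rewrite dwork_entry_rec //; ring.
Qed.

(* The left-hand side is the truncated trace of the operator with matrix
   dwork_entry. The two error terms vanish p-adically: the first as L grows, the
   second because eta = a q^k is highly divisible by p. *)
Lemma trace_identity L : (0 < a)%N ->
  (1 - q%:R) * \sum_(0 <= u < L.+1) dwork_entry u u =
  \sum_(0 <= u < L.+1) falling 0 u * dwork_entry u 0
  - q%:R * falling_sum (dwork_entry L) L.+1
  + eta * \sum_(0 <= u < L.+1) falling_sum (dwork_entry u) u.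
Proof.
move=> a0; elim: L => [|L IHL].
  by rewrite !big_nat1 falling_sumS fallingnn /falling_sum !big_geq //; ring.
rewrite !(big_nat_recr L.+1) //= mulrDr IHL (falling_sumS _ L.+1).
by rewrite [in LHS]mulrBl mul1r {1}dwork_entry_diag //; ring.
Qed.

Lemma sum_falling_entry L : (a < q)%N -> (M <= L)%N ->
  \sum_(0 <= u < L.+1) falling 0 u * dwork_entry u 0 =
  M`!%:R * w_ ^+ M / (q * M + a)`!%:R.
Proof.
move=> ltaq leML.
rewrite (big_cat_nat (n := M.+1)) //= [X in _ + X]big_nat_cond [X in _ + X]big1 ?addr0; last first.
  by move=> u; rewrite andbT => /andP[ltM _]; rewrite falling0 ffact_small // mul0r.
rewrite -[_^-1]/(inv_fact _) -dwork_expX [f * _]mulrC fpsM.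
pose g j := (w_^-1 ^+ j / j`!%:R) * f (q * M + a - j * q)%N.
have -> : \sum_(i < (q * M + a).+1) expX inv_fact q w_^-1 i * f (q * M + a - i)%N = \sum_(i < M.+1) g i.
  transitivity (\sum_(i < (q * M + a).+1) fps_compXn q g i); last first.
    by rewrite sum_fps_compXn // mulnC divnMDl // divn_small ?addn0.
  apply: eq_bigr => i _; rewrite /expX /fps_compXn.
  by case: ifP => [/dvdnP[j ->]|_]; rewrite ?mul0r // mulnK.
rewrite mulr_sumr [RHS](reindex_inj rev_ord_inj) big_mkord; apply: eq_bigr => u _; rewrite /g /= subSS.
have leuM : (u <= M)%N by rewrite -ltnS.
have -> : (q * M + a - (M - u) * q = a + q * u)%N.
  by rewrite mulnBl [(M * q)%N]mulnC [(u * q)%N]mulnC; have := leq_mul (leqnn q) leuM; lia.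
rewrite falling0 /dwork_entry subn0.
have -> : w_ ^+ M = w_ ^+ u * w_ ^+ (M - u) by rewrite -exprD subnKC.
rewrite -(ffact_fact leuM) natrM exprVn; field.
by rewrite expf_neq0 // natr_fact_neq0.
Qed.

End TraceIdentity.

Section TraceLimit.
Variables (p : nat) (p_pr : prime p) (r a : nat) (r_gt0 : (0 < r)%N).
Local Notation q := (p ^ r)%N.
Local Notation f := (dwork p r).
Local Notation w_ := (varpi p r).
Local Notation K := (p * p.+1 * p ^ r)%N.
Local Notation C := (a + 1 + K)%N.
Let p_gt0 := prime_gt0 p_pr.
Let p_gt1 := prime_gt1 p_pr.
Let p_neq0 := natr_prime_neq0 p_pr.
Let K_gt0 : (0 < K)%N. Proof. by rewrite !muln_gt0 p_gt0 expn_gt0 p_gt0. Qed.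
Let p1_gt0 : (0 < p - 1)%N. Proof. by rewrite subn_gt0. Qed.

Lemma dwork_exponent_le u m :
  (((K - 1) * (a + (q - 1) * u + m)) %/ (K * (p - 1)) + u %/ (K * (p - 1))
   <= C + (geom p r * u + logn p (m.-1)`!))%N.
Proof.
have q_gt1 : (1 < q)%N by rewrite -(expn0 p) ltn_exp2l.
have geom_eq := geomE r p_gt0; have := logn_fact_geK p_pr m.-1 K_gt0.
move: (logn p _) (geom p r) geom_eq => v G.
move: K K_gt0 => k k_gt0; move: q q_gt1 (p - 1)%N p1_gt0 => Q Q_gt1 P P_gt0 geom_eq le_v.
have kP_gt0 : (0 < k * P)%N by rewrite muln_gt0 k_gt0.
rewrite -(leq_pmul2r kP_gt0) mulnDl.
apply: leq_trans (leq_add (leq_divM _ _) (leq_divM _ _)) _.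
have le_m : ((k - 1) * m <= k * (P * (v + k)) + (k - 1))%N.
  apply: leq_trans (_ : (k - 1) * m.-1 + (k - 1) <= _)%N; rewrite ?leq_add2r //.
  by rewrite -mulnSr leq_mul2l leqSpred orbT.
have le_u : (u + (k - 1) * ((Q - 1) * u) <= k * ((Q - 1) * u))%N.
  have : (u <= (Q - 1) * u)%N by rewrite leq_pmull // subn_gt0.
  by case: k k_gt0 {kP_gt0 le_v le_m} => // k _; rewrite subSS subn0 mulSn leq_add2r.
have le_a : ((k - 1) * a + (k - 1) <= k * P * (a + 1))%N.
  by rewrite -mulnSr addn1 leq_mul2r (leq_trans (leq_subr _ _)) ?orbT // leq_pmulr.
have -> : ((a + 1 + k + (G * u + v)) * (k * P) =
   k * P * (a + 1) + k * ((P * G) * u) + k * (P * (v + k)))%N by ring.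
by rewrite geom_eq !mulnDr; move: le_m le_u le_a; clear; lia.
Qed.

Lemma dwork_coef_bound u m :
  p%:R ^+ C * (w_ ^+ u * f (a + (q - 1) * u + m)%N * (m.-1)`!%:R) /
    p%:R ^+ (u %/ (K * (p - 1))) \is a pint p.
Proof.
have := decay_dwork p_pr r (a + (q - 1) * u + m)%N; have := dwork_exponent_le u m.
move: (_ %/ _)%N (_ %/ _)%N => e2 e1 le_e.
have [c _] := pfactor_coprime p_pr (fact_gt0 m.-1); move: (logn p _) le_e => v le_e -> pf.
rewrite natrM natrX /varpi -exprM (exprNn p%:R); move: (f _) pf => x px.
have powersE : p%:R ^+ C * (p%:R ^+ (geom p r * u) * p%:R ^+ v) =
    p%:R ^+ (C + (geom p r * u + v) - (e1 + e2)) * (p%:R ^+ e1 * p%:R ^+ e2) :> rat.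
  by rewrite -!exprD subnK.
have -> : p%:R ^+ C * ((-1) ^+ (geom p r * u) * p%:R ^+ (geom p r * u) * x * (c%:R * p%:R ^+ v))
     / p%:R ^+ e2 =
   (-1) ^+ (geom p r * u) * c%:R * (p%:R ^+ (C + (geom p r * u + v) - (e1 + e2)) * (p%:R ^+ e1 * x)).
  apply: (mulIf (expf_neq0 e2 p_neq0)); rewrite mulfVK ?expf_neq0 //.
  transitivity ((-1) ^+ (geom p r * u) * c%:R * x * (p%:R ^+ C * (p%:R ^+ (geom p r * u) * p%:R ^+ v))).
    by ring.
  by rewrite powersE; ring.
by rewrite rpredM // rpredM // ?rpred_sign ?rpredX ?rpred_nat.
Qed.

Lemma falling_fact M w u : (w <= u)%N -> exists z : int, falling M w u = (u - w)`!%:R * z%:~R.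
Proof.
move=> le_wu; have /dvdzP[z prodE] := fact_dvd_prodz (u - w) (M%:Z - w%:Z).
exists z; rewrite mulrC pmulrn -intrM -prodE rmorph_prod /falling -[w in LHS]add0n big_addn big_mkord.
by apply: eq_bigr => i _; rewrite natrD rmorphB rmorphB /= -!pmulrn; ring.
Qed.

Lemma entry_indexE n w : (w <= n)%N -> (a + q * n - w = a + (q - 1) * n + (n - w))%N.
Proof.
move=> le_wn; have : (n <= q * n)%N by rewrite leq_pmull // expn_gt0 p_gt0.
by rewrite mulnBl mul1n; lia.
Qed.

Lemma falling_sum_diag_bound M u : p%:R ^+ C * falling_sum M (dwork_entry p r a u) u \is a pint p.
Proof.
rewrite /falling_sum mulr_sumr big_nat_cond; apply: rpred_sum => w; rewrite andbT => /andP[_ lt_wu].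
have [z ->] := falling_fact M lt_wu; rewrite /dwork_entry entry_indexE 1?ltnW //.
have -> : (u - w.+1 = (u - w).-1)%N by lia.
have := dwork_coef_bound u (u - w); move: (_ %/ _)%N (f _) (_`!%:R) => e x y pe.
have -> : p%:R ^+ C * (w_ ^+ u * x * (y * z%:~R)) =
    p%:R ^+ e * z%:~R * (p%:R ^+ C * (w_ ^+ u * x * y) / p%:R ^+ e).
  by field; rewrite expf_neq0.
by rewrite rpredM // rpredM ?rpredX ?rpred_nat ?rpred_int.
Qed.

Lemma falling_sum_last_bound M L :
  p%:R ^+ C * falling_sum M (dwork_entry p r a L) L.+1 / p%:R ^+ (L %/ (K * (p - 1))) \is a pint p.
Proof.
rewrite /falling_sum mulr_sumr mulr_suml big_nat_cond; apply: rpred_sum => w.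
rewrite andbT => /andP[_ lt_wL]; have [z ->] := falling_fact M lt_wL.
rewrite /dwork_entry entry_indexE // subSS.
have [k ->] : exists k, (L - w)`! = (k * (L - w).-1`!)%N.
  by case: (L - w)%N => [|m]; [exists 1%N | exists m.+1; rewrite factS].
have := dwork_coef_bound L (L - w); rewrite natrM; move: (_ %/ _)%N (f _) (_`!%:R) => e x y pe.
have -> : p%:R ^+ C * (w_ ^+ L * x * (k%:R * y * z%:~R)) / p%:R ^+ e =
    k%:R * z%:~R * (p%:R ^+ C * (w_ ^+ L * x * y) / p%:R ^+ e) by ring.
by rewrite rpredM // rpredM ?rpred_nat ?rpred_int.
Qed.

Lemma trace_limit B : (0 < a < q)%N -> exists k0, forall k M, (k0 <= k)%N ->
    (a + (q - 1) * M = a * q ^ k)%N ->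
  exists L0, forall L, (L0 <= L)%N ->
    pcong p B ((1 - q%:R) * \sum_(0 <= u < L.+1) dwork_entry p r a u u)
      (M`!%:R * w_ ^+ M / (q * M + a)`!%:R).
Proof.
move=> /andP[a0 aq]; exists (B + C)%N => k M lek M_eq.
exists (M + (B + C) * (K * (p - 1)))%N => L leL.
rewrite /pcong (trace_identity p_pr r M) // sum_falling_entry //; last first.
  by apply: leq_trans leL; rewrite leq_addr.
set X := M`!%:R * _ / _; set Y := falling_sum _ _ _; set T := \sum_(_ <= u < _) _.
have pT : p%:R ^+ C * T \is a pint p.
  by rewrite mulr_sumr rpred_sum // => u _; apply: falling_sum_diag_bound.
have le_e : (B + C <= L %/ (K * (p - 1)))%N.
  by rewrite leq_divRL ?muln_gt0 ?p1_gt0 ?p_gt0 ?expn_gt0 ?p_gt0 // (leq_trans _ leL) // leq_addl.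
have := falling_sum_last_bound M L; rewrite -/Y -(subnK le_e); move: (_ - _)%N => e pY.
have le_rk : (B + C <= r * k)%N by rewrite (leq_trans lek) // leq_pmull.
have -> : (X - q%:R * Y + (a + (q - 1) * M)%:R * T - X) / p%:R ^+ B =
  - (q%:R * p%:R ^+ e * (p%:R ^+ C * Y / p%:R ^+ (e + (B + C)))) +
  a%:R * p%:R ^+ (r * k - (B + C)) * (p%:R ^+ C * T).
  have -> : ((a + (q - 1) * M)%:R : rat) = a%:R * p%:R ^+ (r * k - (B + C)) * (p%:R ^+ B * p%:R ^+ C).
    by rewrite M_eq natrM -expnM natrX -mulrA -!exprD subnK.
  by rewrite (exprD _ e) (exprD _ B); field; rewrite !expf_neq0.
apply: rpredD; first by rewrite rpredN rpredM // rpredM ?rpredX ?rpred_nat.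
by rewrite rpredM // rpredM ?rpredX ?rpred_nat.
Qed.

End TraceLimit.

(** * Characters of finite fields, Gauss and Jacobi sums *)

Section FiniteField.
Variable F : finFieldType.
Local Notation q := #|F|.

Lemma card_finField_neq0 : #|[pred x : F | x != 0]| = (q - 1)%N.
Proof. by rewrite subn1 -(cardC1 (0 : F)); apply: eq_card => x; rewrite !inE. Qed.

Lemma expf_card_sub1 (x : F) : x != 0 -> x ^+ (q - 1) = 1.
Proof.
move=> x0; apply: (mulfI x0); rewrite -exprS subn1 prednK ?expf_card ?mulr1 //.
exact: ltnW (finNzRing_gt1 F).
Qed.

Lemma expf_modn (x : F) m : x != 0 -> x ^+ m = x ^+ (m %% (q - 1)).
Proof.
move=> x0; rewrite {1}(divn_eq m (q - 1)) exprD mulnC exprM.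
by rewrite expf_card_sub1 // expr1n mul1r.
Qed.

Lemma exists_expf_neq1 m : ~~ (q - 1 %| m)%N -> exists2 c : F, c != 0 & c ^+ m != 1.
Proof.
have /cyclicP[g unitsE] := field_unit_group_cyclic [set: {unit F}].
have order_g : #[g]%g = (q - 1)%N by rewrite orderE -unitsE card_finField_unit subn1.
rewrite -order_g order_dvdn => gm; exists (val g); first by rewrite -unitfE (valP g).
by apply: contraNneq gm => gm1; apply/eqP/val_inj; rewrite FinRing.val_unitX.
Qed.

Lemma natr_card_finField : (q%:R : F) = 0.
Proof.
have shiftE : \sum_(x : F) x = \sum_(x : F) (x + 1) by rewrite (reindex_inj (addIr 1)).
rewrite big_split /= sumr_const in shiftE.
by apply: (addrI (\sum_(x : F) x)); rewrite addr0.
Qed.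

Lemma natr_finField_neq0 p r d : prime p -> q = (p ^ r)%N -> coprime p d -> (d%:R : F) != 0.
Proof.
move=> p_pr cardF pd; have := natr_card_finField; rewrite cardF natrX => /eqP.
rewrite expf_eq0 => /andP[_ p0]; have pF : p \in [pchar F] by rewrite inE p_pr.
by rewrite -(dvdn_pcharf pF) -prime_coprime.
Qed.

Lemma expf_coprime_inj d : (0 < d)%N -> coprime (q - 1) d -> injective (fun x : F => x ^+ d).
Proof.
move=> d_gt0 d_cop; have [a b bezout _] := egcdnP (q - 1) d_gt0.
rewrite gcdnC (eqP d_cop) in bezout.
have expK (x : F) : x ^+ d ^+ a = x.
  rewrite -exprM mulnC bezout addn1 exprSr mulnC exprM.
  have [->|x0] := eqVneq x 0; first by rewrite mulr0.
  by rewrite expf_card_sub1 // expr1n mul1r.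
by move=> x y /(congr1 (fun z => z ^+ a)); rewrite !expK.
Qed.

End FiniteField.

Section DilatedTuples.
Variables (F : finFieldType) (d : nat).
Implicit Types (c : F) (y : {ffun 'I_d -> F}).

Definition nowhere_zero y := [forall i, y i != 0].

Lemma nowhere_zeroE y : nowhere_zero y = (\prod_i y i != 0).
Proof. by apply/forallP/prodf_neq0 => [y0 i _|y0 i]; apply: y0. Qed.

Definition dilate c y : {ffun 'I_d -> F} := [ffun i => c * y i].

Lemma dilateK c : c != 0 -> cancel (dilate c) (dilate c^-1).
Proof. by move=> c0 y; apply/ffunP => i; rewrite !ffunE mulKf. Qed.

Lemma dilate_inj c : c != 0 -> injective (dilate c).
Proof. by move=> c0; apply: can_inj (dilateK c0). Qed.

Lemma dilateM b c y : dilate b (dilate c y) = dilate (b * c) y.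
Proof. by apply/ffunP => i; rewrite !ffunE mulrA. Qed.

Lemma dilate1 y : dilate 1 y = y.
Proof. by apply/ffunP => i; rewrite ffunE mul1r. Qed.

Lemma nowhere_zero_dilate c y : c != 0 -> nowhere_zero (dilate c y) = nowhere_zero y.
Proof. by move=> c0; apply: eq_forallb => i; rewrite ffunE mulf_eq0 (negPf c0). Qed.

Lemma sum_dilate c y : \sum_i dilate c y i = c * \sum_i y i.
Proof. by rewrite mulr_sumr; apply: eq_bigr => i _; rewrite ffunE. Qed.

Lemma prod_dilate c y : \prod_i dilate c y i = c ^+ d * \prod_i y i.
Proof.
rewrite -[X in c ^+ X]card_ord -prodr_const -big_split; apply: eq_bigr => i _.
by rewrite ffunE.
Qed.

Lemma sum_dilate_eq c y : c != 0 -> (\sum_i dilate c y i == c) = (\sum_i y i == 1).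
Proof. by move=> c0; rewrite sum_dilate -{2}[c]mulr1 (inj_eq (mulfI c0)). Qed.

End DilatedTuples.

Section Characters.
Variables (F : finFieldType) (A : comNzRingType).
Implicit Types om psi : F -> A.
Local Notation q := #|F|.

(* Since A may have zero divisors, the relation om u != 1 that gives the
   orthogonality relations is strengthened to the regularity of om u - 1. *)
Definition separating_character om :=
  [/\ om 1 = 1, {morph om : x y / x * y} & forall u, u != 1 -> GRing.lreg (om u - 1)].

Definition additive_character psi := psi 0 = 1 /\ {morph psi : x y / x + y >-> x * y}.

Definition gauss_sum om psi j : A := \sum_(x | x != 0) om x^-1 ^+ j * psi x.

Definition jacobi_sum om d j : A :=
  \sum_(y : {ffun 'I_d -> F} | nowhere_zero y && (\sum_i y i == 1)) om (\prod_i y i)^-1 ^+ j.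

Variable om : F -> A.
Hypothesis om_char : separating_character om.
Let om1 : om 1 = 1. Proof. by case: om_char. Qed.
Let omM : {morph om : x y / x * y}. Proof. by case: om_char. Qed.

Lemma characterX x n : om x ^+ n = om (x ^+ n).
Proof. by elim: n => [|n IHn]; rewrite ?expr0 ?om1 // !exprS omM IHn. Qed.

Lemma character_prod d (G : 'I_d -> F) : \prod_i om (G i) = om (\prod_i G i).
Proof. by rewrite (big_morph om omM om1). Qed.

Lemma character_modn x m : x != 0 -> om x ^+ m = om x ^+ (m %% (q - 1)).
Proof. by move=> x0; rewrite !characterX -expf_modn. Qed.

Lemma character_mulV x : x != 0 -> om x * om x^-1 = 1.
Proof. by move=> x0; rewrite -omM mulfV. Qed.

Lemma character_fixed u z : u != 1 -> om u * z = z -> z = 0.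
Proof.
case: om_char => _ _ om_reg u1 uz; apply: (om_reg u u1).
by rewrite mulrBl uz mul1r subrr mulr0.
Qed.

Lemma sum_character_exp m :
  \sum_(x : F | x != 0) om x ^+ m = if (q - 1 %| m)%N then (q - 1)%:R else 0.
Proof.
case: ifP => [/dvdnP[k ->]|/negbT /exists_expf_neq1[c c0 cm]].
  rewrite (eq_bigr (fun _ => 1)) => [|x x0].
    by rewrite sumr_const -(card_finField_neq0 F).
  by rewrite characterX mulnC exprM expf_card_sub1 // expr1n om1.
apply: (character_fixed cm); rewrite mulr_sumr [RHS](reindex_inj (mulfI c0)) /=.
by apply: eq_big => x; rewrite ?mulf_eq0 ?negb_or ?c0 // !characterX -omM exprMn.
Qed.

Lemma sum_character_powers u : u != 0 ->
  \sum_(j < q - 1) om u ^+ j = if u == 1 then (q - 1)%:R else 0.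
Proof.
move=> u0; case: eqVneq => [->|u1].
  rewrite (eq_bigr (fun _ => 1)) => [|j _]; last by rewrite om1 expr1n.
  by rewrite sumr_const card_ord.
apply: (character_fixed u1); apply/eqP; rewrite -subr_eq0 -{2}[\sum_(_ < _) _]mul1r -mulrBl.
by rewrite -subrX1 characterX expf_card_sub1 // om1 subrr.
Qed.

Variable psi : F -> A.
Hypothesis psi_char : additive_character psi.

Lemma additive_character_sum d (G : 'I_d -> F) : \prod_i psi (G i) = psi (\sum_i G i).
Proof. by case: psi_char => psi0 psiD; rewrite (big_morph psi psiD psi0). Qed.

Lemma gauss_sumX d j : gauss_sum om psi j ^+ d =
  \sum_(y : {ffun 'I_d -> F} | nowhere_zero y) om (\prod_i y i)^-1 ^+ j * psi (\sum_i y i).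
Proof.
rewrite -[d in LHS]card_ord -prodr_const /gauss_sum bigA_distr_big /=.
apply: eq_big => [y|y _]; first by apply/ffun_onP/forallP.
by rewrite big_split additive_character_sum prodrXl character_prod prodfV.
Qed.

Lemma sum_hyperplane_character d j : ~~ (q - 1 %| d * j)%N ->
  \sum_(y : {ffun 'I_d -> F} | nowhere_zero y && (\sum_i y i == 0))
    om (\prod_i y i)^-1 ^+ j = 0.
Proof.
case/exists_expf_neq1 => c c0 cdj; have cdj' : c ^- (d * j) != 1 by rewrite invr_eq1.
apply: (character_fixed cdj'); rewrite [in RHS](reindex_inj (dilate_inj c0)) mulr_sumr.
apply: eq_big => [y|y _]; first by rewrite nowhere_zero_dilate // sum_dilate mulf_eq0 (negPf c0).
by rewrite prod_dilate invfM omM exprMn; congr (_ * _); rewrite characterX exprVn -exprM.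
Qed.

Lemma jacobi_gauss_sum d j : ~~ (q - 1 %| d * j)%N ->
  jacobi_sum om d j * gauss_sum om psi (d * j) = gauss_sum om psi j ^+ d.
Proof.
move=> ndvd; rewrite gauss_sumX (bigID (fun y : {ffun 'I_d -> F} => \sum_i y i == 0)) /=.
rewrite (eq_bigr (fun y : {ffun 'I_d -> F} => om (\prod_i y i)^-1 ^+ j)) => [|y]; last first.
  by case/andP => _ /eqP->; rewrite psi_char.1 mulr1.
rewrite sum_hyperplane_character // add0r.
rewrite [RHS](partition_big (fun y : {ffun 'I_d -> F} => \sum_i y i) (fun s => s != 0)) /=; last first.
  by move=> y /andP[].
rewrite /gauss_sum mulr_sumr; apply: eq_bigr => s s0.
rewrite /jacobi_sum mulr_suml [RHS](reindex_inj (dilate_inj s0)) /=.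
apply: eq_big => [y|y /andP[_ /eqP sum_y]].
  rewrite nowhere_zero_dilate // sum_dilate_eq // sum_dilate mulf_eq0 (negPf s0) /=.
  by case: (nowhere_zero y) => //=; case: eqP => [->|_]; rewrite ?oner_eq0 ?andbF.
rewrite sum_dilate sum_y mulr1 prod_dilate invfM omM exprMn mulrA; congr (_ * _).
by rewrite mulrC !characterX -exprVn -exprM.
Qed.

End Characters.

(** * Dwork's additive character *)

Section PowerCongruence.
Variables (A : comNzRingType) (n : nat).
Implicit Types x y c : A.

Lemma sum_expr_cong x y c : x = y + n%:R * c ->
  exists b, \sum_(i < n) x ^+ (n.-1 - i) * y ^+ i = n%:R * b.
Proof.
move=> xy; pose S k := \sum_(i < k) x ^+ (k.-1 - i) * y ^+ i.
have xE k : x ^+ k = y ^+ k + n%:R * (c * S k).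
  by apply/eqP; rewrite addrC -subr_eq subrXX {1}xy [y + _]addrC addrK mulrA.
exists (y ^+ n.-1 + c * \sum_(i < n) S (n.-1 - i)%N * y ^+ i).
have -> : n%:R * (y ^+ n.-1 + c * \sum_(i < n) S (n.-1 - i)%N * y ^+ i) =
    \sum_(i < n) (y ^+ n.-1 + n%:R * (c * (S (n.-1 - i)%N * y ^+ i))).
  by rewrite big_split /= sumr_const card_ord mulrDr mulr_natl !mulr_sumr.
apply: eq_bigr => i _; have le_i : (i <= n.-1)%N by have := ltn_ord i; lia.
by rewrite xE mulrDl -exprD subnK //; ring.
Qed.

Lemma expr_exp_cong x y c m : x = y + n%:R * c ->
  exists c', x ^+ (n ^ m) = y ^+ (n ^ m) + n%:R ^+ m.+1 * c'.
Proof.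
move=> xy; elim: m => [|m [c' IHm]]; first by exists c; rewrite expn0 !expr1.
rewrite expnSr !exprM; move: (x ^+ _) (y ^+ _) IHm => X Y XE.
have [|b sumE] := @sum_expr_cong X Y (n%:R ^+ m * c'); first by rewrite XE exprS mulrA.
exists (c' * b); apply/eqP; rewrite addrC -subr_eq subrXX sumE {1}XE [Y + _]addrC addrK.
by apply/eqP; rewrite [n%:R ^+ m.+2]exprSr; ring.
Qed.

End PowerCongruence.

Section MultiplicativeLift.
Variables (F : finFieldType) (A : comNzRingType) (p : nat).

Definition multiplicative_lift (om : F -> A) :=
  [/\ om 0 = 0, om 1 = 1, {morph om : x y / x * y}
    & forall x y, exists c, om (x + y) = om x + om y + p%:R * c].

Variable om : F -> A.
Hypothesis om_lift : multiplicative_lift om.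

Lemma lift_separating N : (p%:R : A) ^+ N.+1 = 0 -> separating_character om.
Proof.
move=> pN; case: om_lift => _ om1 omM omD; split=> // u u1; apply: mulrI0_lreg => z.
have [c] := omD (u - 1) 1; rewrite subrK om1 => ->; rewrite addrAC addrK mulrDl => uz.
have inv : om (u - 1)^-1 * om (u - 1) = 1 by rewrite -omM mulVf // subr_eq0.
have zE : z = p%:R * (- om (u - 1)^-1 * c) * z.
  rewrite -{1}[z]mul1r -{1}inv -[LHS]mulrA.
  by move/(canRL (addrK _)): uz => ->; ring.
have z_iter k : z = (p%:R * (- om (u - 1)^-1 * c)) ^+ k * z.
  by elim: k => [|k IHk]; rewrite ?mul1r // exprSr -mulrA -zE.
by rewrite (z_iter N.+1) exprMn pN !mul0r.
Qed.

Lemma lift_natr n : exists c, om n%:R = n%:R + p%:R * c.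
Proof.
case: om_lift => om0 om1 _ omD; elim: n => [|n [c IHn]]; first by exists 0; rewrite om0 mulr0 addr0.
by have [c' om_n1] := omD n%:R 1; exists (c + c'); rewrite -natr1 om_n1 IHn om1 -natr1; ring.
Qed.

Lemma lift_exp_limit N r k t x c : (p%:R : A) ^+ N.+1 = 0 -> (0 < r)%N -> #|F| = (p ^ r)%N ->
  (N <= k)%N -> x = om t + p%:R * c -> x ^+ ((p ^ r) ^ k) = om t.
Proof.
move=> pN r_gt0 cardF leNk /(expr_exp_cong (r * k))[c'].
have leN : (N.+1 <= (r * k).+1)%N by rewrite ltnS (leq_trans leNk) // leq_pmull.
rewrite -expnM -(subnK leN) exprD pN mulr0 mul0r addr0 expnM => ->.
elim: k {leNk c' leN} => [|k IHk]; first by rewrite expn0 expr1.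
by rewrite expnSr exprM IHk (characterX (lift_separating pN)) -cardF expf_card.
Qed.

End MultiplicativeLift.

Section PowersOfPi.
Variables (p : nat) (p_pr : prime p) (N : nat).
Variables (A : comNzRingType) (iota : {rmorphism 'Z_(p ^ N.+1) -> A}).
Variables (pi : A) (piE : pi ^+ (p - 1) = - p%:R).
Let p_gt1 := prime_gt1 p_pr.
Let p1_gt0 : (0 < p - 1)%N. Proof. by rewrite subn_gt0. Qed.
Implicit Types (f g : fps rat) (x y : rat).

Lemma natrXS_eq0 : (p%:R : A) ^+ N.+1 = 0.
Proof. by rewrite -(rmorph_nat iota) -rmorphXn natrXS_Zpn // rmorph0. Qed.

Definition pi_pint n x := (- p%:R) ^+ (n %/ (p - 1)) * x \is a pint p.

(* pi^n x, which makes sense as soon as the valuation of x is at least - n/(p-1)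
   rounded towards 0. *)
Definition pi_mul n x : A :=
  pi ^+ (n %% (p - 1)) * iota (Zpn_rat p N ((- p%:R) ^+ (n %/ (p - 1)) * x)).

Let Np_pint k : (- p%:R) ^+ k \is a pint p.
Proof. by rewrite rpredX ?rpredN ?rpred_nat. Qed.

Let iota_Np k : iota (Zpn_rat p N ((- p%:R) ^+ k)) = (- p%:R) ^+ k.
Proof.
by rewrite Zpn_ratX ?Zpn_ratN ?Zpn_rat_nat ?rpredN ?rpred_nat // rmorphXn rmorphN rmorph_nat.
Qed.

Lemma pi_pint_sum n (I : Type) (s : seq I) (P : pred I) (G : I -> rat) :
  (forall i, P i -> pi_pint n (G i)) -> pi_pint n (\sum_(i <- s | P i) G i).
Proof. by move=> pG; rewrite /pi_pint mulr_sumr; apply: rpred_sum. Qed.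

Lemma pi_mul_sum n (I : Type) (s : seq I) (P : pred I) (G : I -> rat) :
  (forall i, P i -> pi_pint n (G i)) ->
  pi_mul n (\sum_(i <- s | P i) G i) = \sum_(i <- s | P i) pi_mul n (G i).
Proof. by move=> pG; rewrite /pi_mul mulr_sumr Zpn_rat_sum // rmorph_sum mulr_sumr. Qed.

Lemma pi_pintZ n x y : x \is a pint p -> pi_pint n y -> pi_pint n (x * y).
Proof. by move=> px py; rewrite /pi_pint mulrCA rpredM. Qed.

Lemma pi_mulZ n x y : x \is a pint p -> pi_pint n y ->
  pi_mul n (x * y) = iota (Zpn_rat p N x) * pi_mul n y.
Proof. by move=> px py; rewrite /pi_mul mulrCA Zpn_ratM // rmorphM mulrCA. Qed.

Lemma pi_mul_cong n x y : pi_pint n y -> pcong p N.+1 x y -> pi_mul n x = pi_mul n y.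
Proof.
move=> py xy; rewrite /pi_mul; congr (_ * iota _).
by apply: Zpn_rat_cong py _ => //; apply: pcongMl.
Qed.

Lemma pi_pint_shift n k x : pi_pint (n + (p - 1) * k) x = pi_pint n ((- p%:R) ^+ k * x).
Proof. by rewrite /pi_pint [(_ * k)%N]mulnC addnC divnMDl // exprD mulrA [_ ^+ k * _]mulrC. Qed.

Lemma pi_mul_shift n k x : pi_mul (n + (p - 1) * k) x = pi_mul n ((- p%:R) ^+ k * x).
Proof.
by rewrite /pi_mul [(_ * k)%N]mulnC addnC modnMDl divnMDl // exprD mulrA [_ ^+ k * _]mulrC.
Qed.

Lemma pi_mul_pint n x : x \is a pint p -> pi_mul n x = pi ^+ n * iota (Zpn_rat p N x).
Proof.
move=> px; rewrite /pi_mul Zpn_ratM // rmorphM iota_Np -piE -exprM mulrA -exprD.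
by rewrite addnC mulnC -divn_eq.
Qed.

Lemma pi_pintM i j x y : pi_pint i x -> pi_pint j y -> pi_pint (i + j) (x * y).
Proof.
move=> px py; rewrite /pi_pint divnD // !exprD.
have -> : forall u v w : rat, u * v * w * (x * y) = u * x * (v * y) * w by move=> *; ring.
by rewrite rpredM // rpredM.
Qed.

Lemma pi_mulM i j x y : pi_pint i x -> pi_pint j y -> pi_mul i x * pi_mul j y = pi_mul (i + j) (x * y).
Proof.
move=> px py; rewrite /pi_mul divnD // modnD //.
case: leqP => [le_p1|_]; last first.
  rewrite mul0n subn0 addn0 mulrACA -exprD -rmorphM -Zpn_ratM //.
  by congr (_ * iota (Zpn_rat p N _)); rewrite exprD; ring.
rewrite /= mul1n mulrACA -exprD -{1}(subnK le_p1) exprD piE -[- p%:R]expr1 -iota_Np expr1.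
rewrite -mulrA -!rmorphM -!Zpn_ratM ?rpredN ?rpred_nat //; last exact: rpredM.
by rewrite !exprD; congr (_ * iota (Zpn_rat p N _)); ring.
Qed.

Lemma pi_pint_inv_fact n : pi_pint n (inv_fact n).
Proof.
rewrite /pi_pint exprNn -mulrA rpredM ?rpred_sign //.
apply: (@pint_leX _ (logn p n`!)); last exact: pint_pfactorV (fact_gt0 _).
by rewrite leq_divRL // mulnC logn_fact_le.
Qed.

Definition pi_scaled (H : fps A) f := forall n, pi_pint n (f n) /\ H n = pi_mul n (f n).

Lemma pi_scaledM H f L g : pi_scaled H f -> pi_scaled L g -> pi_scaled (H * L) (f * g).
Proof.
move=> Hf Lg n; have pM (i : 'I_n.+1) : pi_pint n (f i * g (n - i)%N).
  have lein : (i <= n)%N by rewrite -ltnS.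
  by rewrite -[X in pi_pint X](subnKC lein); apply: pi_pintM; [case: (Hf i)|case: (Lg (n - i)%N)].
split; first exact: pi_pint_sum.
rewrite [in RHS]fpsM pi_mul_sum // fpsM; apply: eq_bigr => i _.
have lein : (i <= n)%N by rewrite -ltnS.
have [pf ->] := Hf i; have [pg ->] := Lg (n - i)%N.
by rewrite pi_mulM // subnKC.
Qed.

Lemma pi_scaled_decay H f K n : (0 < K)%N -> pi_scaled H f -> decay p K f ->
  (K * (p - 1) * N.+1 <= n)%N -> H n = 0.
Proof.
move=> K0 Hf df le_n; have [_ ->] := Hf n; rewrite /pi_mul.
have := df n; set e := (_ %/ _)%N => pf.
have le_e : (N.+1 + e <= n %/ (p - 1))%N.
  rewrite leq_divRL // -(leq_pmul2l K0) !mulnA.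
  have : (e * (K * (p - 1)) <= (K - 1) * n)%N by apply: leq_divM.
  move: e {pf} => e; move: (p - 1)%N le_n => D le_n le_eD.
  have -> : (K * (N.+1 + e) * D = K * D * N.+1 + e * (K * D))%N by ring.
  by apply: leq_trans (leq_add le_n le_eD) _; rewrite mulnBl mul1n subnKC // leq_pmull.
rewrite exprNn -{2}(subnK le_e) !exprD.
have -> : forall s t u v : rat, s * (t * (u * v)) * f n = u * (s * t * (v * f n)) by move=> *; ring.
by rewrite Zpn_rat_expM ?rmorph0 ?mulr0 // rpredM // rpredM ?rpred_sign ?rpredX ?rpred_nat.
Qed.

Definition pi_exp : fps A := fun n => pi_mul n (inv_fact n).

Lemma pi_exp_divided_powers : divided_powers pi_exp.
Proof.
have [inv_fact0 inv_factM] := inv_fact_divided_powers; split=> [|i j].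
  by rewrite /pi_exp /pi_mul div0n mod0n inv_fact0 !mul1r (Zpn_rat_nat p N 1) rmorph1.
rewrite /pi_exp pi_mulM ?pi_pint_inv_fact // inv_factM pi_mulZ ?rpred_nat ?pi_pint_inv_fact //.
by rewrite Zpn_rat_nat rmorph_nat.
Qed.

Lemma pi_scaled_exp : pi_scaled (expX pi_exp 1 1) (expX inv_fact 1 1).
Proof. by move=> n; rewrite !expX1E !expr1n !mul1r; split=> //; apply: pi_pint_inv_fact. Qed.

Lemma pi_scaled_exp_varpi r :
  pi_scaled (expX pi_exp (p ^ r) (-1)) (expX inv_fact (p ^ r) (- (varpi p r)^-1)).
Proof.
have p_gt0 := prime_gt0 p_pr; have q_gt0 : (0 < p ^ r)%N by rewrite expn_gt0 p_gt0.
move=> n; case: (boolP (p ^ r %| n)%N) => [/dvdnP[j ->]|ndvd]; last first.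
  by rewrite !expX_ndvd // /pi_pint /pi_mul mulr0 rpred0 (Zpn_rat_nat p N 0) rmorph0 mulr0.
rewrite !expXE //; have -> : (j * p ^ r = j + (p - 1) * (geom p r * j))%N.
  by rewrite mulnA geomE // mulnBl mul1n [RHS]subnKC 1?mulnC // leq_pmulr.
rewrite pi_pint_shift pi_mul_shift.
have -> : (- p%:R) ^+ (geom p r * j) * ((- (varpi p r)^-1) ^+ j * inv_fact j) = (-1) ^+ j * inv_fact j.
  rewrite exprM -/(varpi p r) mulrA -exprMn mulrN divff ?varpi_neq0 //.
split; first by rewrite pi_pintZ ?rpred_sign ?pi_pint_inv_fact.
rewrite pi_mulZ ?rpred_sign ?pi_pint_inv_fact // Zpn_ratX ?rpredN1 //.
by rewrite (Zpn_rat_int p N (-1)) rmorphXn rmorphN1.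
Qed.

End PowersOfPi.

Lemma big_arith_progression (R : Type) (idx : R) (op : Monoid.law idx) (G : nat -> R) a b m :
  (a < b)%N ->
  \big[op/idx]_(n < b * m | (n %% b == a)%N) G n = \big[op/idx]_(u < m) G (a + b * u)%N.
Proof.
move=> lt_ab; elim: m => [|m IHm]; first by rewrite muln0 !big_ord0.
rewrite big_ord_recr -IHm mulnSr big_split_ord /=; congr (op _ _).
rewrite (big_pred1 (Ordinal lt_ab)) => [|i /=]; first by rewrite addnC.
by rewrite mulnC modnMDl modn_small.
Qed.

Section DworkCharacter.
Variables (p : nat) (p_pr : prime p) (r N : nat).
Variables (A : comNzRingType) (iota : {rmorphism 'Z_(p ^ N.+1) -> A}).
Variables (pi : A) (piE : pi ^+ (p - 1) = - p%:R).
Local Notation q := (p ^ r)%N.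
Let p_gt0 := prime_gt0 p_pr.
Let p_gt1 := prime_gt1 p_pr.
Let p1_gt0 : (0 < p - 1)%N. Proof. by rewrite subn_gt0. Qed.
Let q_gt0 : (0 < q)%N. Proof. by rewrite expn_gt0 p_gt0. Qed.

Local Notation e_ := (pi_exp iota pi).
Let e_dp : divided_powers e_ := pi_exp_divided_powers p_pr iota piE.

(* exp(pi (X - X^q)). *)
Definition dwork_pi : fps A := expX e_ 1 1 * expX e_ q (-1).

Definition dwork_deg := (p * p.+1 * p ^ r * (p - 1) * N.+1)%N.

Lemma pi_scaled_dwork : pi_scaled iota pi dwork_pi (dwork p r).
Proof.
apply: (pi_scaledM p_pr piE); first exact: (pi_scaled_exp p_pr).
exact: (pi_scaled_exp_varpi p_pr).
Qed.

Lemma dwork_pi_eq0 n : (dwork_deg <= n)%N -> dwork_pi n = 0.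
Proof.
apply: (pi_scaled_decay p_pr _ pi_scaled_dwork (decay_dwork p_pr r)).
by rewrite !muln_gt0 p_gt0 q_gt0.
Qed.

Definition dwork_eval (t : A) : A := (fps_trunc dwork_deg dwork_pi).[t].

Lemma dwork_evalE L t : (dwork_deg <= L)%N -> dwork_eval t = \sum_(n < L) dwork_pi n * t ^+ n.
Proof.
by move=> leL; rewrite -horner_fps_trunc (fps_trunc_leq dwork_pi_eq0 leL).
Qed.

Lemma dwork_eval0 : dwork_eval 0 = 1.
Proof.
have deg_gt0 : (0 < dwork_deg)%N by rewrite !muln_gt0 p_gt0 q_gt0 p1_gt0.
rewrite (dwork_evalE _ (leqnn _)) -(prednK deg_gt0) big_ord_recl big1 ?addr0 => [|i _].
  by rewrite expr0 mulr1 [LHS]fpsM big_ord1 !coef0_expX e_dp.1 mulr1.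
by rewrite expr0n mulr0.
Qed.

Section NilpotentExponent.
Variable c : A.

Lemma expX_nilp k n : (0 < k)%N -> (k * N.+1 <= n)%N -> expX e_ k (p%:R * c) n = 0.
Proof.
move=> k0 le_n; case: (boolP (k %| n)%N) => [/dvdnP[m nE]|kn]; last by rewrite expX_ndvd.
have leN : (N.+1 <= m)%N by rewrite -(leq_pmul2l k0) [(k * m)%N]mulnC -nE.
by rewrite nE expXE // exprMn -(subnK leN) [p%:R ^+ _]exprD (natrXS_eq0 p_pr iota) mulr0 !mul0r.
Qed.

Definition nilp_exp k : {poly A} := fps_trunc (k * N.+1) (expX e_ k (p%:R * c)).

Lemma nilp_expE k : (0 < k)%N -> fps_of_poly (nilp_exp k) = expX e_ k (p%:R * c).
Proof. by move=> k0; apply: fps_truncK => n; apply: expX_nilp. Qed.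

Lemma nilp_exp_horner1 k : (0 < k)%N -> (nilp_exp k).[1] = (nilp_exp 1).[1].
Proof.
move=> k0; have kN0 : (0 < k * N.+1)%N by rewrite muln_gt0 k0.
rewrite !horner_fps_trunc mul1n.
under eq_bigr do rewrite expr1n mulr1.
under [in RHS]eq_bigr do rewrite expr1n mulr1.
rewrite -(prednK kN0) sum_fps_compXn // (_ : (_ %/ k)%N = N); last first.
  have -> : ((k * N.+1).-1 = N * k + k.-1)%N by lia.
  by rewrite divnMDl // divn_small ?addn0 // prednK.
by apply: eq_bigr => i _; rewrite expX1E.
Qed.

End NilpotentExponent.

Lemma nilp_exp_unit c : (nilp_exp c 1).[1] * (nilp_exp (- c) 1).[1] = 1.
Proof.
rewrite -hornerM (_ : nilp_exp c 1 * nilp_exp (- c) 1 = 1) ?hornerC //.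
apply: fps_of_poly_inj; rewrite rmorphM rmorph1 /= !nilp_expE // -expXD //.
by rewrite mulrN addrN expX0.
Qed.

Lemma fps_scale_dwork t : t ^+ q = t -> fps_scale t dwork_pi = expX e_ 1 t * expX e_ q (- t).
Proof. by move=> tq; rewrite fps_scaleM !fps_scale_expX // tq expr1 mulr1 mulrN1. Qed.

(* For t = t^q the factor exp(pi (t - t^q)) is formally trivial; the error p c made
   by om in x + y enters both factors of dwork_pi and cancels at X = 1. *)
Lemma dwork_evalD s t c : s ^+ q = s -> t ^+ q = t -> (s + t + p%:R * c) ^+ q = s + t + p%:R * c ->
  dwork_eval (s + t + p%:R * c) = dwork_eval s * dwork_eval t.
Proof.
set u := s + t + p%:R * c => sq tq uq.
pose P x := fps_trunc dwork_deg (fps_scale x dwork_pi).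
have PE x : x ^+ q = x -> fps_of_poly (P x) = expX e_ 1 x * expX e_ q (- x).
  move=> xq; rewrite -fps_scale_dwork //; apply: fps_truncK => n /dwork_pi_eq0 n0.
  by rewrite /fps_scale n0 mulr0.
have evalE x : dwork_eval x = (P x).[1] by rewrite horner_trunc_scale mulr1.
have : P u * nilp_exp c q = P s * P t * nilp_exp c 1.
  apply: fps_of_poly_inj; rewrite !rmorphM /= !PE // !nilp_expE //.
  have exp_u : expX e_ 1 u = expX e_ 1 s * expX e_ 1 t * expX e_ 1 (p%:R * c) by rewrite -!expXD.
  have exp_q : expX e_ q (- s) * expX e_ q (- t) = expX e_ q (- u) * expX e_ q (p%:R * c).
    by rewrite -!expXD //; congr expX; rewrite /u; ring.
  have -> : forall a b d e g : fps A, a * b * (d * e) * g = a * d * g * (b * e) by move=> *; ring.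
  by rewrite exp_q exp_u; ring.
move/(congr1 (horner^~ 1)); rewrite !hornerM nilp_exp_horner1 // !evalE.
move/(congr1 ( *%R^~ (nilp_exp (- c) 1).[1])).
by rewrite -!mulrA nilp_exp_unit !mulr1.
Qed.

Variables (F : finFieldType) (cardF : #|F| = q) (om : F -> A).
Hypothesis om_lift : multiplicative_lift p om.
Let om_char : separating_character om := lift_separating om_lift (natrXS_eq0 p_pr iota).

Definition dwork_psi (x : F) := dwork_eval (om x).

Lemma dwork_psi_character : additive_character dwork_psi.
Proof.
case: om_lift => om0 _ _ omD; split=> [|x y]; first by rewrite /dwork_psi om0 dwork_eval0.
have fixed z : om z ^+ q = om z by rewrite (characterX om_char) -cardF expf_card.
rewrite /dwork_psi; have [c om_xy] := omD x y.
by rewrite om_xy dwork_evalD ?fixed // -om_xy fixed.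
Qed.

Lemma gauss_sum_dwork a L : (a < q - 1)%N -> (dwork_deg <= L)%N ->
  gauss_sum om dwork_psi a = (q - 1)%:R * \sum_(u < L) dwork_pi (a + (q - 1) * u)%N.
Proof.
move=> ltaq leL; have q1_gt0 : (0 < q - 1)%N by apply: leq_ltn_trans ltaq.
rewrite -(big_arith_progression _ _ _ ltaq) mulr_sumr /gauss_sum.
rewrite (eq_bigr (fun x => \sum_(n < (q - 1) * L) dwork_pi n * om x ^+ (n + (q - 1 - a)))).
  rewrite exchange_big [RHS]big_mkcond /=; apply: eq_bigr => n _.
  rewrite -mulr_sumr sum_character_exp // cardF addnBA 1?ltnW // -eqn_mod_dvd; last first.
    by rewrite (leq_trans (ltnW ltaq)) // leq_addl.
  by rewrite modnDr (modn_small ltaq); case: ifP; rewrite ?mulr0 // mulrC.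
move=> x x0; rewrite /dwork_psi (@dwork_evalE ((q - 1) * L)); last first.
  by rewrite (leq_trans leL) // leq_pmull.
rewrite mulr_sumr; apply: eq_bigr => n _; rewrite mulrCA exprD [_ ^+ n * _]mulrC; congr (_ * (_ * _)).
rewrite !(characterX om_char); congr om; apply: (mulfI (expf_neq0 a x0)).
by rewrite -exprMn mulfV // expr1n -exprD subnKC ?(ltnW ltaq) // -cardF expf_card_sub1.
Qed.

Lemma gauss_sum_limit a : (0 < r)%N -> (0 < a < q - 1)%N -> exists k0, forall k M, (k0 <= k)%N ->
    (a + (q - 1) * M = a * q ^ k)%N ->
  gauss_sum om dwork_psi a = - pi_mul iota pi a (M`!%:R * varpi p r ^+ M / (q * M + a)`!%:R).
Proof.
move=> r_gt0 /andP[a0 aq].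
have aq' : (0 < a < q)%N by rewrite a0 (leq_trans aq) // leq_subr.
have [k0 limit] := trace_limit p_pr r_gt0 N.+1 aq'.
exists k0 => k M lek M_eq; have [L0 /(_ (L0 + dwork_deg)%N (leq_addr _ _))] := limit k M lek M_eq.
set L := (L0 + dwork_deg)%N => trace_cong.
have entryE u : dwork_pi (a + (q - 1) * u)%N = pi_mul iota pi a (dwork_entry p r a u u) /\
    pi_pint p a (dwork_entry p r a u u).
  have [] := pi_scaled_dwork (a + (q - 1) * u)%N; rewrite /dwork_entry.
  have -> : (a + q * u - u = a + (q - 1) * u)%N by rewrite mulnBl mul1n -addnBA // leq_pmull.
  move: (dwork _ _ _) (dwork_pi _) => x y; rewrite -geomE // -mulnA.
  by rewrite pi_pint_shift // pi_mul_shift // exprM.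
have pS : pi_pint p a (\sum_(0 <= u < L.+1) dwork_entry p r a u u).
  by apply: pi_pint_sum => u _; case: (entryE u).
have pq1 : 1 - q%:R \is a pint p by rewrite rpredB ?rpred1 ?rpred_nat.
have pq1S := pi_pintZ pq1 pS.
rewrite (pi_mul_cong p_pr iota pi pq1S (pcong_sym trace_cong)) pi_mulZ //.
rewrite (@gauss_sum_dwork a L.+1) //; last by rewrite leqW // leq_addl.
have -> : 1 - q%:R = - (q - 1)%:R :> rat by rewrite natrB // opprB.
rewrite Zpn_ratN ?rpred_nat // Zpn_rat_nat rmorphN rmorph_nat mulNr opprK; congr (_ * _).
rewrite (pi_mul_sum p_pr) => [|u _]; last by case: (entryE u).
by rewrite big_mkord; apply: eq_bigr => u _; case: (entryE u).
Qed.

End DworkCharacter.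

(** * Morita's gamma function *)

Section GammaNat.
Variables (p : nat) (p_pr : prime p) (p_odd : odd p) (N : nat).
Local Notation P := (p ^ N.+1)%N.
Local Notation Z := 'Z_(p ^ N.+1).
Let p_gt0 := prime_gt0 p_pr.
Let p_gt1 := prime_gt1 p_pr.
Let P_gt1 : (1 < P)%N. Proof. exact: expnS_gt1. Qed.

Definition pfree (R : nzRingType) j : R := if (p %| j)%N then 1 else j%:R.

Lemma prod_pfree_Fp m : \prod_(0 <= j < p * m) pfree 'F_p j = (-1) ^+ m.
Proof.
have Fp0 : (p%:R : 'F_p) = 0 by apply: pchar_Fp_0.
elim: m => [|m IHm]; first by rewrite muln0 big_geq.
rewrite (big_cat_nat (n := (p * m)%N)) ?leq_pmul2l //= IHm exprSr; congr (_ * _).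
rewrite mulnS addnC -{1}[(p * m)%N]add0n big_addn addKn big_ltn // {1}/pfree dvdn_mulr // mul1r.
transitivity (\prod_(1 <= j < p) (j%:R : 'F_p)).
  apply: eq_big_nat => j /andP[j0 jp]; rewrite /pfree dvdn_addl ?dvdn_mulr // gtnNdvd //.
  by rewrite natrD natrM Fp0 mul0r addr0.
have -> : \prod_(1 <= j < p) (j%:R : 'F_p) = (p.-1)`!%:R.
  by rewrite -natr_prod fact_prod prednK.
have := p_pr; rewrite (Wilson p_gt1) => /dvdnP[c fact_predE].
by apply/eqP; rewrite -subr_eq0 opprK natr1 fact_predE natrM Fp0 mulr0.
Qed.

Lemma big_Zpn (Q : pred nat) (G : nat -> Z) :
  \prod_(0 <= j < P | Q j) G j = \prod_(x : Z | Q x) G x.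
Proof.
have big_ord m : (Zp_trunc P).+2 = m -> \prod_(0 <= j < m | Q j) G j = \prod_(x : Z | Q x) G x.
  by move=> <-; rewrite big_mkord.
by rewrite big_ord // Zp_cast.
Qed.

Lemma unit_Zpn (x : Z) : (x \is a GRing.unit) = ~~ (p %| x)%N.
Proof. by rewrite -{1}[x]natr_Zp unitZpE // coprime_pexpl // prime_coprime. Qed.

Lemma prod_units_sqr (R : finComUnitRingType) :
  (\prod_(x : R | x \is a GRing.unit) x) ^+ 2 = 1.
Proof.
set w := \prod_(x : R | _) x; have w_unit : w \is a GRing.unit by apply: rpred_prod.
rewrite expr2 -(mulrV w_unit); congr (_ * _); rewrite {2}/w -prodrV // /w (reindex_inj invr_inj).
by apply: eq_big => x; rewrite ?unitrV.
Qed.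

Lemma prod_units_Zpn : \prod_(x : Z | x \is a GRing.unit) x = -1.
Proof.
have := prod_units_sqr Z; set w := \prod_(x : Z | _) x => w2.
pose X := (\prod_(0 <= j < P | ~~ (p %| j)) j)%N.
have wX : w = X%:R.
  rewrite /X natr_prod big_Zpn; apply: eq_big => x; first exact: unit_Zpn.
  by rewrite natr_Zp.
have pX : (p %| X.+1)%N.
  rewrite (dvdn_pcharf (pchar_Fp p_pr)) -natr1 /X natr_prod big_mkcond /= expnS.
  under eq_bigr => j _ do rewrite -if_neg negbK.
  rewrite (eq_bigr (fun j => pfree 'F_p j)) // prod_pfree_Fp -signr_odd oddX p_odd orbT.
  by rewrite expr1 addNr.
have X_gt0 : (0 < X)%N.
  by rewrite lt0n; apply: contraTneq pX => ->; rewrite dvdn1 neq_ltn p_gt1 orbT.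
have X1_unit : ((X - 1)%:R : Z) \is a GRing.unit.
  apply: natr_unit_Zpn; rewrite // prime_coprime //; apply: contraL p_odd => pX1.
  have : (p %| X.+1 - (X - 1))%N by apply: dvdn_sub.
  have -> : (X.+1 - (X - 1) = 2)%N by lia.
  by rewrite dvdn_prime2 // => /eqP->.
apply/eqP; rewrite -addr_eq0; apply/eqP/(mulrI X1_unit).
by rewrite mulr0 natrB // -wX -subr_sqr_1 w2 subrr.
Qed.

Lemma prod_pfree_period n : \prod_(n <= j < n + P) pfree Z j = -1.
Proof.
elim: n => [|n IHn].
  rewrite -prod_units_Zpn add0n big_Zpn [RHS]big_mkcond /=; apply: eq_bigr => x _.
  by rewrite unit_Zpn /pfree natr_Zp if_neg.
rewrite -IHn [RHS]big_ltn; last by lia.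
rewrite addSn big_nat_recr /=; last by lia.
by rewrite mulrC /pfree dvdn_addl ?dvdn_exp // natrD pchar_Zp // addr0.
Qed.

Definition gamma_nat n : Z := (gammap_nat p n)%:~R.

Lemma gamma_natE n : gamma_nat n = (-1) ^+ n * \prod_(1 <= j < n) pfree Z j.
Proof.
rewrite /gamma_nat /gammap_nat -[LHS]/(intr _) rmorphM rmorphXn rmorphN1 rmorph_prod; congr (_ * _).
by rewrite big_mkcond; apply: eq_bigr => j _; rewrite /pfree; case: (p %| j)%N.
Qed.

Lemma gamma_natS n : (0 < n)%N -> gamma_nat n.+1 = - (gamma_nat n * pfree Z n).
Proof. by move=> n0; rewrite !gamma_natE big_nat_recr //= exprS; ring. Qed.

Lemma gamma_nat_pfact n : gamma_nat n.+1 = (-1) ^+ n.+1 * (pfact p n)%:R.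
Proof.
rewrite gamma_natE /pfact natr_prod [in RHS]big_mkcond; congr (_ * _).
by apply: eq_bigr => j _; rewrite /pfree; case: (p %| j)%N.
Qed.

Lemma gamma_nat_unit n : gamma_nat n \is a GRing.unit.
Proof.
rewrite gamma_natE unitrM unitrX ?unitrN1 //=; apply: rpred_prod => j _.
rewrite /pfree; case: ifP => [_|/negbT pj]; first exact: unitr1.
by rewrite natr_unit_Zpn // prime_coprime.
Qed.

Lemma gamma_nat_period n m : (0 < n)%N -> gamma_nat (n + m * P) = gamma_nat n.
Proof.
move=> n0; elim: m => [|m IHm]; first by rewrite addn0.
rewrite mulSn addnCA addnC -IHm; have : (0 < n + m * P)%N by rewrite addn_gt0 n0.
move: (n + m * P)%N => k k0; rewrite !gamma_natE (big_cat_nat (n := k)) ?leq_addr //=.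
by rewrite prod_pfree_period exprD -[(-1) ^+ P]signr_odd oddX p_odd orbT; ring.
Qed.

Lemma gamma_nat_cong n m : (0 < n)%N -> (0 < m)%N -> pcong p N.+1 n%:R m%:R ->
  gamma_nat n = gamma_nat m.
Proof.
wlog le_mn : n m / (m <= n)%N => [sym|] n0 m0 nm.
  by case: (leqP m n) => [le_mn|/ltnW le_nm]; [apply: sym | apply/esym/sym; rewrite // pcong_sym].
move: nm; rewrite pcong_nat // subzn // dvdzE /= => /dvdnP[k diffE].
by rewrite -(subnKC le_mn) diffE gamma_nat_period.
Qed.

Lemma pcong_numq k n x : x \is a pint p ->
  ((p ^ k)%:Z %| n%:Z * denq x - numq x)%Z = pcong p k n%:R x.
Proof.
move=> px; have dx0 : (denq x)%:~R != 0 :> rat by rewrite intr_eq0 denq_eq0.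
have pV : (denq x)%:~R^-1 \is a pint p.
  by rewrite -absz_denq -pmulrn pintV // absz_gt0 denq_eq0.
rewrite -pcong_int // intrM numqE -pmulrn; apply/idP/idP => [|nx].
  by move/(pcongMl pV); rewrite [n%:R * _]mulrC [x * _]mulrC !mulKf.
by rewrite ![_ * (denq x)%:~R]mulrC; apply: pcongMl; rewrite ?rpred_int.
Qed.

Lemma gammapE x n : (0 < n)%N -> pcong p N.+1 x n%:R -> gammap p N x = gamma_nat n.
Proof.
move=> n0 xn; have px : x \is a pint p := pcong_pint p_gt1 (rpred_nat _ n) xn.
have ex : exists y : Z, exists M : nat, forall m : nat, (0 < m)%N ->
    ((p ^ M)%:Z %| (m%:Z * denq x - numq x))%Z -> (gammap_nat p m)%:~R = y.
  exists (gamma_nat n), N.+1 => m m0; rewrite pcong_numq // => mx.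
  by apply: gamma_nat_cong => //; apply: pcong_trans mx xn.
have [M limit] := epsilon_spec (inhabits 0) _ ex; rewrite -/(gammap p N x) in limit.
have [m m0 xm] := pcong_nat_exists p_gt1 (M + N.+1) px.
rewrite -(limit m m0); last by rewrite pcong_numq // pcong_sym // (pcong_leX p_gt1 _ xm) ?leq_addr.
apply: gamma_nat_cong => //; apply: pcong_trans xn; rewrite pcong_sym //.
by apply: (pcong_leX p_gt1 _ xm); rewrite leq_addl.
Qed.

End GammaNat.

Section GammaFunctional.
Variables (p : nat) (p_pr : prime p) (p_odd : odd p) (N : nat).
Local Notation Z := 'Z_(p ^ N.+1).
Local Notation G := (gammap p N).
Let p_gt0 := prime_gt0 p_pr.
Let p_gt1 := prime_gt1 p_pr.
Let p_neq0 := natr_prime_neq0 p_pr.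

Lemma gammap_natr n : (0 < n)%N -> G n%:R = gamma_nat p N n.
Proof. by move=> n0; apply: gammapE => //; apply: pcong_refl. Qed.

Lemma gammap_cong x y : y \is a pint p -> pcong p N.+1 x y -> G x = G y.
Proof.
move=> py xy; have [n n0 yn] := pcong_nat_exists p_gt1 N.+1 py.
by rewrite (gammapE p_pr p_odd n0 yn) (gammapE p_pr p_odd n0 (pcong_trans xy yn)).
Qed.

Lemma gammap_unit x : x \is a pint p -> G x \is a GRing.unit.
Proof.
move=> px; have [n n0 xn] := pcong_nat_exists p_gt1 N.+1 px.
by rewrite (gammapE p_pr p_odd n0 xn) gamma_nat_unit.
Qed.

Lemma gammap1 : G 1 = -1.
Proof. by rewrite (@gammap_natr 1) // gamma_natE big_geq // expr1 mulr1. Qed.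

Lemma gammap0 : G 0 = 1.
Proof.
have P_gt0 : (0 < p ^ N.+1)%N by rewrite expn_gt0 p_gt0.
have P1 : gamma_nat p N (p ^ N.+1).+1 = G 1.
  by rewrite (@gammap_natr 1) // -(@gamma_nat_period _ p_pr p_odd N 1 1) // mul1n add1n.
rewrite (gammapE p_pr p_odd P_gt0); last first.
  by rewrite /pcong sub0r natrX mulNr divff ?expf_neq0 // rpredN1.
by apply: oppr_inj; rewrite -gammap1 -P1 gamma_natS // /pfree dvdn_exp // mulr1.
Qed.

Definition gammap_ratio (x : rat) : Z :=
  if x / p%:R \is a pint p then -1 else - Zpn_rat p N x.

Lemma pint_natr_divp n : (n%:R / p%:R \is a pint p) = (p %| n)%N.
Proof.
have := pcong_int p_gt1 1 n%:Z 0.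
by rewrite /pcong expr1 expn1 subr0 subr0 -pmulrn.
Qed.

Lemma gammapS x : x \is a pint p -> G (x + 1) = G x * gammap_ratio x.
Proof.
move=> px; have [n n0 xn] := pcong_nat_exists p_gt1 N.+1 px.
have xn1 : pcong p N.+1 (x + 1) n.+1%:R by rewrite -natr1 ![_ + 1]addrC pcongDl.
rewrite (gammapE p_pr p_odd n0 xn) (gammapE p_pr p_odd _ xn1) // gamma_natS // -mulrN.
congr (_ * _); rewrite /pfree /gammap_ratio.
have pxn : (x - n%:R) / p%:R \is a pint p.
  by have := pcong_leX p_gt1 (isT : 1 <= N.+1)%N xn; rewrite /pcong expr1.
have -> : x / p%:R = n%:R / p%:R + (x - n%:R) / p%:R by ring.
rewrite rpredDr // pint_natr_divp; case: ifP => // _.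
by rewrite (Zpn_rat_cong p_gt1 _ xn) ?rpred_nat // Zpn_rat_nat.
Qed.

Lemma gammap_ratioN x : x \is a pint p -> gammap_ratio (- x) ^+ 2 = gammap_ratio x ^+ 2.
Proof.
move=> px; rewrite /gammap_ratio mulNr rpredN; case: ifP => // _.
by rewrite Zpn_ratN // opprK sqrrN.
Qed.

Lemma gammap_reflect x : x \is a pint p -> (G x * G (1 - x)) ^+ 2 = 1.
Proof.
move=> px; have [n _ xn] := pcong_nat_exists p_gt1 N.+1 px.
rewrite (gammap_cong _ xn) ?rpred_nat // (gammap_cong _ (pcongBl 1 xn)); last first.
  by rewrite rpredB ?rpred1 ?rpred_nat.
elim: n {xn} => [|n IHn]; first by rewrite subr0 gammap0 gammap1 mul1r sqrrN expr1n.
have -> : 1 - n.+1%:R = - n%:R :> rat by rewrite -natr1 opprD addrCA subrr addr0.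
rewrite -[RHS]IHn -natr1 gammapS ?rpred_nat // [1 - _]addrC gammapS ?rpredN ?rpred_nat //.
by rewrite !exprMn gammap_ratioN ?rpred_nat //; ring.
Qed.

Definition pfree_count n := (\sum_(0 <= l < n) ~~ (p %| l))%N.

Lemma pfree_countS n : pfree_count n.+1 = (n - n %/ p)%N.
Proof.
elim: n => [|n IHn]; first by rewrite /pfree_count big_nat1 dvdn0 div0n.
rewrite /pfree_count big_nat_recr //= -/(pfree_count n.+1) IHn divnS //.
have : (n %/ p <= n)%N by rewrite leq_div.
by case: (p %| n.+1)%N => /=; lia.
Qed.

Variables (d : nat) (d_gt0 : (0 < d)%N) (pd : coprime p d).
Let d_neq0 : d%:R != 0 :> rat. Proof. by rewrite pnatr_eq0 -lt0n. Qed.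
Let dV_pint : d%:R^-1 \is a pint p. Proof. exact: pintV. Qed.

Lemma gammap_ratio_div n :
  gammap_ratio (n%:R / d%:R) * d%:R ^+ (~~ (p %| n)%N) = gammap_ratio n%:R.
Proof.
have -> : gammap_ratio (n%:R / d%:R) =
    if (p %| n)%N then -1 else - Zpn_rat p N (n%:R / d%:R).
  rewrite /gammap_ratio -pint_natr_divp mulrAC.
  suff -> : (n%:R / p%:R / d%:R \is a pint p) = (n%:R / p%:R \is a pint p) by [].
  apply/idP/idP => pn; last by rewrite rpredM.
  by rewrite -[n%:R / _](divfK d_neq0) rpredM ?rpred_nat.
rewrite /gammap_ratio pint_natr_divp; case: (p %| n)%N; first by rewrite mulr1.
rewrite mulNr -(Zpn_rat_nat p N d) expr1 -Zpn_ratM ?rpred_nat ?divfK //.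
by rewrite rpredM ?rpred_nat.
Qed.

(* Gauss's multiplication formula; the power of d counts the integers below n that
   are prime to p. *)
Lemma gammap_mult n :
  (\prod_(i < d) G ((n + i)%N%:R / d%:R)) * d%:R ^+ pfree_count n =
  G n%:R * \prod_(i < d) G (i%:R / d%:R).
Proof.
elim: n => [|n IHn]; first by rewrite /pfree_count big_geq // mulr1 gammap0 mul1r.
have shift : \prod_(i < d) G ((n.+1 + i)%N%:R / d%:R) =
    (\prod_(i < d) G ((n + i)%N%:R / d%:R)) * gammap_ratio (n%:R / d%:R).
  rewrite -!(big_mkord xpredT (fun i => G ((_ + i)%N%:R / d%:R))).
  have -> : \prod_(0 <= i < d) G ((n.+1 + i)%N%:R / d%:R) =
      \prod_(1 <= i < d.+1) G ((n + i)%N%:R / d%:R).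
    by rewrite big_add1; apply: eq_bigr => i _; rewrite addSnnS.
  rewrite big_nat_recr //= [in RHS]big_ltn // addn0 natrD mulrDl divff // gammapS; first by ring.
  by rewrite rpredM ?rpred_nat.
rewrite shift /pfree_count big_nat_recr //= exprD -/(pfree_count n) -natr1 gammapS ?rpred_nat //.
rewrite -gammap_ratio_div.
have -> : forall a b c e : Z, a * b * (c * e) = (a * c) * (b * e) by move=> *; ring.
by rewrite IHn; ring.
Qed.

End GammaFunctional.

(** * The Gross-Koblitz formula *)

Lemma coprime_expn_sub1 p r : (0 < p ^ r - 1)%N -> coprime p (p ^ r - 1).
Proof.
case: r => [|r] // q1_gt0; rewrite -(coprime_pexpl _ _ (ltn0Sn r)) coprime_sym subn1.
by rewrite coprimePn // ltnW // -subn_gt0.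
Qed.

Lemma big_ord_cycle (R : Type) (idx : R) (op : Monoid.com_law idx) r (h : nat -> R) :
  h r = h 0 -> \big[op/idx]_(l < r) h l.+1 = \big[op/idx]_(l < r) h l.
Proof. by case: r => [|r] hr; rewrite ?big_ord0 // big_ord_recr big_ord_recl hr Monoid.mulmC. Qed.

Section DigitRotation.
Variables (p : nat) (p_pr : prime p) (r : nat).
Local Notation q := (p ^ r)%N.
Let p_gt0 := prime_gt0 p_pr.
Let q_gt0 : (0 < q)%N. Proof. by rewrite expn_gt0 p_gt0. Qed.

(* Division of a p^l by q - 1: the remainder is a with its r base-p digits rotated
   l times. *)
Definition rot_quot a l := ((a * p ^ l) %/ (q - 1))%N.
Definition rot_rem a l := ((a * p ^ l) %% (q - 1))%N.

(* For 0 < a < q - 1, carries p a is the sum of the base-p digits of a. *)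
Definition carries m a := (\sum_(l < r) (m * rot_rem a l) %/ (q - 1))%N.

Lemma rot_quot_rem a l : ((q - 1) * rot_quot a l + rot_rem a l = a * p ^ l)%N.
Proof. by rewrite mulnC -divn_eq. Qed.

Lemma rot_remM m a l : rot_rem ((m * a) %% (q - 1))%N l = ((m * rot_rem a l) %% (q - 1))%N.
Proof. by rewrite /rot_rem modnMml modnMmr mulnA. Qed.

Lemma expn_mod_sub1 k : q ^ k = 1 %[mod q - 1].
Proof.
have q_mod : (q %% (q - 1) = 1 %% (q - 1))%N by rewrite -{1}(subnK q_gt0) modnDl.
by rewrite -modnXm q_mod modnXm exp1n.
Qed.

Lemma rot_remD a k l : rot_rem a (r * k + l) = rot_rem a l.
Proof.
by rewrite /rot_rem expnD expnM mulnCA -modnMml expn_mod_sub1 modnMml mul1n.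
Qed.

Lemma rot_rem_r a : rot_rem a r = rot_rem a 0.
Proof. by rewrite -(rot_remD a 1 0) muln1 addn0. Qed.

Lemma rot_quotS a l : rot_quot a l = (rot_quot a l.+1 %/ p)%N.
Proof. by rewrite /rot_quot -divnMA expnSr mulnA divnMr. Qed.

Lemma sum_rot_rem m a :
  (m * \sum_(l < r) rot_rem a l =
   (q - 1) * carries m a + \sum_(l < r) rot_rem ((m * a) %% (q - 1)) l)%N.
Proof.
rewrite /carries !big_distrr -big_split /=; apply: eq_bigr => l _.
by rewrite rot_remM mulnC -mulnC [((q - 1) * _)%N]mulnC -divn_eq.
Qed.

Lemma sum_rot_rem_digits a : ((p - 1) * \sum_(l < r) rot_rem a l = (q - 1) * carries p a)%N.
Proof.
rewrite mulnBl mul1n sum_rot_rem.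
have -> : (\sum_(l < r) rot_rem ((p * a) %% (q - 1)) l = \sum_(l < r) rot_rem a l.+1)%N.
  by apply: eq_bigr => l _; rewrite rot_remM /rot_rem modnMmr expnS mulnCA.
by rewrite (big_ord_cycle _ (rot_rem_r a)) addnK.
Qed.

Section Bounds.
Variable a : nat.
Hypothesis a_bound : (0 < a < q - 1)%N.
Let a_gt0 : (0 < a)%N. Proof. by case/andP: a_bound. Qed.
Let a_lt : (a < q - 1)%N. Proof. by case/andP: a_bound. Qed.
Let q1_gt0 : (0 < q - 1)%N. Proof. exact: leq_ltn_trans a_lt. Qed.

Lemma rot_rem_bound l : (0 < rot_rem a l < q - 1)%N.
Proof.
rewrite ltn_mod q1_gt0 andbT lt0n; apply/negP => /eqP rem0.
have : (q - 1 %| a * p ^ l)%N by rewrite /dvdn -/(rot_rem a l) rem0.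
rewrite Gauss_dvdl; last by rewrite coprime_sym coprimeXl ?coprime_expn_sub1.
by move/(dvdn_leq a_gt0); rewrite leqNgt a_lt.
Qed.

Lemma rot_quot_mul k : rot_quot a (r * k) = (a * geom q k)%N.
Proof.
rewrite /rot_quot; have -> : (a * p ^ (r * k) = a * geom q k * (q - 1) + a)%N.
  by rewrite -mulnA [(geom _ _ * _)%N]mulnC geomE // -mulnSr expnM subn1 prednK // expn_gt0 q_gt0.
by rewrite divnMDl // divn_small ?addn0.
Qed.

Lemma rot_quot_diff k : (rot_quot a (r * k) + a * q ^ k = rot_quot a (r * k.+1))%N.
Proof.
rewrite !rot_quot_mul geomS mulnDr muln1; have := geomE k q_gt0; move: (geom q k) => g.
have : (0 < q ^ k)%N by rewrite expn_gt0 q_gt0.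
move: q q_gt0 (q ^ k)%N => Q Q_gt0 X X_gt0 geom_eq.
by have -> : (X = (Q - 1) * g + 1)%N; [lia | case: Q Q_gt0 {geom_eq} => // Q _; rewrite subSS subn0; ring].
Qed.

Lemma sum_rot_quotS k :
  (\sum_(l < r) rot_quot a (r * k + l.+1) = \sum_(l < r) rot_quot a (r * k + l) + a * q ^ k)%N.
Proof.
apply/eqP; rewrite -(eqn_add2l (rot_quot a (r * k))) addnCA rot_quot_diff; apply/eqP.
transitivity (\sum_(l < r.+1) rot_quot a (r * k + l))%N.
  by rewrite [RHS]big_ord_recl addn0.
by rewrite big_ord_recr mulnSr.
Qed.

Lemma carries_sum_quot k :
  (carries p a + (p - 1) * \sum_(l < r) rot_quot a (r * k + l) = a * q ^ k)%N.
Proof.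
apply/eqP; rewrite -(eqn_add2l (\sum_(l < r) rot_quot a (r * k + l))) -sum_rot_quotS.
rewrite addnCA -mulSn -subSn // subSS subn0 /carries big_distrr -big_split /=; apply/eqP.
apply: eq_bigr => l _; rewrite -(rot_remD a k) {2}/rot_quot addnS expnSr mulnA -rot_quot_rem.
rewrite mulnDl -mulnA [((q - 1) * (_ * p))%N]mulnC divnMDl //.
by rewrite addnC [(rot_rem _ _ * p)%N]mulnC [(_ * p)%N in RHS]mulnC.
Qed.

Lemma carries_digit_leq : (carries p a <= (p - 1) * r)%N.
Proof.
rewrite /carries mulnC -[r in (_ <= r * _)%N]card_ord -sum_nat_const; apply: leq_sum => l _.
have /andP[_ lt_rem] := rot_rem_bound l.
by rewrite -ltnS -subSn // subSS subn0 ltn_divLR // ltn_pmul2l.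
Qed.

Lemma fact_rot_quot m i :
  ((rot_quot a (m + i))`! = p ^ (\sum_(l < i) rot_quot a (m + l)) * (rot_quot a m)`! *
     \prod_(l < i) pfact p (rot_quot a (m + l.+1)))%N.
Proof.
elim: i => [|i IHi]; first by rewrite !big_ord0 addn0 mul1n muln1.
rewrite addnS (fact_pfact p_pr) -rot_quotS IHi !big_ord_recr /= expnD addnS; ring.
Qed.

End Bounds.
End DigitRotation.

Section GrossKoblitz.
Variables (p : nat) (p_pr : prime p) (p_odd : odd p) (r N : nat) (r_gt0 : (0 < r)%N).
Local Notation q := (p ^ r)%N.
Local Notation Z := 'Z_(p ^ N.+1).
Let p_gt0 := prime_gt0 p_pr.
Let p_gt1 := prime_gt1 p_pr.
Let p_neq0 := natr_prime_neq0 p_pr.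
Let q_gt0 : (0 < q)%N. Proof. by rewrite expn_gt0 p_gt0. Qed.

Definition rot_frac a l : rat := (rot_rem p r a l)%:R / (q - 1)%:R.

Definition gamma_orbit a : Z := \prod_(l < r) gammap p N (1 - rot_frac a l).

Lemma rot_frac_pcong a l : (0 < a < q - 1)%N -> (N.+1 <= l)%N ->
  pcong p N.+1 (1 - rot_frac a l) (rot_quot p r a l).+1%:R.
Proof.
move=> /andP[a_gt0 a_lt] leNl; have q1_gt0 : (0 < q - 1)%N := ltn_trans a_gt0 a_lt.
have pq1 := coprime_expn_sub1 q1_gt0.
have q1_neq0 : (q - 1)%:R != 0 :> rat by rewrite pnatr_eq0 -lt0n.
have /(congr1 (fun n : nat => n%:R : rat)) := rot_quot_rem p r a l.
rewrite natrD natrM => quot_remE.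
have diffE : 1 - rot_frac a l - (rot_quot p r a l).+1%:R = - (a * p ^ l)%:R / (q - 1)%:R.
  by rewrite -quot_remE /rot_frac -natr1; field.
rewrite /pcong diffE -(subnK leNl) expnD mulnA natrM [(p ^ N.+1)%:R]natrX.
rewrite -mulNr mulrAC mulfK ?expf_neq0 //.
by rewrite rpredM ?rpredN ?rpred_nat ?pintV.
Qed.

Lemma gamma_orbit_quot a k : (0 < a < q - 1)%N -> (N.+1 <= k)%N ->
  gamma_orbit a = \prod_(l < r) gamma_nat p N (rot_quot p r a (r * k + l.+1)).+1.
Proof.
move=> a_bound leNk.
pose h l := gammap p N (1 - rot_frac a l).
have h_cycle : h r = h 0%N by rewrite /h /rot_frac rot_rem_r.
rewrite /gamma_orbit -[LHS](big_ord_cycle _ h_cycle); apply: eq_bigr => l _.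
rewrite /h -[rot_frac _ _](_ : rot_frac a (r * k + l.+1) = _); last by rewrite /rot_frac rot_remD.
apply: gammapE => //; apply: rot_frac_pcong => //.
by rewrite (leq_trans leNk) // (leq_trans _ (leq_addr _ _)) // leq_pmull.
Qed.

Lemma gamma_orbit_unit a : (0 < a < q - 1)%N -> gamma_orbit a \is a GRing.unit.
Proof.
move=> a_bound; rewrite (gamma_orbit_quot a_bound (leqnn _)).
by apply: rpred_prod => l _; apply: gamma_nat_unit.
Qed.

Lemma prod_pfact_gamma (n : 'I_r -> nat) :
  (\prod_(l < r) pfact p (n l))%:R =
  (-1) ^+ (\sum_(l < r) n l + r) * \prod_(l < r) gamma_nat p N (n l).+1 :> Z.
Proof.
have -> : (\sum_(l < r) n l + r = \sum_(l < r) (n l).+1)%N.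
  by under [RHS]eq_bigr do rewrite -addn1; rewrite big_split sum1_card card_ord.
rewrite -prodrXr -big_split natr_prod; apply: eq_bigr => l _ /=.
by rewrite gamma_nat_pfact mulrA -exprMn mulrNN mulr1 expr1n mul1r.
Qed.

Variables (F : finFieldType) (cardF : #|F| = q).
Variables (A : comNzRingType) (iota : {rmorphism Z -> A}).
Variables (pi : A) (piE : pi ^+ (p - 1) = - p%:R).
Variables (om : F -> A) (om_lift : multiplicative_lift p om).
Local Notation psi := (dwork_psi r iota pi om).

Lemma gross_koblitz a : (0 < a < q - 1)%N ->
  gauss_sum om psi a = (-1) ^+ (a + r).+1 * pi ^+ carries p r p a * iota (gamma_orbit a)^-1.
Proof.
move=> a_bound; have [k0 limit] := gauss_sum_limit p_pr iota piE cardF om_lift r_gt0 a_bound.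
pose k := (k0 + N.+1)%N; pose M := (a * geom q k)%N.
have M_eq : (a + (q - 1) * M = a * q ^ k)%N.
  by rewrite /M mulnCA geomE // -mulnS subn1 prednK // expn_gt0 q_gt0.
have quot_fact := fact_rot_quot p_pr r a (r * k) r.
have sum_digits := carries_sum_quot p_pr a_bound k.
rewrite -mulnSr !(rot_quot_mul p_pr a_bound) geomS mulnDr muln1 mulnCA -/M in quot_fact.
move: quot_fact sum_digits; set S := \sum_(l < r) _; set W := \prod_(l < r) _ => quot_fact sum_digits.
have W_gt0 : (0 < W)%N by apply: prodn_gt0 => l; apply: pfact_gt0.
have pW : coprime p W.
  by apply: (big_ind (coprime p)) => // [|x y px py|l _]; rewrite ?coprimen1 ?coprimeMr ?px ?coprime_pfact.
have pWV : W%:R^-1 \is a pint p by rewrite pintV.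
have W_neq0 : W%:R != 0 :> rat by rewrite pnatr_eq0 -lt0n.
rewrite (limit k M (leq_addr _ _) M_eq).
have -> : M`!%:R * varpi p r ^+ M / (q * M + a)`!%:R =
    (- p%:R) ^+ (geom p r * M) * ((p%:R ^+ S)^-1 / W%:R) :> rat.
  rewrite quot_fact !natrM natrX /varpi -exprM; field.
  by rewrite W_neq0 natr_fact_neq0 expf_neq0.
rewrite -(pi_mul_shift p_pr) mulnA geomE // M_eq -sum_digits (pi_mul_shift p_pr).
have -> : (- p%:R) ^+ S * ((p%:R ^+ S)^-1 / W%:R) = (-1) ^+ S / W%:R :> rat.
  by rewrite exprNn; field; rewrite W_neq0 expf_neq0.
rewrite (pi_mul_pint p_pr iota piE) ?rpredM ?rpred_sign // Zpn_ratM ?rpred_sign // Zpn_ratV //.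
rewrite Zpn_ratX ?rpredN1 // (Zpn_rat_int p N (-1)) /W prod_pfact_gamma sum_rot_quotS // -/S.
rewrite -gamma_orbit_quot // ?leq_addl // invrM ?gamma_orbit_unit ?unitrX ?unitrN1 // invr_sign.
rewrite [_^-1 * _]mulrC mulrA (_ : (-1) ^+ S * (-1) ^+ _ = (-1) ^+ (a + r)).
  by rewrite rmorphM rmorphXn rmorphN1 exprS; ring.
rewrite -exprD -signr_odd -[RHS]signr_odd !oddD oddM !oddX p_odd !orbT andbT.
by case: (odd S); case: (odd a); case: (odd r).
Qed.

Variables (d : nat) (d_odd : odd d) (d_cop : coprime (q - 1) d).

Lemma ndvd_mul_bound j : (0 < j < q - 1)%N -> ~~ (q - 1 %| d * j)%N.
Proof. by case/andP=> j0 jq; rewrite Gauss_dvdr // gtnNdvd. Qed.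

Lemma mul_mod_bound j : (0 < j < q - 1)%N -> (0 < (d * j) %% (q - 1) < q - 1)%N.
Proof.
move=> j_bound; have := ndvd_mul_bound j_bound; rewrite /dvdn -lt0n => ->.
by rewrite ltn_mod; case/andP: j_bound => _; apply: leq_ltn_trans.
Qed.

Lemma carries_digits j : (0 < j < q - 1)%N ->
  (d * carries p r p j = (p - 1) * carries p r d j + carries p r p ((d * j) %% (q - 1)))%N.
Proof.
move=> /andP[_ jq]; have q1_gt0 : (0 < q - 1)%N by apply: leq_ltn_trans jq.
apply/eqP; rewrite -(eqn_pmul2l q1_gt0) mulnCA -sum_rot_rem_digits // mulnCA (sum_rot_rem p r).
by rewrite !mulnDr -sum_rot_rem_digits // mulnCA.
Qed.

Lemma jacobi_sum_pi j : (0 < j < q - 1)%N ->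
  jacobi_sum om d j * pi ^+ carries p r p ((d * j) %% (q - 1)) =
  pi ^+ (d * carries p r p j) * iota (gamma_orbit ((d * j) %% (q - 1)) / gamma_orbit j ^+ d).
Proof.
move=> j_bound; have j'_bound := mul_mod_bound j_bound; set j' := ((d * j) %% (q - 1))%N in j'_bound *.
have om_char := lift_separating om_lift (natrXS_eq0 p_pr iota).
have psi_char := dwork_psi_character p_pr iota piE cardF om_lift.
have ndvd : ~~ (#|F| - 1 %| d * j)%N by rewrite cardF ndvd_mul_bound.
have := jacobi_gauss_sum om_char psi_char ndvd.
have -> : gauss_sum om psi (d * j) = gauss_sum om psi j'.
  by apply: eq_bigr => x x0; rewrite (character_modn om_char) ?invr_eq0 // cardF.
have sign_j' : (-1) ^+ (j' + r).+1 = (-1) ^+ (j + r).+1 :> A.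
  have /(congr1 odd) := divn_eq (d * j) (q - 1); rewrite -/j' oddD !oddM d_odd oddB // oddX p_odd orbT.
  by rewrite andbF /= => odd_j; rewrite -[LHS]signr_odd -[RHS]signr_odd /= !oddD odd_j.
have sign_jd : (-1) ^+ (j + r).+1 ^+ d = (-1) ^+ (j + r).+1 :> A.
  by rewrite -exprM -signr_odd oddM d_odd andbT signr_odd.
rewrite !gross_koblitz // !exprMn sign_j' sign_jd => jacobi_gauss.
have gamma_inv : iota (gamma_orbit j')^-1 * iota (gamma_orbit j') = 1.
  by rewrite -rmorphM mulVr ?rmorph1 ?gamma_orbit_unit.
have sign_sqr : (-1) ^+ (j + r).+1 * (-1) ^+ (j + r).+1 = 1 :> A by rewrite -expr2 sqrr_sign.
transitivity ((-1) ^+ (j + r).+1 * iota (gamma_orbit j') * (jacobi_sum om d j *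
  ((-1) ^+ (j + r).+1 * pi ^+ carries p r p j' * iota (gamma_orbit j')^-1))).
  rewrite -[LHS](mul1r) -[X in X * _](mulr1) -{1}sign_sqr -gamma_inv; ring.
rewrite jacobi_gauss -exprVn rmorphM rmorphXn mulnC exprM.
have -> : forall e g x y : A, e * g * (e * x * y) = e * e * (x * (g * y)) by move=> *; ring.
by rewrite sign_sqr mul1r.
Qed.

(* The factors p ^ r on both sides leave room for r (p - 1) spare powers of pi, which
   makes the digit sums of jacobi_sum_pi cancel without dividing by p. *)
Lemma jacobi_gross_koblitz j : (0 < j < q - 1)%N ->
  p%:R ^+ r * jacobi_sum om d j = (- p%:R) ^+ carries p r d j * p%:R ^+ r *
    iota (gamma_orbit ((d * j) %% (q - 1)) / gamma_orbit j ^+ d).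
Proof.
move=> j_bound; have le_digits := carries_digit_leq p_pr (mul_mod_bound j_bound).
have signed : (- p%:R) ^+ r * jacobi_sum om d j =
    (- p%:R) ^+ (carries p r d j + r) * iota (gamma_orbit ((d * j) %% (q - 1)) / gamma_orbit j ^+ d).
  rewrite -piE -!exprM -(subnKC le_digits) exprD mulrC mulrA jacobi_sum_pi //.
  by rewrite mulrAC -exprD carries_digits // mulnDr -addnA subnKC.
have -> : p%:R ^+ r = (-1) ^+ r * (- p%:R) ^+ r :> A.
  by rewrite [(- p%:R) ^+ r]exprNn mulrA -expr2 sqrr_sign mul1r.
by rewrite -[LHS]mulrA signed exprD; ring.
Qed.

End GrossKoblitz.

(** * The coefficients of McCarthy's function *)

Section AffineReindexing.
Variables (R : Type) (idx : R) (op : Monoid.com_law idx) (d c : nat).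
Hypothesis cop_dc : coprime d c.

Lemma big_affine_mod e (h : nat -> R) :
  \big[op/idx]_(i < d) h ((i * c + e) %% d)%N = \big[op/idx]_(i < d) h i.
Proof.
have lt_mod (i : 'I_d) : ((i * c + e) %% d < d)%N by rewrite ltn_mod (leq_ltn_trans _ (ltn_ord i)).
pose f i := Ordinal (lt_mod i); rewrite [RHS](reindex_inj (_ : injective f)) // => i1 i2 [].
wlog le_i12 : i1 i2 / (i1 <= i2)%N => [sym|] /eqP mod_eq.
  by case: (leqP i1 i2) => [|/ltnW] le_i; [apply: sym | apply/esym/sym]; rewrite // (eqP mod_eq).
move: mod_eq; rewrite eqn_modDr eq_sym eqn_mod_dvd ?leq_mul2r ?le_i12 ?orbT // -mulnBl Gauss_dvdl //.
move=> d_dvd; apply/val_inj/eqP; rewrite eqn_leq le_i12 -subn_eq0 /=.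
by apply: contraLR d_dvd; rewrite -lt0n => lt_i12; rewrite gtnNdvd // (leq_ltn_trans (leq_subr _ _)).
Qed.

Lemma big_mul_mod (h : nat -> R) :
  \big[op/idx]_(i < d.-1) h ((i.+1 * c) %% d)%N = \big[op/idx]_(1 <= m < d) h m.
Proof.
have := big_affine_mod 0 (fun m => if m == 0%N then idx else h m).
case: d cop_dc => [|d'] cop; first by move=> _; rewrite [RHS]big_geq // big_ord0.
have dvd_mul i : (d'.+1 %| i * c)%N = (d'.+1 %| i)%N by rewrite Gauss_dvdl.
rewrite !big_ord_recl mod0n eqxx !Monoid.mul1m => eq_big_mod.
rewrite big_add1 big_mkord -[RHS]eq_big_mod; apply: eq_bigr => i _.
by rewrite addn0 -[_ == 0%N]/(d'.+1 %| _)%N dvd_mul gtnNdvd // ltnS.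
Qed.

End AffineReindexing.

Lemma floor_natr_div (a b : nat) : Num.floor (a%:R / b%:R : rat) = (a %/ b)%N.
Proof.
have [->|b_gt0] := posnP b; first by rewrite invr0 mulr0 divn0 floor0.
have b0 : 0 < (b%:R : rat) by rewrite ltr0n.
apply: floor_def; rewrite -!pmulrn ler_pdivlMr // ltr_pdivrMr // -!natrM ler_nat ltr_nat.
by rewrite leq_divM addn1 ltn_ceil.
Qed.

Lemma fracq_natr_div (a b : nat) : (0 < b)%N -> Defs.fracq (a%:R / b%:R) = (a %% b)%N%:R / b%:R.
Proof.
move=> b_gt0; have b0 : (b%:R : rat) != 0 by rewrite pnatr_eq0 -lt0n.
rewrite /Defs.fracq floor_natr_div -pmulrn {1}(divn_eq a b) natrD natrM mulrDl mulfK //.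
by rewrite addrC addrA addNr add0r.
Qed.

Lemma fracq_unique (x y : rat) (z : int) : x = z%:~R + y -> 0 <= y < 1 -> Defs.fracq x = y.
Proof.
move=> -> /andP[y0 y1]; rewrite /Defs.fracq (@floor_def _ _ z); first by rewrite addrAC subrr add0r.
by rewrite lerDl y0 intrD ltrD2l.
Qed.

Lemma sum_nat_leq c d : (c < d)%N -> (\sum_(1 <= m < d) (m <= c) = c)%N.
Proof.
move=> lt_cd; rewrite (big_cat_nat (n := c.+1)) //=.
rewrite (eq_big_nat _ _ (F2 := fun=> 1%N)) => [|m /andP[_]]; last by rewrite ltnS => ->.
rewrite sum_nat_const_nat muln1 subn1 big_nat_cond big1 ?addn0 // => m.
by rewrite andbT => /andP[lt_cm _]; rewrite leqNgt lt_cm.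
Qed.

Section McFactor.
Variables (p : nat) (p_pr : prime p) (p_odd : odd p) (r N : nat).
Variables (d : nat) (d_gt0 : (0 < d)%N) (pd : coprime p d).
Local Notation q := (p ^ r)%N.
Local Notation Z := 'Z_(p ^ N.+1).
Local Notation G := (gammap p N).
Let p_gt1 := prime_gt1 p_pr.
Let d_neq0 : (d%:R : rat) != 0. Proof. by rewrite pnatr_eq0 -lt0n. Qed.

Definition mc_coef j := \prod_(m < d.-1) \prod_(l < r) mc_factor p r N (m.+1%:R / d%:R) 0 j l.

Lemma mc_factor0 m l : mc_factor p r N (m%:R / d%:R) 0 0 l = p%:R.
Proof.
rewrite /mc_factor !(mul0r, subr0, oppr0, addr0) [_ * (p ^ l)%:R]mulrAC -natrM.
have fracq0 : Defs.fracq 0 = 0 by rewrite /Defs.fracq floor0 subr0.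
rewrite fracq0 fracq_natr_div // floor_natr_div divn_small ?ltn_mod //.
rewrite oppr0 add0r expr0z mul1r expr1 !divrr ?mulr1 ?gammap_unit ?rpred0 //.
by rewrite rpredM ?rpred_nat ?pintV.
Qed.

Lemma mc_coef0 : mc_coef 0 = p%:R ^+ (d.-1 * r).
Proof.
rewrite /mc_coef; under eq_bigr do under eq_bigr do rewrite mc_factor0.
by rewrite !prodr_const !card_ord -exprM mulnC.
Qed.

Hypothesis d_cop : coprime (q - 1) d.
Variable j : nat.
Hypothesis j_bound : (0 < j < q - 1)%N.
Local Notation j' := ((d * j) %% (q - 1))%N.
Local Notation carry l := ((d * rot_rem p r j l) %/ (q - 1))%N.
Let j'_bound : (0 < j' < q - 1)%N. Proof. exact: mul_mod_bound. Qed.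
Let q1_gt0 : (0 < q - 1)%N. Proof. by case/andP: j_bound => _; apply: leq_ltn_trans. Qed.
Let r_gt0 : (0 < r)%N. Proof. by move: q1_gt0; case: (r). Qed.
Let pq1 : coprime p (q - 1). Proof. exact: coprime_expn_sub1. Qed.
Let q1_neq0 : ((q - 1)%:R : rat) != 0. Proof. by rewrite pnatr_eq0 -lt0n. Qed.

Let rot_frac_pint a l : rot_frac p r a l \is a pint p.
Proof. by rewrite rpredM ?rpred_nat ?pintV. Qed.

Let div_d_pint x : x \is a pint p -> x / d%:R \is a pint p.
Proof. by move=> px; rewrite rpredM ?pintV. Qed.

Lemma rot_frac_bound a l : (0 < a < q - 1)%N -> 0 < rot_frac p r a l < 1.
Proof.
move=> a_bound; have /andP[rem_gt0 rem_lt] := rot_rem_bound a_bound l.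
have q1r : 0 < ((q - 1)%:R : rat) by rewrite ltr0n.
by rewrite /rot_frac divr_gt0 ?ltr0n //= ltr_pdivrMr // mul1r ltr_nat.
Qed.

Lemma carry_lt l : (carry l < d)%N.
Proof.
have /andP[_ rem_lt] := rot_rem_bound j_bound l.
by rewrite ltn_divLR // ltn_pmul2l.
Qed.

Lemma rot_frac_carry l : d%:R * rot_frac p r j l = (carry l)%:R + rot_frac p r j' l.
Proof.
rewrite /rot_frac mulrA -natrM {1}(divn_eq (d * rot_rem p r j l) (q - 1)) -rot_remM.
by rewrite natrD natrM mulrDl mulfK.
Qed.

(* The fractional part of m/d - j p^l / (q - 1). *)
Definition shifted_frac l m : rat := m%:R / d%:R - rot_frac p r j l + (m <= carry l)%N%:R.

Lemma shifted_fracE l m : (m < d)%N -> shifted_frac l m =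
  (1 - rot_frac p r j' l + ((m * 1 + (d - (carry l).+1)) %% d)%N%:R) / d%:R.
Proof.
move=> md; have cd := carry_lt l; apply: (mulIf d_neq0); rewrite divfK // /shifted_frac.
rewrite mulrDl mulrBl divfK // [rot_frac _ _ _ _ * _]mulrC rot_frac_carry muln1.
case: leqP => [le_mc|lt_cm] /=.
  rewrite [((m + _) %% d)%N]modn_small; last by lia.
  by rewrite natrD natrB // -[(_.+1)%:R]natr1; ring.
have -> : (m + (d - (carry l).+1) = d + (m - (carry l).+1))%N by lia.
rewrite modnDl [((m - _) %% d)%N]modn_small; last exact: leq_ltn_trans (leq_subr _ _) md.
by rewrite natrB // -[(_.+1)%:R]natr1; ring.
Qed.

Lemma shifted_frac_bound l m : (m < d)%N -> 0 <= shifted_frac l m < 1.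
Proof.
move=> md; have /andP[Y0 Y1] := rot_frac_bound l j'_bound.
rewrite shifted_fracE //; set t := (_ %% d)%N.
have td : (t%:R + 1 <= d%:R :> rat) by rewrite natr1 ler_nat ltn_mod.
have t0 : 0 <= (t%:R : rat) by rewrite ler0n.
by rewrite divr_ge0 ?ltW // ?ltr_pdivrMr // ?mul1r; lra.
Qed.

Lemma prod_shifted_frac l :
  \prod_(m < d) G (shifted_frac l m) = \prod_(i < d) G ((1 - rot_frac p r j' l + i%:R) / d%:R).
Proof.
rewrite -(big_affine_mod _ (coprimen1 d) (d - (carry l).+1)
  (fun i => G ((1 - rot_frac p r j' l + i%:R) / d%:R))).
by apply: eq_bigr => m _; rewrite shifted_fracE.
Qed.

Lemma mc_factorE i l : let m := ((i * p ^ l) %% d)%N in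
  mc_factor p r N (i%:R / d%:R) 0 j l =
  (-1) ^+ (m <= carry l)%N * p%:R ^+ (m <= carry l)%N.+1 *
  (G (shifted_frac l m) / G (m%:R / d%:R)) * G (rot_frac p r j l).
Proof.
move=> m; have md : (m < d)%N by rewrite ltn_mod.
have /andP[x0 x1] := rot_frac_bound l j_bound; have /andP[f0 f1] := shifted_frac_bound l md.
have mulpE : i%:R / d%:R * (p ^ l)%:R = (i * p ^ l)%:R / d%:R :> rat by rewrite mulrAC natrM.
have quot_fracE : j%:R * (p ^ l)%:R / (q - 1)%:R = (rot_quot p r j l)%:R + rot_frac p r j l.
  by rewrite -natrM -(rot_quot_rem p r) natrD natrM mulrDl mulrAC mulfV // mul1r.
have fracq_i : Defs.fracq (i%:R / d%:R * (p ^ l)%:R) = m%:R / d%:R.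
  by rewrite mulpE fracq_natr_div.
have fracq_0 : Defs.fracq (- 0 * (p ^ l)%:R) = 0.
  by rewrite oppr0 mul0r /Defs.fracq floor0 subr0.
have fracq_ij : Defs.fracq ((i%:R / d%:R - j%:R / (q - 1)%:R) * (p ^ l)%:R) = shifted_frac l m.
  apply: (@fracq_unique _ _
    (((i * p ^ l) %/ d)%N%:Z - (rot_quot p r j l)%:Z - (m <= carry l)%N%:Z)); last by rewrite f0.
  rewrite mulrBl mulpE {1}(divn_eq (i * p ^ l) d) natrD natrM [(_ * _ + _) / _]mulrDl mulfK //.
  by rewrite [j%:R / _ * _]mulrAC quot_fracE /shifted_frac !intrB -!pmulrn; ring.
have fracq_j : Defs.fracq ((- 0 + j%:R / (q - 1)%:R) * (p ^ l)%:R) = rot_frac p r j l.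
  apply: (@fracq_unique _ _ (rot_quot p r j l)%:Z); last by rewrite x1 ltW.
  by rewrite oppr0 add0r mulrAC quot_fracE.
rewrite /mc_factor -subn1 fracq_i fracq_0 fracq_ij fracq_j quot_fracE add0r gammap0 // divr1.
have -> : Num.floor ((rot_quot p r j l)%:R + rot_frac p r j l) = (rot_quot p r j l)%:Z.
  by apply: floor_def; rewrite intrD -!pmulrn lerDl ltW //= ltrD2l.
have -> : Num.floor (m%:R / d%:R - ((rot_quot p r j l)%:R + rot_frac p r j l)) =
    - (rot_quot p r j l)%:Z - (m <= carry l)%N%:Z.
  by move: f0 f1; rewrite /shifted_frac => f0 f1; apply: floor_def; rewrite !intrD !rmorphN /= -!pmulrn; lra.
by rewrite opprB opprK addrK; case: leqP.
Qed.

Lemma prod_gammap_shifted l :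
  \prod_(1 <= m < d) (G (shifted_frac l m) / G (m%:R / d%:R)) =
  \prod_(i < d) G ((1 - rot_frac p r j' l + i%:R) / d%:R) / \prod_(i < d) G (i%:R / d%:R) /
    G (1 - rot_frac p r j l).
Proof.
have fr0 : shifted_frac l 0 = 1 - rot_frac p r j l by rewrite /shifted_frac mul0r add0r addrC.
rewrite -prod_shifted_frac -(big_mkord xpredT (fun m => G (shifted_frac l m))).
rewrite -(big_mkord xpredT (fun m => G (m%:R / d%:R))) ![\prod_(0 <= _ < d) _]big_ltn // fr0.
rewrite mul0r gammap0 // mul1r big_split prodrV => [|m _]; last by rewrite gammap_unit ?div_d_pint ?rpred_nat.
have G1_unit : G (1 - rot_frac p r j l) \is a GRing.unit by rewrite gammap_unit // rpredB ?rpred1.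
by rewrite -[G _ * _ / _]mulrA [RHS]mulrC mulKr.
Qed.

Lemma gammap_reflect_exp l : odd d ->
  G (rot_frac p r j l) ^+ d.-1 = (G (1 - rot_frac p r j l))^-1 ^+ d.-1.
Proof.
move=> d_odd; have G1_unit : G (1 - rot_frac p r j l) \is a GRing.unit.
  by rewrite gammap_unit // rpredB ?rpred1.
have sqr : G (rot_frac p r j l) ^+ 2 = (G (1 - rot_frac p r j l))^-1 ^+ 2.
  apply: (mulIr (unitrX 2 G1_unit)); rewrite -exprMn gammap_reflect //.
  by rewrite -exprMn mulVr // expr1n.
have -> : d.-1 = (2 * d.-1./2)%N.
  by rewrite mul2n -[LHS]odd_double_half -[odd _]negbK -oddS prednK // d_odd.
by rewrite !exprM sqr.
Qed.

Lemma prod_mc_factor l : odd d ->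
  \prod_(m < d.-1) mc_factor p r N (m.+1%:R / d%:R) 0 j l =
  (- p%:R) ^+ carry l * p%:R ^+ d.-1 *
  (\prod_(i < d) G ((1 - rot_frac p r j' l + i%:R) / d%:R) / \prod_(i < d) G (i%:R / d%:R)) *
  (G (1 - rot_frac p r j l))^-1 ^+ d.
Proof.
move=> d_odd; under eq_bigr do rewrite mc_factorE.
have cop_dp : coprime d (p ^ l) by rewrite coprimeXr // coprime_sym.
rewrite (big_mul_mod _ cop_dp (fun m => (-1) ^+ (m <= carry l)%N * p%:R ^+ (m <= carry l)%N.+1 *
  (G (shifted_frac l m) / G (m%:R / d%:R)) * G (rot_frac p r j l))).
rewrite 3!big_split /= prod_gammap_shifted.
have count1 : (\sum_(1 <= m < d) (m <= carry l).+1 = carry l + d.-1)%N.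
  under eq_bigr do rewrite -addn1.
  by rewrite big_split /= (sum_nat_leq (carry_lt l)) sum_nat_const_nat muln1 [(d - 1)%N]subn1.
rewrite !prodrXr count1 (sum_nat_leq (carry_lt l)) prodr_const_nat [(d - 1)%N]subn1 gammap_reflect_exp //.
have expr_d (x : Z) : x ^+ d = x * x ^+ d.-1 by rewrite -exprS prednK.
by rewrite exprNn exprD expr_d; ring.
Qed.

Lemma gammap_mult_rot_quot a l : (0 < a < q - 1)%N -> (N < l.+1)%N ->
  \prod_(i < d) G ((1 - rot_frac p r a l.+1 + i%:R) / d%:R) / \prod_(i < d) G (i%:R / d%:R) =
  gamma_nat p N (rot_quot p r a l.+1).+1 * d%:R^-1 ^+ (rot_quot p r a l.+1 - rot_quot p r a l).
Proof.
move=> a_bound ltNl; have frac_cong := rot_frac_pcong p_pr a_bound ltNl.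
have := gammap_mult p_pr p_odd N d_gt0 pd (rot_quot p r a l.+1).+1.
rewrite pfree_countS // -(rot_quotS p_pr) gammap_natr //; set D := (_ - _)%N => mult.
have U_unit : \prod_(i < d) G (i%:R / d%:R) \is a GRing.unit.
  by apply: rpred_prod => i _; rewrite gammap_unit ?div_d_pint ?rpred_nat.
have D_unit : (d%:R : Z) ^+ D \is a GRing.unit by rewrite unitrX ?natr_unit_Zpn.
apply: (mulIr U_unit); apply: (mulIr D_unit).
rewrite divrK // mulrAC -[_ * _ * d%:R ^+ _]mulrA -exprMn mulVr ?natr_unit_Zpn // expr1n mulr1 -mult.
congr (_ * _); apply: eq_bigr => i _; apply: gammap_cong => //; first by rewrite div_d_pint ?rpred_nat.
by rewrite natrD ![_ / d%:R]mulrC; apply: pcongMl; rewrite ?pintV // ![_ + i%:R]addrC; apply: pcongDl.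
Qed.

Lemma gammap_mult_orbit a k : (0 < a < q - 1)%N -> (N.+1 <= k)%N ->
  \prod_(l < r) (\prod_(i < d) G ((1 - rot_frac p r a l + i%:R) / d%:R) /
    \prod_(i < d) G (i%:R / d%:R)) =
  gamma_orbit p r N a * d%:R^-1 ^+ (a * q ^ k).
Proof.
move=> a_bound leNk; pose h l := \prod_(i < d) G ((1 - rot_frac p r a l + i%:R) / d%:R) /
  \prod_(i < d) G (i%:R / d%:R).
have h_period l m : h (r * m + l)%N = h l by rewrite /h /rot_frac rot_remD.
have h_cycle : h r = h 0%N by rewrite -(h_period 0%N 1%N) muln1 addn0.
pose Q l := rot_quot p r a (r * k + l).
have h_quot (l : 'I_r) : h l.+1 = gamma_nat p N (Q l.+1).+1 * d%:R^-1 ^+ (Q l.+1 - Q l).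
  rewrite -(h_period _ k) /Q addnS /h gammap_mult_rot_quot // ltnS.
  by apply: leq_trans (leq_addr _ _); rewrite (leq_trans (ltnW leNk)) // leq_pmull.
have quot_le l : (Q l <= Q l.+1)%N by rewrite /Q addnS (rot_quotS p_pr) leq_div.
rewrite -[LHS](big_ord_cycle _ h_cycle) (eq_bigr _ (fun l _ => h_quot l)) big_split /=.
by rewrite -gamma_orbit_quot // prodrXr sumnB // sum_rot_quotS // addKn.
Qed.

Lemma mc_coefE k : odd d -> (N.+1 <= k)%N ->
  mc_coef j = (- p%:R) ^+ carries p r d j * p%:R ^+ (d.-1 * r) *
    (gamma_orbit p r N j' / gamma_orbit p r N j ^+ d) * d%:R^-1 ^+ (j' * q ^ k).
Proof.
move=> d_odd leNk; rewrite /mc_coef exchange_big /=; under eq_bigr do rewrite prod_mc_factor //.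
rewrite 3!big_split /= prodrXr prodr_const card_ord -exprM (gammap_mult_orbit j'_bound leNk).
rewrite prodrXl prodrV => [|l _]; last by rewrite gammap_unit // rpredB ?rpred1.
by rewrite -/(gamma_orbit p r N j) -/(carries p r d j) -[_ ^- d]exprVn; ring.
Qed.

End McFactor.

Section MonicQuotient.
Variables (R : comNzRingType) (h : {poly R}) (h_size : (1 < size h)%N) (h_monic : h \is monic).

Lemma mk_monic_id : mk_monic h = h.
Proof. by rewrite /mk_monic h_size h_monic. Qed.

Lemma in_qpoly_self : in_qpoly h h = 0.
Proof. by apply/val_inj; rewrite /= mk_monic_id Pdiv.RingMonic.rmodpp. Qed.

End MonicQuotient.

Section Coefficient.
Variables (p : nat) (p_pr : prime p) (p_odd : odd p) (r N : nat) (r_gt0 : (0 < r)%N).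
Local Notation q := (p ^ r)%N.
Variables (F : finFieldType) (cardF : #|F| = q).
Variables (d : nat) (d_odd : odd d) (d_gt1 : (1 < d)%N) (pd : coprime p d) (d_cop : coprime (q - 1) d).
Let d_gt0 : (0 < d)%N := ltnW d_gt1.

Lemma mc_coef_jacobi_pi (A : comNzRingType) (iota : {rmorphism 'Z_(p ^ N.+1) -> A}) (pi : A)
    (om : F -> A) j :
  pi ^+ (p - 1) = - p%:R -> multiplicative_lift p om -> (0 < j < q - 1)%N ->
  iota (mc_coef p r N d j) = p%:R ^+ (d.-1 * r) * jacobi_sum om d j * om d%:R^-1 ^+ (d * j).
Proof.
move=> piE om_lift j_bound; have pN := natrXS_eq0 p_pr iota.
have om_char := lift_separating om_lift pN.
have dr : (d.-1 * r = (d - 2) * r + r)%N by rewrite -mulSnr; congr (_ * _)%N; lia.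
rewrite (mc_coefE p_pr p_odd d_gt0 pd d_cop j_bound d_odd (leqnn N.+1)) dr !exprD.
rewrite -[_ * _ * jacobi_sum _ _ _]mulrA.
rewrite (jacobi_gross_koblitz p_pr p_odd r_gt0 cardF iota piE om_lift d_odd d_cop j_bound).
have dF := natr_finField_neq0 p_pr cardF pd.
rewrite (character_modn om_char) ?invr_eq0 // cardF.
rewrite !rmorphM !rmorphXn rmorphN rmorph_nat /=; set j' := ((d * j) %% (q - 1))%N.
suff -> : iota d%:R^-1 ^+ (j' * q ^ N.+1) = om d%:R^-1 ^+ j' by ring.
have [c dE] := lift_natr om_lift d.
have {}dE : (d%:R : A) = om d%:R + p%:R * - c by rewrite dE; ring.
have {}dE := lift_exp_limit om_lift pN r_gt0 cardF (leqnSn N) dE.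
have inv : iota d%:R^-1 * (d%:R : A) = 1.
  by rewrite -(rmorph_nat iota) -rmorphM mulVr ?rmorph1 // natr_unit_Zpn // prime_gt1.
rewrite mulnC exprM; congr (_ ^+ _).
by rewrite -[LHS]mulr1 -(character_mulV om_char dF) -{1}dE mulrA -exprMn inv expr1n mul1r.
Qed.

(* A ring containing pi is obtained as B[X]/(X^(p-1) + p), into which B embeds. *)
Lemma adjoin_pi (B : comNzRingType) : exists (A : comNzRingType) (kap : {rmorphism B -> A}) (pi : A),
  injective kap /\ pi ^+ (p - 1) = - p%:R.
Proof.
have p1_gt0 : (0 < p - 1)%N by rewrite subn_gt0 prime_gt1.
pose h : {poly B} := 'X^(p - 1) + (p%:R)%:P.
have ltC : (size (p%:R%:P : {poly B}) < size ('X^(p - 1) : {poly B}))%N.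
  by rewrite size_polyXn (leq_ltn_trans (size_polyC_leq1 _)).
have h_size : size h = (p - 1).+1 by rewrite size_polyDl // size_polyXn.
have h_monic : h \is monic by rewrite monicE lead_coefDl ?lead_coefXn.
exists {poly %/ h}, (qpolyC h), (in_qpoly h 'X); split.
  by move=> x y /(congr1 (fun z : {poly %/ h} => z : {poly B})); rewrite !qpolyCE => /polyC_inj.
have h0 : in_qpoly h h = 0 by rewrite in_qpoly_self // h_size ltnS.
have hE g : g = 'X^(p - 1) + p%:R -> in_qpoly h g = in_qpoly h 'X ^+ (p - 1) + p%:R.
  by move=> ->; rewrite rmorphD rmorphXn rmorph_nat.
by apply/eqP; rewrite -addr_eq0 -(hE h) ?h0 // /h polyC_natr.
Qed.

Lemma mc_coef_jacobi (B : comNzRingType) (iota : {rmorphism 'Z_(p ^ N.+1) -> B}) (om : F -> B) j :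
  multiplicative_lift p om -> (0 < j < q - 1)%N ->
  iota (mc_coef p r N d j) = p%:R ^+ (d.-1 * r) * jacobi_sum om d j * om d%:R^-1 ^+ (d * j).
Proof.
case=> om0 om1 omM omD j_bound; have [A [kap [pi [kap_inj piE]]]] := adjoin_pi B.
have kap_lift : multiplicative_lift p (kap \o om).
  split=> [|||x y] /=; rewrite ?om0 ?om1 ?rmorph0 ?rmorph1 //.
    by move=> x y /=; rewrite omM rmorphM.
  by have [c ->] := omD x y; exists (kap c); rewrite !rmorphD rmorphM rmorph_nat.
apply: kap_inj; rewrite [LHS](mc_coef_jacobi_pi (kap \o iota) piE kap_lift j_bound).
rewrite !rmorphM !rmorphXn rmorph_nat; congr (_ * _ * _).
by rewrite /jacobi_sum rmorph_sum; apply: eq_bigr => y _; rewrite rmorphXn.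
Qed.

End Coefficient.

(** * Counting points *)

Section NowhereZeroCount.
Variable F : finFieldType.
Local Notation q := #|F|.

Definition ffun_cons d (x : F) (y : {ffun 'I_d -> F}) : {ffun 'I_d.+1 -> F} :=
  [ffun i => oapp y x (unlift ord0 i)].

Lemma ffun_cons0 d x (y : {ffun 'I_d -> F}) : ffun_cons x y ord0 = x.
Proof. by rewrite ffunE unlift_none. Qed.

Lemma ffun_consS d x (y : {ffun 'I_d -> F}) k : ffun_cons x y (lift ord0 k) = y k.
Proof. by rewrite ffunE liftK. Qed.

Lemma big_ffun_cons (R : Type) (idx : R) (op : Monoid.com_law idx) d (G : {ffun 'I_d.+1 -> F} -> R) :
  \big[op/idx]_y G y = \big[op/idx]_x \big[op/idx]_y G (ffun_cons x y).
Proof.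
rewrite pair_big (reindex (fun xy : F * {ffun 'I_d -> F} => ffun_cons xy.1 xy.2)) //=.
exists (fun y : {ffun 'I_d.+1 -> F} => (y ord0, [ffun k => y (lift ord0 k)])) => [[x y] _|y _] /=.
  by rewrite ffun_cons0; congr (_, _); apply/ffunP => k; rewrite ffunE ffun_consS.
apply/ffunP => i; case: (unliftP ord0 i) => [k|] ->; last by rewrite ffun_cons0.
by rewrite ffun_consS ffunE.
Qed.

Lemma sum_ffun_cons d x (y : {ffun 'I_d -> F}) : \sum_i ffun_cons x y i = x + \sum_i y i.
Proof.
by rewrite big_ord_recl ffun_cons0; congr (_ + _); apply: eq_bigr => i _; rewrite ffun_consS.
Qed.

Lemma nowhere_zero_cons d x (y : {ffun 'I_d -> F}) :
  nowhere_zero (ffun_cons x y) = (x != 0) && nowhere_zero y.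
Proof.
rewrite !nowhere_zeroE big_ord_recl ffun_cons0 mulf_eq0 negb_or; congr (_ && (_ != 0)).
by apply: eq_bigr => i _; rewrite ffun_consS.
Qed.

Definition nowhere_zero_count d s := #|[set y : {ffun 'I_d -> F} | nowhere_zero y && (\sum_i y i == s)]|.

Lemma nowhere_zero_countS d s :
  (nowhere_zero_count d.+1 s + nowhere_zero_count d s = \sum_x nowhere_zero_count d x)%N.
Proof.
rewrite [RHS](reindex_inj (can_inj (subKr s))) [RHS](bigD1 0) //= subr0 addnC; congr (_ + _)%N.
rewrite /nowhere_zero_count -sum1dep_card big_mkcond big_ffun_cons [RHS]big_mkcond /=.
apply: eq_bigr => x _; case: eqVneq => [->|x0] /=.
  by rewrite big1 // => y _; rewrite nowhere_zero_cons eqxx.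
rewrite -sum1dep_card [RHS]big_mkcond; apply: eq_bigr => y _.
by rewrite nowhere_zero_cons x0 sum_ffun_cons /= [_ == s - x]eq_sym subr_eq eq_sym addrC.
Qed.

Lemma nowhere_zero_count_diff d s : s != 0 ->
  (nowhere_zero_count d 0)%:Z - (nowhere_zero_count d s)%:Z = (-1) ^+ d.
Proof.
move=> s0; elim: d => [|d IHd].
  have zeroE t : nowhere_zero_count 0 t = (t == 0).
    rewrite /nowhere_zero_count (_ : [set _ | _] = if t == 0 then setT else set0).
      by case: eqP; rewrite ?cards0 // cardsT card_ffun card_ord.
    apply/setP => y; rewrite inE nowhere_zeroE !big_ord0 oner_neq0 eq_sym.
    by case: eqP; rewrite !inE.
  by rewrite !zeroE eqxx (negPf s0).
rewrite exprS mulN1r -IHd; have := nowhere_zero_countS d 0; have := nowhere_zero_countS d s; lia.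
Qed.

Lemma card_hyperplane d : #|[set y : {ffun 'I_d.+1 -> F} | \sum_i y i == 0]| = (q ^ d)%N.
Proof.
rewrite -sum1dep_card big_mkcond big_ffun_cons exchange_big /=.
rewrite (eq_bigr (fun=> 1%N)) => [|y _]; first by rewrite sum1_card card_ffun card_ord.
rewrite (bigD1 (- \sum_i y i)) //= sum_ffun_cons addNr eqxx big1 ?addn0 // => x x_neq.
by rewrite sum_ffun_cons addr_eq0 (negPf x_neq).
Qed.

End NowhereZeroCount.

Section DilationOrbits.
Variables (F : finFieldType) (d : nat).
Local Notation q := #|F|.
Implicit Types x y : {ffun 'I_d -> F}.

Definition dilation_orbit x : {set {ffun 'I_d -> F}} :=
  [set dilate c x | c : F in [set c : F | c != 0]].

Lemma dilation_orbitP x y : reflect (exists2 c, c != 0 & y = dilate c x) (y \in dilation_orbit x).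
Proof. by apply: (iffP imsetP) => [[c]|[c c0 ->]]; [rewrite inE; exists c | exists c; rewrite ?inE]. Qed.

Lemma dilation_orbit_dilate c x : c != 0 -> dilation_orbit (dilate c x) = dilation_orbit x.
Proof.
move=> c0; apply/setP => y; apply/dilation_orbitP/dilation_orbitP => [[b b0 ->]|[b b0 ->]].
  by exists (b * c); rewrite ?mulf_neq0 // dilateM.
by exists (b / c); rewrite ?mulf_neq0 ?invr_eq0 // dilateM divfK.
Qed.

Lemma dilation_orbit_refl x : x \in dilation_orbit x.
Proof. by apply/dilation_orbitP; exists 1; rewrite ?oner_neq0 ?dilate1. Qed.

Lemma card_dilation_orbit x : x != 0 -> #|dilation_orbit x| = (q - 1)%N.
Proof.
move=> x0; have [i xi] : exists i, x i != 0.
  apply/existsP; apply: contraNT x0 => /existsPn x_eq0; apply/eqP/ffunP => i.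
  by have := x_eq0 i; rewrite negbK ffunE => /eqP.
rewrite card_in_imset => [|a b _ _ /ffunP /(_ i)]; last by rewrite !ffunE; apply: mulIf.
by rewrite cardsE card_finField_neq0.
Qed.

Lemma card_dilation_orbits (S : {set {ffun 'I_d -> F}}) :
  0 \notin S -> (forall c x, c != 0 -> x \in S -> dilate c x \in S) ->
  (#|dilation_orbit @: S| * (q - 1) = #|S|)%N.
Proof.
move=> S0 S_stable; rewrite -[RHS]sum1_card (partition_big_imset dilation_orbit) /= -sum_nat_const.
apply: eq_bigr => O /imsetP[x xS ->]; rewrite -(@card_dilation_orbit x); last first.
  by apply: contraNneq S0 => <-.
rewrite sum1dep_card; apply: eq_card => y; rewrite in_set.
apply/idP/andP => [/dilation_orbitP[c c0 ->]|[_ /eqP <-]]; last exact: dilation_orbit_refl.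
by rewrite dilation_orbit_dilate // S_stable.
Qed.

End DilationOrbits.

Section DworkHypersurface.
Variable F : finFieldType.
Local Notation q := #|F|.
Variables (d : nat) (d_gt0 : (0 < d)%N).

Definition dwork_solutions (lam : F) : {set {ffun 'I_d -> F}} :=
  [set x : {ffun 'I_d -> F} | (x != 0) &&
     (\sum_(i < d) x i ^+ d == d%:R * lam * \prod_(i < d) x i)].

Lemma card_dwork_orbits lam :
  (#|@dilation_orbit F d @: dwork_solutions lam| * (q - 1) = #|dwork_solutions lam|)%N.
Proof.
apply: card_dilation_orbits => [|c x c0]; first by rewrite inE eqxx.
rewrite !inE => /andP[x0 /eqP sum_x]; apply/andP; split.
  by apply: contraNneq x0 => cx0; rewrite -(dilateK c0 x) cx0; apply/eqP/ffunP => i; rewrite !ffunE mulr0.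
rewrite prod_dilate mulrCA -sum_x mulr_sumr; apply/eqP; apply: eq_bigr => i _.
by rewrite ffunE exprMn.
Qed.

Definition power_cone (k : F) : {set {ffun 'I_d -> F}} :=
  [set y : {ffun 'I_d -> F} | (\sum_i y i) ^+ d == k * \prod_i y i].

Lemma card_dwork_solutions lam : coprime (q - 1) d ->
  (#|dwork_solutions lam|.+1 = #|power_cone ((d%:R * lam) ^+ d)|)%N.
Proof.
move=> d_cop; have powI := expf_coprime_inj d_gt0 d_cop.
pose g (x : {ffun 'I_d -> F}) : {ffun 'I_d -> F} := [ffun i => x i ^+ d].
have g_inj : injective g.
  by move=> x y /ffunP gxy; apply/ffunP => i; have := gxy i; rewrite !ffunE; apply: powI.
have -> : power_cone ((d%:R * lam) ^+ d) = g @: ((0 : {ffun 'I_d -> F}) |: dwork_solutions lam).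
  apply/setP => y; rewrite -[y](f_finv g_inj) mem_imset // !inE; move: (finv g y) => x.
  have -> : \sum_i g x i = \sum_i x i ^+ d by apply: eq_bigr => i _; rewrite ffunE.
  have -> : \prod_i g x i = (\prod_i x i) ^+ d.
    by rewrite -prodrXl; apply: eq_bigr => i _; rewrite ffunE.
  rewrite -exprMn (inj_eq powI); case: (eqVneq x 0) => //= ->.
  rewrite big1 => [|i _]; last by rewrite ffunE expr0n gtn_eqF.
  by rewrite (bigD1 (Ordinal d_gt0)) //= ffunE mul0r mulr0 eqxx.
by rewrite card_imset // cardsU1 inE eqxx.
Qed.

(* The points of power_cone k off the coordinate hyperplanes, up to scaling. *)
Definition normalized_count (k : F) :=
  #|[set y : {ffun 'I_d -> F} | [&& nowhere_zero y, \sum_i y i == 1 & k * \prod_i y i == 1]]|.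

Lemma card_power_cone_nowhere_zero (k : F) : k != 0 ->
  #|[set y in power_cone k | nowhere_zero y]| = ((q - 1) * normalized_count k)%N.
Proof.
move=> k0; rewrite -sum1dep_card.
rewrite (partition_big (fun y : {ffun 'I_d -> F} => \sum_i y i) (fun s => s != 0)) /=; last first.
  move=> y /andP[]; rewrite inE nowhere_zeroE => y_cone y0; apply: contraTneq isT => s0.
  by move: y_cone; rewrite s0 expr0n gtn_eqF // eq_sym mulf_eq0 (negPf k0) (negPf y0).
rewrite (eq_bigr (fun=> normalized_count k)) => [|s s0].
  by rewrite sum_nat_const; congr (_ * _)%N; rewrite -card_finField_neq0.
rewrite sum1dep_card /normalized_count -!sum1dep_card (reindex_inj (dilate_inj s0)) /=.
apply: eq_bigl => y; rewrite !inE nowhere_zero_dilate // sum_dilate_eq // sum_dilate prod_dilate.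
case: (nowhere_zero y); rewrite ?andbF //= ?andbT andbC.
case: (eqVneq (\sum_i y i) 1) => //= ->.
by rewrite mulr1 mulrCA -{1}[s ^+ d]mulr1 (inj_eq (mulfI (expf_neq0 d s0))) eq_sym.
Qed.

Lemma card_hyperplane_power_cone (k : F) : k != 0 ->
  #|[set y : {ffun 'I_d -> F} | \sum_i y i == 0]|%:Z - #|power_cone k|%:Z =
  (nowhere_zero_count d (0 : F))%:Z - ((q - 1) * normalized_count k)%:Z.
Proof.
move=> k0; rewrite -card_power_cone_nowhere_zero //.
pose NZ := [set y : {ffun 'I_d -> F} | nowhere_zero y].
pose H := [set y : {ffun 'I_d -> F} | \sum_i y i == 0].
rewrite -/H -(cardsID NZ H) -(cardsID NZ (power_cone k)).
have -> : H :&: NZ = [set y : {ffun 'I_d -> F} | nowhere_zero y && (\sum_i y i == 0)].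
  by apply/setP => y; rewrite !inE andbC.
have -> : power_cone k :&: NZ = [set y in power_cone k | nowhere_zero y].
  by apply/setP => y; rewrite !inE.
have -> : H :\: NZ = power_cone k :\: NZ.
  apply/setP => y; rewrite !inE nowhere_zeroE negbK.
  by case: (\prod_i y i =P 0) => //= ->; rewrite mulr0 expf_eq0 d_gt0.
by rewrite /nowhere_zero_count !PoszD opprD addrACA subrr addr0.
Qed.

End DworkHypersurface.

(** * Point counts and McCarthy sums *)

Section PointDefect.
Variable F : finFieldType.
Local Notation q := #|F|.
Variables (d : nat) (d_gt0 : (0 < d)%N) (d_cop : coprime (q - 1) d).
Let q_gt1 : (1 < q)%N := finNzRing_gt1 F.
Let q1_gt0 : (0 < q - 1)%N. Proof. by rewrite subn_gt0. Qed.

Definition point_defect (lam : F) : int :=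
  ((q ^ d.-1).-1 %/ q.-1)%:Z - #|@dilation_orbit F d @: dwork_solutions d lam|%:Z.

Lemma point_defectE lam : (q - 1)%:Z * point_defect lam =
  #|[set y : {ffun 'I_d -> F} | \sum_i y i == 0]|%:Z - #|power_cone d ((d%:R * lam) ^+ d)|%:Z.
Proof.
have quot : ((q - 1) * ((q ^ d.-1).-1 %/ q.-1) = q ^ d.-1 - 1)%N.
  by rewrite !subn1 mulnC divnK // predn_exp dvdn_mulr.
have := card_dwork_orbits d lam; have := card_dwork_solutions d_gt0 lam d_cop.
have := card_hyperplane F d.-1; rewrite prednK // => cardH cardS cardO.
rewrite /point_defect mulrBr -!PoszM quot [(_ * #|_|)%N]mulnC cardO cardH -cardS; lia.
Qed.

Lemma point_defect0 : point_defect 0 = 0.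
Proof.
have /eqP : (q - 1)%:Z * point_defect 0 = 0.
  rewrite point_defectE mulr0 expr0n gtn_eqF //=; apply/eqP; rewrite subr_eq0; apply/eqP.
  by congr Posz; apply: eq_card => y; rewrite !inE mul0r expf_eq0 d_gt0.
by rewrite mulf_eq0 eqz_nat gtn_eqF //= => /eqP.
Qed.

Variables (B : comNzRingType) (om : F -> B).
Hypothesis om_char : separating_character om.

Lemma jacobi_sum0 : jacobi_sum om d 0 = (nowhere_zero_count d (1 : F))%:R.
Proof. by rewrite /nowhere_zero_count -sum1dep_card natr_sum; apply: eq_bigr => y _; rewrite expr0. Qed.

Lemma normalized_count_jacobi k : k != 0 ->
  (q - 1)%:R * (normalized_count d k)%:R = \sum_(j < q - 1) om k^-1 ^+ j * jacobi_sum om d j.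
Proof.
move=> k0; have omM : {morph om : x y / x * y} by case: om_char.
under eq_bigr => j _ do rewrite mulr_sumr.
rewrite exchange_big /normalized_count -sum1dep_card natr_sum mulr_sumr /=.
under eq_bigl do rewrite andbA.
rewrite big_mkcondr; apply: eq_bigr => y /andP[ny _].
under [in RHS]eq_bigr => j _ do rewrite -exprMn -omM -invfM.
rewrite sum_character_powers // ?invr_eq0 ?mulf_neq0 -?nowhere_zeroE //.
by rewrite invr_eq1; case: ifP; rewrite ?mulr1.
Qed.

Lemma point_defect_jacobi lam : odd d -> d%:R * lam != 0 ->
  (q - 1)%:R * (point_defect lam)%:~R =
  -1 - \sum_(1 <= j < q - 1) om ((d%:R * lam) ^- d) ^+ j * jacobi_sum om d j :> B.
Proof.
move=> d_odd dlam0; have k0 : (d%:R * lam) ^+ d != 0 by rewrite expf_neq0.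
have := normalized_count_jacobi k0.
rewrite -(big_mkord xpredT (fun j => om ((d%:R * lam) ^- d) ^+ j * jacobi_sum om d j)).
rewrite big_ltn // expr0 mul1r jacobi_sum0 => count_jacobi.
have := nowhere_zero_count_diff d (oner_neq0 F); rewrite -signr_odd d_odd expr1 => count_diff.
have /(congr1 (fun z : int => z%:~R : B)) := point_defectE lam.
rewrite card_hyperplane_power_cone //.
rewrite -(subrK (nowhere_zero_count d (1 : F))%:Z (nowhere_zero_count d (0 : F))%:Z).
rewrite count_diff PoszM !(intrM, intrB, intrD) -!pmulrn count_jacobi => ->; ring.
Qed.

End PointDefect.

Section McCarthySum.
Variables (p : nat) (p_pr : prime p) (p_odd : odd p) (r N : nat) (r_gt0 : (0 < r)%N).
Local Notation q := (p ^ r)%N.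
Variables (F : finFieldType) (cardF : #|F| = q).
Variables (d : nat) (d_odd : odd d) (d_gt1 : (1 < d)%N) (pd : coprime p d) (d_cop : coprime (q - 1) d).
Variables (B : comNzRingType) (iota : {rmorphism 'Z_(p ^ N.+1) -> B}) (om : F -> B).
Hypothesis om_lift : multiplicative_lift p om.

Lemma point_defect_mc_coef lam : lam != 0 ->
  \sum_(j < q - 1) iota (mc_coef p r N d j) * om (lam ^+ d)^-1 ^+ j =
  - ((q - 1)%:R * (p%:R ^+ (d.-1 * r) * (point_defect d lam)%:~R)).
Proof.
move=> lam0; rewrite -[LHS]opprK; congr (- _); apply/esym.
have d_gt0 := ltnW d_gt1.
have om_char := lift_separating om_lift (natrXS_eq0 p_pr iota).
have q1_gt0 : (0 < q - 1)%N by rewrite -cardF subn_gt0 finNzRing_gt1.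
have dlam0 : d%:R * lam != 0 by rewrite mulf_neq0 // (natr_finField_neq0 p_pr cardF).
have d_copF : coprime (#|F| - 1) d by rewrite cardF.
have := point_defect_jacobi d_gt0 d_copF om_char d_odd dlam0; rewrite cardF mulrCA => ->.
rewrite -(big_mkord xpredT (fun j => iota (mc_coef p r N d j) * om (lam ^+ d)^-1 ^+ j)).
rewrite [in RHS]big_ltn // mc_coef0 // rmorphXn rmorph_nat expr0 mulr1 mulrBr mulrN1 opprD.
congr (_ - _); rewrite mulr_sumr; apply: eq_big_nat => j j_bound.
rewrite (mc_coef_jacobi p_pr p_odd r_gt0 cardF d_odd d_gt1 pd d_cop iota om_lift j_bound).
have -> : om ((d%:R * lam) ^- d) ^+ j = om d%:R^-1 ^+ (d * j) * om (lam ^+ d)^-1 ^+ j.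
  rewrite exprM -exprMn (characterX om_char _ d); case: om_char => _ <- _.
  by rewrite exprMn invfM exprVn.
by ring.
Qed.

End McCarthySum.

(** * The residue rings of the integers of Q_q *)

Section TeichmullerLift.
Variables (p : nat) (r N : nat) (r_gt0 : (0 < r)%N).
Local Notation q := (p ^ r)%N.
Variables (F : finFieldType) (cardF : #|F| = q).
Variables (B : comNzRingType) (pN : (p%:R : B) ^+ N.+1 = 0) (rd : {rmorphism B -> F}).
Hypothesis rd_surj : forall t, exists x, rd x = t.
Hypothesis rd_ker : forall x, rd x = 0 -> exists y, x = p%:R * y.

Definition teichmuller_rep t x := (x ^+ q.-1 == 1) && (rd x == t).

Lemma residue_eqP x y : rd x = rd y -> exists c, x = y + p%:R * c.
Proof.
move=> xy; have [|c xyc] := @rd_ker (x - y); first by rewrite rmorphB xy subrr.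
by exists c; rewrite -xyc addrC subrK.
Qed.

Lemma residue_exp_eq x y : rd x = rd y -> x ^+ (q ^ N) = y ^+ (q ^ N).
Proof.
move=> /residue_eqP[c /(expr_exp_cong (r * N))[c' expE]]; rewrite -expnM expE.
have leN : (N.+1 <= (r * N).+1)%N by rewrite ltnS leq_pmull.
by rewrite -(subnK leN) exprD pN mulr0 mul0r addr0.
Qed.

Lemma teichmuller_rep_exists t : t != 0 -> exists x, teichmuller_rep t x.
Proof.
move=> t0; have [x xt] := rd_surj t; exists (x ^+ (q ^ N)); apply/andP; split; apply/eqP.
  rewrite exprAC (@residue_exp_eq _ 1) ?expr1n // rmorphXn xt rmorph1 -cardF -subn1.
  exact: expf_card_sub1.
rewrite rmorphXn xt -cardF; elim: N => [|m IHm]; first by rewrite expn0 expr1.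
by rewrite expnSr exprM IHm expf_card.
Qed.

Lemma teichmuller_rep_inj t x y : teichmuller_rep t x -> teichmuller_rep t y -> x = y.
Proof.
have q_gt0 : (0 < q)%N by rewrite -cardF ltnW // finNzRing_gt1.
have fixed (z : B) : z ^+ q.-1 = 1 -> z ^+ (q ^ N) = z.
  move=> z1; elim: N => [|m IHm]; first by rewrite expn0 expr1.
  by rewrite expnSr exprM IHm -(prednK q_gt0) exprS z1 mulr1.
move=> /andP[/eqP x1 /eqP xt] /andP[/eqP y1 /eqP yt].
by rewrite -(fixed x x1) -(fixed y y1); apply: residue_exp_eq; rewrite xt yt.
Qed.

Lemma teichmuller_multiplicative_lift om :
  om 0 = 0 -> (forall t, t != 0 -> teichmuller_rep t (om t)) -> multiplicative_lift p om.
Proof.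
move=> om0 omP; have rd_om x : rd (om x) = x.
  by have [->|/omP/andP[_ /eqP]] := eqVneq x 0; rewrite ?om0 ?rmorph0.
split=> // [|x y|x y].
- by apply: teichmuller_rep_inj (omP _ (oner_neq0 F)) _; rewrite /teichmuller_rep expr1n rmorph1 !eqxx.
- have [->|x0] := eqVneq x 0; first by rewrite !(mul0r, om0).
  have [->|y0] := eqVneq y 0; first by rewrite !(mulr0, om0).
  apply: teichmuller_rep_inj (omP _ (mulf_neq0 x0 y0)) _.
  have [/andP[/eqP x1 _] /andP[/eqP y1 _]] := (omP x x0, omP y y0).
  by rewrite /teichmuller_rep exprMn x1 y1 mulr1 rmorphM !rd_om !eqxx.
by apply: residue_eqP; rewrite rmorphD !rd_om.
Qed.

End TeichmullerLift.

(* The unused primality proof lets the morphism instances below be inferred. *)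
Definition residue_modp p of prime p := fun N (c : 'Z_(p ^ N.+1)) => (nat_of_ord c)%:R : 'F_p.

Section ResidueModp.
Variables (p : nat) (p_pr : prime p) (N : nat).
Local Notation rho := (@residue_modp p p_pr N).

Lemma residue_modp_nat n : rho n%:R = n%:R.
Proof.
rewrite /residue_modp val_Zp_nat ?expnS_gt1 ?prime_gt1 //.
have /dvdnP[k ->] : (p %| p ^ N.+1)%N by apply: dvdn_exp.
by rewrite [in RHS](divn_eq n (k * p)) natrD !natrM pchar_Fp_0 // !mulr0 add0r.
Qed.

Lemma residue_modp_zmod_morphism : zmod_morphism rho.
Proof.
move=> x y; have addM a b : rho (a + b) = rho a + rho b.
  rewrite -[a]natr_Zp -[b]natr_Zp -natrD !residue_modp_nat; exact: natrD.
by apply/eqP; rewrite eq_sym subr_eq -addM subrK.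
Qed.

Lemma residue_modp_monoid_morphism : monoid_morphism rho.
Proof.
split; first exact: (residue_modp_nat 1).
by move=> a b; rewrite -[a]natr_Zp -[b]natr_Zp -natrM !residue_modp_nat; exact: natrM.
Qed.

HB.instance Definition _ := GRing.isZmodMorphism.Build _ _ rho residue_modp_zmod_morphism.
HB.instance Definition _ := GRing.isMonoidMorphism.Build _ _ rho residue_modp_monoid_morphism.

Lemma residue_modp_eq0 c : rho c = 0 -> c = p%:R * (nat_of_ord c %/ p)%:R.
Proof.
move=> c0; have pc : (p %| nat_of_ord c)%N by rewrite (dvdn_pcharf (pchar_Fp p_pr)); apply/eqP.
by rewrite -natrM mulnC divnK // natr_Zp.
Qed.

End ResidueModp.

Section IntegerPolynomialReduction.
Variables (f : {poly int}) (f_monic : f \is monic) (R : comNzRingType).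

Lemma monic_map_intr : map_poly (fun c : int => c%:~R : R) f \is monic.
Proof. exact: (monic_map (intr : {rmorphism int -> R})). Qed.

Lemma size_map_intr : size (map_poly (fun c : int => c%:~R : R) f) = size f.
Proof. by rewrite size_map_poly_id0 // (monicP f_monic) oner_neq0. Qed.

End IntegerPolynomialReduction.

Section ResidueRing.
Variables (p : nat) (p_pr : prime p) (r N : nat) (r_gt0 : (0 < r)%N).
Variables (f : {poly int}) (f_monic : f \is monic) (f_size : size f = r.+1).
Local Notation Z := 'Z_(p ^ N.+1).
Local Notation rho := (@residue_modp p p_pr N).

Lemma fbar_monic : fbar p f \is monic. Proof. exact: monic_map_intr. Qed.

Lemma fN_monic : fN p f N \is monic. Proof. exact: monic_map_intr. Qed.

Lemma size_fbar : size (fbar p f) = r.+1. Proof. by rewrite /fbar size_map_intr. Qed.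

Lemma size_fN : size (fN p f N) = r.+1. Proof. by rewrite /fN size_map_intr. Qed.

Lemma mk_monic_fbar : mk_monic (fbar p f) = fbar p f.
Proof. by rewrite mk_monic_id ?fbar_monic // size_fbar. Qed.

Lemma mk_monic_fN : mk_monic (fN p f N) = fN p f N.
Proof. by rewrite mk_monic_id ?fN_monic // size_fN. Qed.

Lemma map_fN : map_poly rho (fN p f N) = fbar p f.
Proof. by apply/polyP => i; rewrite coef_map /fN /fbar !coef_map_id0 //; apply: rmorph_int. Qed.

Lemma red_zmod_morphism : zmod_morphism (@red p f N).
Proof.
have redE x : red x = in_qpoly (fbar p f) (map_poly rho (x : {poly Z})) by [].
by move=> x y; rewrite !redE !raddfB.
Qed.

Lemma red_monoid_morphism : monoid_morphism (@red p f N).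
Proof.
have redE x : red x = in_qpoly (fbar p f) (map_poly rho (x : {poly Z})) by [].
split; first by rewrite redE !rmorph1.
move=> x y; rewrite !redE poly_of_qpolyM -[RHS]rmorphM -rmorphM /=.
have := Pdiv.RingMonic.rdivp_eq (monic_mk_monic (fN p f N)) ((x : {poly Z}) * (y : {poly Z})).
move: (Pdiv.CommonRing.rdivp _ _) (Pdiv.CommonRing.rmodp _ _) => Q R ->.
rewrite rmorphD rmorphM /= mk_monic_fN map_fN [RHS]rmorphD rmorphM /=.
by rewrite in_qpoly_self ?fbar_monic ?size_fbar // mulr0 add0r.
Qed.

Lemma size_Fq (t : Fq p f) : (size (t : {poly 'F_p}) <= r)%N.
Proof. by apply: leq_trans (size_npoly t) _; rewrite mk_monic_fbar size_fbar. Qed.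

Lemma size_GR (x : GR p f N) : (size (x : {poly Z}) <= r)%N.
Proof. by apply: leq_trans (size_npoly x) _; rewrite mk_monic_fN size_fN. Qed.

Lemma GR_of_poly (P : {poly Z}) : (size P <= r)%N -> exists x : GR p f N, (x : {poly Z}) = P.
Proof.
move=> sizeP; have sizeP' : (size P <= (size (mk_monic (fN p f N))).-1)%N by rewrite mk_monic_fN size_fN.
by exists (@NPoly _ _ P sizeP').
Qed.

Lemma val_red (x : GR p f N) : (red x : {poly 'F_p}) = map_poly rho (x : {poly Z}).
Proof.
rewrite in_qpoly_small // mk_monic_fbar size_fbar ltnS.
exact: leq_trans (size_poly _ _) (size_GR x).
Qed.

Lemma red_surj (t : Fq p f) : exists x : GR p f N, red x = t.
Proof.
have [x xE] := @GR_of_poly (\poly_(i < r) (nat_of_ord (t : {poly 'F_p})`_i)%:R) (size_poly _ _).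
exists x; apply/val_inj; rewrite [LHS](val_red x) xE; apply/polyP => i.
rewrite coef_map /= coef_poly; case: ltnP => [_|le_ri].
  by rewrite residue_modp_nat natr_Zp.
by rewrite raddf0 nth_default // (leq_trans (size_Fq t)).
Qed.

Lemma red_ker (x : GR p f N) : red x = 0 -> exists y : GR p f N, x = p%:R * y.
Proof.
move=> x0; have [y yE] :=
  @GR_of_poly (\poly_(i < r) (nat_of_ord (x : {poly Z})`_i %/ p)%:R) (size_poly _ _).
have pyE : p%:R * y = p%:R *: y :> GR p f N by rewrite mulr_natl scaler_nat.
exists y; apply/val_inj; rewrite pyE [RHS]poly_of_qpolyZ yE; apply/polyP => i.
rewrite coefZ coef_poly; case: ltnP => [_|le_ri]; last first.
  by rewrite mulr0 nth_default // (leq_trans (size_GR x)).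
apply: (residue_modp_eq0 (p_pr := p_pr)).
have := congr1 (fun z : Fq p f => (z : {poly 'F_p})`_i) x0.
by rewrite val_red coef_map coef0.
Qed.

Hypothesis f_irr : irreducible_poly (fbar p f).

Definition Fq_irr : monic_irreducible_poly (fbar p f) := (f_irr, fbar_monic).

Definition Fq_field : finFieldType := {poly %/ fbar p f with Fq_irr}.

Lemma card_Fq_field : #|Fq_field| = (p ^ r)%N.
Proof. by rewrite card_qfpoly size_fbar /= card_Fp. Qed.

Definition red_morphism : {rmorphism GR p f N -> Fq_field} := HB.pack (@red p f N : GR p f N -> Fq_field)
  (GRing.isZmodMorphism.Build _ _ (@red p f N : GR p f N -> Fq_field) red_zmod_morphism)
  (GRing.isMonoidMorphism.Build _ _ (@red p f N : GR p f N -> Fq_field) red_monoid_morphism).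

Lemma teich_lift : multiplicative_lift p (teich r N : Fq_field -> GR p f N).
Proof.
have pN := natrXS_eq0 p_pr (GRing.in_alg (GR p f N)).
have surj t : exists x, red_morphism x = t by exact: red_surj.
have ker x : red_morphism x = 0 -> exists y, x = p%:R * y by exact: red_ker.
apply: (teichmuller_multiplicative_lift r_gt0 card_Fq_field pN ker) => [|t t0].
  by rewrite /teich eqxx.
rewrite /teich (negPf t0); case: pickP => [y //|no_rep].
have [y] := teichmuller_rep_exists r_gt0 card_Fq_field pN surj ker t0.
by rewrite /teichmuller_rep [_ && _]no_rep.
Qed.

Lemma teichbar_powE j (t : Fq_field) : t != 0 ->
  teichbar_pow r N j (t : Fq p f) = teich r N (t^-1 : Fq_field) ^+ j.
Proof.
move=> t0; rewrite /teichbar_pow [_ == 0](negPf t0) /teichbar [_ == 0](negPf t0); congr (_ ^+ j).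
have om_char := lift_separating teich_lift (natrXS_eq0 p_pr (GRing.in_alg (GR p f N))).
have inv : teich r N (t : Fq p f) * teich r N (t^-1 : Fq_field) = 1 := character_mulV om_char t0.
case: pickP => [y /= /eqP yt|/(_ (teich r N (t^-1 : Fq_field)))]; last by rewrite mulrC inv eqxx.
by rewrite -[LHS]mulr1 -inv mulrA yt mul1r.
Qed.

Lemma mcG_scaled_mc_coef d (t : Fq_field) : odd d -> t != 0 ->
  mcG_scaled r (fun i : 'I_d.-1 => i.+1%:R / d%:R) (fun=> 0) N (t : Fq p f) =
  - (GRing.in_alg (GR p f N) (p ^ r - 1)%:R^-1 *
     \sum_(j < p ^ r - 1) GRing.in_alg (GR p f N) (mc_coef p r N d j) * teich r N (t^-1 : Fq_field) ^+ j).
Proof.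
move=> d_odd t0; rewrite -mulNr -rmorphN mulr_sumr subn1; apply: eq_bigr => j _.
rewrite teichbar_powE // mulrA -rmorphM -mulr_algl; congr (_%:A * _).
have -> : (-1 : Z) ^+ (j * d.-1) = 1.
  by rewrite -signr_odd oddM -[odd d.-1]negbK -oddS prednK ?odd_gt0 // d_odd andbF.
by rewrite mulr1.
Qed.

Lemma mcG_scaled_at0 n (a b : 'I_n -> rat) : mcG_scaled r a b N (0 : Fq p f) = 0.
Proof. by rewrite /mcG_scaled big1 // => j _; rewrite /teichbar_pow eqxx scaler0. Qed.

Lemma GR_natr_unit m : coprime p m -> GRing.in_alg (GR p f N) m%:R^-1 * m%:R = 1.
Proof.
move=> pm; rewrite -(rmorph_nat (GRing.in_alg (GR p f N))) -rmorphM mulVr ?rmorph1 //.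
by rewrite natr_unit_Zpn // prime_gt1.
Qed.

End ResidueRing.

Lemma coprime_sub1_prime q d : prime d -> (0 < q)%N -> (q %% d != 1)%N -> coprime (q - 1) d.
Proof.
move=> d_pr q_gt0; rewrite coprime_sym prime_coprime //; apply: contra => /dvdnP[c qc].
by rewrite -(subnK q_gt0) qc modnMDl modn_small // prime_gt1.
Qed.

Theorem theorem1p3 (d p r : nat) (f : {poly int}) (lam : Fq p f) :
  prime d -> odd d -> prime p -> odd p -> p != d -> (0 < r)%N ->
  ((p ^ r) %% d != 1)%N ->
  f \is monic -> size f = r.+1 -> irreducible_poly (fbar p f) ->
  mcG_eq r (fun i : 'I_d.-1 => (i.+1)%:R / d%:R) (fun _ => 0) (lam ^+ d)
    ((((p ^ r) ^ d.-1).-1 %/ (p ^ r).-1)%:Z - (#|dwork_points d lam|)%:Z).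
Proof.
move=> d_pr d_odd p_pr p_odd pd r_gt0 qd f_monic f_size f_irr N.
have q_gt1 : (1 < p ^ r)%N by rewrite -(expn0 p) ltn_exp2l ?prime_gt1.
have cop_pd : coprime p d by rewrite prime_coprime // dvdn_prime2.
have cop_qd := coprime_sub1_prime d_pr (ltnW q_gt1) qd.
pose F := Fq_field f_monic f_irr.
have cardF : #|F| = (p ^ r)%N := card_Fq_field p_pr f_monic f_size f_irr.
have -> : (((p ^ r) ^ d.-1).-1 %/ (p ^ r).-1)%:Z - #|dwork_points d lam|%:Z = point_defect d (lam : F).
  by rewrite /point_defect cardF.
have [lam0|lam0] := eqVneq (lam : F) 0.
  rewrite lam0 (point_defect0 (prime_gt0 d_pr)) ?cardF // mulr0.
  by rewrite [_ ^+ d](expr0n F) gtn_eqF ?prime_gt0 //; apply: mcG_scaled_at0.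
rewrite [LHS](mcG_scaled_mc_coef p_pr N r_gt0 f_size d_odd (expf_neq0 d lam0)).
rewrite (point_defect_mc_coef p_pr p_odd r_gt0 cardF d_odd (prime_gt1 d_pr) cop_pd cop_qd
  (GRing.in_alg (GR p f N)) (teich_lift p_pr N r_gt0 f_monic f_size f_irr) lam0).
rewrite mulrN opprK [LHS]mulrA GR_natr_unit ?coprime_expn_sub1 ?subn_gt0 // mul1r.
by rewrite intrM -pmulrn natrX.
Qed.
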